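(* Let $M^6$ be a smooth 6-manifold with an $SU(3)$-structure $(g,J,\Psi)$, $\Psi=\Psi^++\sqrt{-1}\,\Psi^-$ (equivalently, an almost Hermitian 6-manifold $(M^6,g,J)$ whose canonical bundle is topologically trivial and trivialized by a $(3,0)$-form $\Psi$). The following two conditions are equivalent. (a) There exists a unique $SU(3)$-connection with torsion 3-form, i.e. a linear connection with totally skew-symmetric torsion which preserves the almost Hermitian structure and whose holonomy is contained in $SU(3)$. (b) The Nijenhuis tensor $N$ is totally skew-symmetric and $$d\Psi^+=\theta^6\wedge\Psi^+-\tfrac14(N,\Psi^+)\,{*F},\qquad d\Psi^-=\theta^6\wedge\Psi^--\tfrac14(N,\Psi^-)\,{*F}.$$ In this case the torsion is $$T=-{*dF}+{*(\theta^6\wedge F)}+\tfrac14(N,\Psi^+)\Psi^++\tfrac14(N,\Psi^-)\Psi^-,$$ and the Riemannian scalar curvature is $$s^g=\tfrac18(N,\Psi^+)^2+\tfrac18(N,\Psi^-)^2+2\|\theta^6\|^2-\tfrac1{12}\|T\|^2+3\,\delta\theta^6 .$$ In particular, if (under these conditions) the structure is complex and balanced, i.e. $N=0$ and $\theta^6=0$, then the Riemannian scalar curvature is non-positive.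
   Context: An $SU(3)$-structure on a 6-manifold is an almost Hermitian structure $(g,J)$ with fundamental form $F=g(\cdot,J\cdot)$ and a $(3,0)$-form $\Psi=\Psi^++\sqrt{-1}\,\Psi^-$ such that locally there is an orthonormal coframe $e_1,\dots,e_6$ (write $e_{ij\dots}=e_i\wedge e_j\wedge\cdots$) with $F=-e_{12}-e_{34}-e_{56}$, $\Psi=-(e_1+\sqrt{-1}e_2)\wedge(e_3+\sqrt{-1}e_4)\wedge(e_5+\sqrt{-1}e_6)$, so $\Psi^+=-e_{135}+e_{236}+e_{146}+e_{245}$, $\Psi^-=-e_{136}-e_{145}-e_{235}+e_{246}$. The orientation is $e_{123456}$, $*$ is the Hodge star, and $\delta$ is the codifferential ($\delta=-{*d*}$ on 2-forms and on 1-forms, so $\delta\theta=-\mathrm{div}\,\theta$). Lee form: $\theta^6(X)=(\delta F)(JX)$. Nijenhuis tensor: $N(X,Y)=[JX,JY]-[X,Y]-J[JX,Y]-J[X,JY]$ and $N(X,Y,Z)=g(N(X,Y),Z)$; it is totally skew-symmetric if the latter is a 3-form. $(\cdot,\cdot)$ is the inner product on forms for which the monomials $e_{i_1\dots i_p}$, $i_1<\dots<i_p$, are orthonormal; $\|\theta^6\|$ is the usual norm of a 1-form; for a 3-form, $\|T\|^2=\sum_{i,j,k}T(e_i,e_j,e_k)^2$. A metric connection with torsion 3-form $T$ is $\nabla=\nabla^g+\frac12T$, i.e. $g(\nabla_XY,Z)=g(\nabla^g_XY,Z)+\frac12T(X,Y,Z)$ with $\nabla^g$ the Levi-Civita connection.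 ''$SU(3)$-connection'' (preserving the almost Hermitian structure, holonomy in $SU(3)$) means $\nabla g=0$, $\nabla J=0$, $\nabla\Psi=0$. *)

(* Defs.v *)
From HB Require Import structures.
From mathcomp Require Export all_boot all_order all_algebra all_fingroup.
From mathcomp Require Export all_classical all_reals all_analysis.
Export Order.TTheory GRing.Theory Num.Theory numFieldNormedType.Exports.

(* A manifold is a topological space with a smooth atlas modelled on R^6.
   Tensor fields and connections are given, as usual in local coordinates, by
   their expressions in every chart of the atlas, subject to the transformation
   law on overlaps. Vectors of R^6 are row vectors, linear maps act on the right
   by matrices, and the arguments of a k-linear form are the k rows of a matrix.

   Conventions (d without factor 1/k, (e_1 /\ e_2)(E_1, E_2) = 1):
     (d alpha)(X, Y) = X alpha(Y) - Y alpha(X) - alpha([X, Y]). *)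

Set Implicit Arguments.
Unset Strict Implicit.
Unset Printing Implicit Defensive.

Local Open Scope classical_set_scope.
Local Open Scope ring_scope.

Notation vec R := 'rV[R]_6.

Section Smoothness.
Context {R : realType} {W : normedModType R}.

Fixpoint Ck_on (k : nat) (D : set (vec R)) (f : vec R -> W) : Prop :=
  {in D, continuous f} /\
  (if k is k'.+1 then
     forall v, (forall x, D x -> derivable f x v) /\ Ck_on k' D (fun x => 'D_v f x)
   else True).

(* meant for open D *)
Definition smooth_on (D : set (vec R)) (f : vec R -> W) : Prop :=
  forall k, Ck_on k D f.

End Smoothness.

Record chart (R : realType) (M : topologicalType) := Chart {
  dom : set M;
  cod : set (vec R);
  coord : M -> vec R;
  param : vec R -> M;
  dom_open : open dom;
  cod_open : open cod;
  coord_cod : forall p, dom p -> cod (coord p);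
  param_dom : forall x, cod x -> dom (param x);
  coordK : forall p, dom p -> param (coord p) = p;
  paramK : forall x, cod x -> coord (param x) = x;
  coord_cont : {in dom, continuous coord};
  param_cont : {in cod, continuous param} }.

Definition overlap (R : realType) (M : topologicalType) (a b : chart R M) :
    set (vec R) :=
  [set x | cod a x /\ dom b (param a x)].

Definition transition (R : realType) (M : topologicalType) (a b : chart R M) :
    vec R -> vec R :=
  coord b \o param a.

Record manifold6 (R : realType) := Manifold6 {
  points :> topologicalType;
  points_hausdorff : hausdorff_space points;
  points_countable : @second_countable points;
  index : Type;
  atlas : index -> chart R points;
  atlas_cover : forall p : points, exists c, dom (atlas c) p;
  atlas_smooth : forall a b,
    smooth_on (overlap (atlas a) (atlas b)) (transition (atlas a) (atlas b)) }.

Section Multilinear.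
Context {R : realType}.

Definition form (k : nat) := 'M[R]_(k, 6) -> R.

Definition set_row k (i : 'I_k) (u : vec R) (v : 'M[R]_(k, 6)) : 'M[R]_(k, 6) :=
  \matrix_(j < k) if j == i then u else row j v.

Definition is_form k (a : form k) : Prop :=
  (forall i v, scalar (fun u => a (set_row i u v))) /\
  (forall v i j, i != j -> row i v = row j v -> a v = 0).

Definition wedge p q (a : form p) (b : form q) : form (p + q) := fun v =>
  (p`! * q`!)%:R^-1 *
  \sum_(s : 'S_(p + q)) (-1) ^+ s *
    (a (usubmx (row_perm s v)) * b (dsubmx (row_perm s v))).

(* A coframe e_1, ..., e_6 at a point is an invertible matrix e, whose columns
   are the e_i: e_i(v) is the i-th entry of v *m e. The dual frame E_1, ..., E_6
   consists of the rows of invmx e. *)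
Definition frame (e : 'M[R]_6) : 'M[R]_6 := invmx e.

(* e_{i_1 ... i_k}, with 1-based indices *)
Definition monomial k (e : 'M[R]_6) (s : k.-tuple nat) : form k := fun v =>
  \det (\matrix_(a < k, b < k) (v *m e) a (inord (tnth s b).-1)).

(* In the next definitions, e is an orthonormal coframe, and the orientation is
   e_123456; rowsub f (frame e) is the list E_(f 0), ..., E_(f (k-1)). *)
Definition inner k (e : 'M[R]_6) (a b : form k) : R :=
  \sum_(f : {ffun 'I_k -> 'I_6} | [forall i : 'I_k, forall j : 'I_k, (i < j)%N ==> (f i < f j)%N])
    a (rowsub f (frame e)) * b (rowsub f (frame e)).

(* The Hodge star: a /\ *b = (a, b) e_123456, that is,
   *a = \sum_I a(E_I) e_123456(E_I, -) over the increasing multi-indices I;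
   the sum below is over all the multi-indices, whence the factor 1/p!. *)
Definition hodge p q (pq : (p + q = 6)%N) (e : 'M[R]_6) (a : form p) : form q :=
  fun w => (p`!)%:R^-1 *
    \sum_(f : {ffun 'I_p -> 'I_6}) a (rowsub f (frame e)) *
      monomial e [tuple 1; 2; 3; 4; 5; 6]%N
        (castmx (pq, erefl) (col_mx (rowsub f (frame e)) w)).

(* sum over all the indices, without factor 1/3! *)
Definition sqnorm3 (e : 'M[R]_6) (T : form 3) : R :=
  \sum_(f : {ffun 'I_3 -> 'I_6}) T (rowsub f (frame e)) ^+ 2.

End Multilinear.
Arguments form : clear implicits.

Section LocalCalculus.
Context {R : realType}.
Implicit Types (X Y : vec R -> vec R) (x u v w : vec R).

Definition lie_bracket X Y : vec R -> vec R :=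
  fun x => 'D_(X x) Y x - 'D_(Y x) X x.

Definition ext_deriv k (a : vec R -> form R k) : vec R -> form R k.+1 :=
  fun x (v : 'M[R]_(k.+1, 6)) =>
  \sum_(i < k.+1) (-1) ^+ i * 'D_(row i v) (fun y => a y (row' i v)) x.

(* delta = - * d *; here e is a local orthonormal coframe *)
Definition codiff p q (pq : (p.+1 + q = 6)%N) (qp : (q.+1 + p = 6)%N)
    (e : vec R -> 'M[R]_6) (a : vec R -> form R p.+1) : vec R -> form R p :=
  fun x (v : 'M[R]_(p, 6)) => - hodge qp (e x) (ext_deriv (fun y => hodge pq (e y) (a y)) x) v.

(* nabla_X Y for the connection with Christoffel symbols Gamma *)
Definition cov (Gamma : vec R -> vec R -> vec R -> vec R) X Y : vec R -> vec R :=
  fun x => 'D_(X x) Y x + Gamma x (X x) (Y x).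

(* The torsion, the curvature and the Nijenhuis tensor are tensors: it suffices
   to evaluate them on vector fields that are constant in the chart. *)
Definition torsion Gamma x u v : vec R :=
  cov Gamma (cst u) (cst v) x - cov Gamma (cst v) (cst u) x
  - lie_bracket (cst u) (cst v) x.

Definition curvature Gamma x u v w : vec R :=
  cov Gamma (cst u) (cov Gamma (cst v) (cst w)) x
  - cov Gamma (cst v) (cov Gamma (cst u) (cst w)) x
  - cov Gamma (lie_bracket (cst u) (cst v)) (cst w) x.

Definition nijenhuis (J : vec R -> 'M[R]_6) x u v : vec R :=
  let JX := fun y => u *m J y in
  let JY := fun y => v *m J y in
  lie_bracket JX JY x - lie_bracket (cst u) (cst v) x
  - lie_bracket JX (cst v) x *m J x - lie_bracket (cst u) JY x *m J x.

(* The value g(v, w) of a bilinear form with Gram matrix G *)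
Definition bilin (G : 'M[R]_6) v w : R := (v *m G *m w^T) 0 0.

(* The 3-form g(B(X, Y), Z) *)
Definition lower (G : 'M[R]_6) (B : vec R -> vec R -> vec R) : form R 3 := fun m =>
  bilin G (B (row (inord 0) m) (row (inord 1) m)) (row (inord 2) m).

(* Christoffel symbols of the Levi-Civita connection: by the Koszul formula,
   2 g(Gamma(v, w), z) = v.g(w, z) + w.g(v, z) - z.g(v, w) for constant v, w, z. *)
Definition levi_civita (g : vec R -> 'M[R]_6) x v w : vec R :=
  (\row_(j < 6) (2^-1 *
     ('D_v (fun y => bilin (g y) w (delta_mx 0 j)) x
      + 'D_w (fun y => bilin (g y) v (delta_mx 0 j)) x
      - 'D_(delta_mx 0 j) (fun y => bilin (g y) v w) x))) *m invmx (g x).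

Definition scalar_curvature (g : vec R -> 'M[R]_6) (e : 'M[R]_6) x : R :=
  \sum_(i < 6) \sum_(j < 6)
    bilin (g x) (curvature (levi_civita g) x (row i (frame e)) (row j (frame e))
                   (row j (frame e))) (row i (frame e)).

Definition parallel_metric Gamma (g : vec R -> 'M[R]_6) x : Prop :=
  forall v w z, 'D_v (fun y => bilin (g y) w z) x
    = bilin (g x) (Gamma x v w) z + bilin (g x) w (Gamma x v z).

(* nabla_v (J w) = J (nabla_v w) *)
Definition parallel_endo (Gamma : vec R -> vec R -> vec R -> vec R)
    (J : vec R -> 'M[R]_6) x : Prop :=
  forall v w, cov Gamma (cst v) (fun y => w *m J y) x
    = cov Gamma (cst v) (cst w) x *m J x.

Definition parallel_form k (Gamma : vec R -> vec R -> vec R -> vec R)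
    (a : vec R -> form R k) x : Prop :=
  forall v m, 'D_v (fun y => a y m) x
    = \sum_(i < k) a x (set_row i (Gamma x v (row i m)) m).

End LocalCalculus.

Section SU3.
Context {R : realType}.

Definition fundamental (G J : 'M[R]_6) : form R 2 := fun m =>
  bilin G (row (inord 0) m) (row (inord 1) m *m J).

(* The formulas for P and Q are the real and imaginary parts of
   - (e_1 + i e_2) /\ (e_3 + i e_4) /\ (e_5 + i e_6). *)
Definition adapted_at (G J : 'M[R]_6) (P Q : form R 3) (e : 'M[R]_6) : Prop :=
  [/\ e \in unitmx,
      (forall v w, bilin G v w = \sum_(i < 6) (v *m e) 0 i * (w *m e) 0 i),
      (forall m, fundamental G J m =
         - monomial e [tuple 1; 2]%N m - monomial e [tuple 3; 4]%N m
         - monomial e [tuple 5; 6]%N m),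
      (forall m, P m =
         - monomial e [tuple 1; 3; 5]%N m + monomial e [tuple 2; 3; 6]%N m
         + monomial e [tuple 1; 4; 6]%N m + monomial e [tuple 2; 4; 5]%N m)
    & (forall m, Q m =
         - monomial e [tuple 1; 3; 6]%N m - monomial e [tuple 1; 4; 5]%N m
         - monomial e [tuple 2; 3; 5]%N m + monomial e [tuple 2; 4; 6]%N m)].

Variable M : manifold6 R.
Implicit Types (a b c : index M) (x v w : vec R).

(* the differential of the change of coordinates *)
Definition dtrans a b x v : vec R := 'D_v (transition (atlas a) (atlas b)) x.

Definition tensorial_metric (g : index M -> vec R -> 'M[R]_6) : Prop :=
  forall a b x, overlap (atlas a) (atlas b) x -> forall v w,
    bilin (g a x) v w =
    bilin (g b (transition (atlas a) (atlas b) x)) (dtrans a b x v) (dtrans a b x w).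

Definition tensorial_endo (J : index M -> vec R -> 'M[R]_6) : Prop :=
  forall a b x, overlap (atlas a) (atlas b) x -> forall v,
    dtrans a b x (v *m J a x) =
    dtrans a b x v *m J b (transition (atlas a) (atlas b) x).

Definition tensorial_form k (P : index M -> vec R -> form R k) : Prop :=
  forall a b x, overlap (atlas a) (atlas b) x -> forall m,
    P a x m = P b (transition (atlas a) (atlas b) x)
                (\matrix_(i < k) dtrans a b x (row i m)).

Definition smooth_form k (P : index M -> vec R -> form R k) : Prop :=
  [/\ forall c x, cod (atlas c) x -> is_form (P c x),
      forall c m, smooth_on (cod (atlas c)) (fun x => P c x m : R)
    & tensorial_form P].

(* Psip and Psim are the real and imaginary parts of Psi. *)
Record su3_structure := SU3Structure {
  met : index M -> vec R -> 'M[R]_6;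
  acs : index M -> vec R -> 'M[R]_6;
  Psip : index M -> vec R -> form R 3;
  Psim : index M -> vec R -> form R 3;
  met_smooth : forall c, smooth_on (cod (atlas c)) (met c);
  met_tensorial : tensorial_metric met;
  met_sym : forall c x, cod (atlas c) x -> (met c x)^T = met c x;
  met_pos : forall c x, cod (atlas c) x -> forall v, v != 0 -> 0 < bilin (met c x) v v;
  acs_smooth : forall c, smooth_on (cod (atlas c)) (acs c);
  acs_tensorial : tensorial_endo acs;
  acs_sqr : forall c x, cod (atlas c) x -> acs c x *m acs c x = - 1%:M;
  acs_hermitian : forall c x, cod (atlas c) x -> forall v w,
    bilin (met c x) (v *m acs c x) (w *m acs c x) = bilin (met c x) v w;
  Psip_form : smooth_form Psip;
  Psim_form : smooth_form Psim;
  su3_coframe : forall c x, cod (atlas c) x ->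
    exists (U : set (vec R)) (e : vec R -> 'M[R]_6),
      [/\ open U, U x, U `<=` cod (atlas c), smooth_on U e
        & forall y, U y -> adapted_at (met c y) (acs c y) (Psip c y) (Psim c y) (e y)] }.

Variable S : su3_structure.

(* Two adapted coframes differ by a function with values in SU(3), hence all the
   quantities below that mention an adapted coframe do not depend on it. *)
Definition adapted c (U : set (vec R)) (e : vec R -> 'M[R]_6) : Prop :=
  [/\ open U, U `<=` cod (atlas c), smooth_on U e
    & forall x, U x ->
        adapted_at (met S c x) (acs S c x) (Psip S c x) (Psim S c x) (e x)].

Definition fund c x : form R 2 := fundamental (met S c x) (acs S c x).

(* theta(X) = (delta F)(J X) *)
Definition lee c (e : vec R -> 'M[R]_6) x : form R 1 := fun v =>
  codiff (p := 1) (q := 4) erefl erefl e (fund c) x (v *m acs S c x).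

(* N(X, Y, Z) = g(N(X, Y), Z) *)
Definition nij c x : form R 3 := lower (met S c x) (nijenhuis (acs S c) x).

Definition star_fund c (e : vec R -> 'M[R]_6) x : form R 4 :=
  hodge (p := 2) (q := 4) erefl (e x) (fund c x).

Definition connection_data := index M -> vec R -> vec R -> vec R -> vec R.

Definition is_connection (nabla : connection_data) : Prop :=
  [/\ (forall c x, cod (atlas c) x -> forall v, linear (nabla c x v)),
      (forall c x, cod (atlas c) x -> forall w, linear (nabla c x ^~ w)),
      (forall c v w, smooth_on (cod (atlas c)) (fun x => nabla c x v w))
    & (forall a b x, overlap (atlas a) (atlas b) x -> forall v w,
         dtrans a b x (nabla a x v w) =
         'D_v (fun y => dtrans a b y w) x
         + nabla b (transition (atlas a) (atlas b) x) (dtrans a b x v) (dtrans a b x w))].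

Definition connection_eq (nabla nabla' : connection_data) : Prop :=
  forall c x, cod (atlas c) x -> forall v w, nabla c x v w = nabla' c x v w.

(* T(X, Y, Z) = g(T(X, Y), Z) *)
Definition torsion_form (nabla : connection_data) c x : form R 3 :=
  lower (met S c x) (torsion (nabla c) x).

Definition su3_connection_skew_torsion (nabla : connection_data) : Prop :=
  is_connection nabla /\
  forall c x, cod (atlas c) x ->
    [/\ parallel_metric (nabla c) (met S c) x,
        parallel_endo (nabla c) (acs S c) x,
        parallel_form (nabla c) (Psip S c) x,
        parallel_form (nabla c) (Psim S c) x
      & is_form (torsion_form nabla c x)].

Definition skew_nijenhuis : Prop :=
  forall c x, cod (atlas c) x -> is_form (nij c x).

(* d P = theta /\ P - 1/4 (N, P) *F *)
Definition structure_eq (P : index M -> vec R -> form R 3) : Prop :=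
  forall c U e, adapted c U e -> forall x, U x -> forall m : 'M[R]_(4, 6),
    ext_deriv (P c) x m =
    wedge (lee c e x) (P c x) m
    - 4^-1 * inner (e x) (nij c x) (P c x) * star_fund c e x m.

Definition scal c (e : vec R -> 'M[R]_6) x : R := scalar_curvature (met S c) (e x) x.

(* delta theta, a 0-form, evaluated at the empty list of vectors *)
Definition codiff_lee c (e : vec R -> 'M[R]_6) x : R :=
  codiff (p := 0) (q := 5) erefl erefl e (lee c e) x 0.

End SU3.

(* Main.v *)
From HB Require Import structures.
Require Import Defs.
From Stdlib Require Import PeanoNat.
From mathcomp Require Import ring lra zify.

Set Implicit Arguments.
Unset Strict Implicit.
Unset Printing Implicit Defensive.

Local Open Scope ring_scope.

(** Near a point, fix an adapted coframe e with dual frame E. The components of F, Psi+ and Psi- are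
    constant in it, so dF, dPsi+, dPsi-, theta and N are linear in the numbers b_kij = (E_k
    e_j)(E_i) of [coframe_deriv]. They see these numbers only through de_j(E_k, E_i) = b_kij -
    b_ikj, hence through the Levi-Civita coefficients [koszul b].

    A connection preserves g, J and Psi at the point exactly when its connection matrices in the
    frame lie in su(3) ([parallel_metricE], [parallel_endoE], [parallel_formE]). Writing its torsion
    as T = 2t, total skewness says that the Levi-Civita matrices are w_k - t_k with w_k in su(3) and
    t a 3-form; this is [su3_relation]. The first half of the theorem is therefore linear algebra at
    a point.

    Uniqueness holds because su(3)-valued 1-forms and 3-forms meet only in 0 ([su3_skew3_eq0]). For
    (a) => (b) and the torsion formula, one substitutes w - t for the Levi-Civita coefficients and
    compares components; the resulting identities hold for all w and t ([leec_su3], [nijc_su3],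
    [ext_tP_su3], [ext_tQ_su3], [torsion_su3]). For (b) => (a), an explicit linear expression
    [half_torsion] in the Levi-Civita coefficients is the candidate for t: total skewness of N makes
    the matrices w = lc + t commute with J ([half_torsion_commutes]), and the equations for dPsi+
    and dPsi- remove their complex trace ([half_torsion_trace]).

    Since the connection is unique at each point, it is the same for all adapted coframes. It is
    smooth by the explicit formula, and it obeys the transformation law because the Levi-Civita
    coefficients in a frame do not depend on the chart ([koszul_pullback], [christoffel_pullback]).

    The scalar curvature involves first derivatives of the coefficients. Differentiating
    [su3_relation] keeps the derivatives of w in su(3). Contracting the first Bianchi identity, in
    the form d(de_j) = 0, twice with F then eliminates them, and the derivatives of t survive only
    in delta theta ([scalc_su3]). When N = 0 and theta = 0, the formula leaves -|T|^2 / 12.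

    The analytic input is that functions with continuous directional derivatives are differentiable
    and that second derivatives commute ([differentiable_C1], [deriveC]); the latter gives d(de_j) =
    0 and the independence of the chart. *)

Section Tables.
Variable R : realFieldType.

(** * Tensors in an adapted frame as computable tables *)

Definition sum6 (f : nat -> R) : R :=
  f 0%N + f 1%N + f 2%N + f 3%N + f 4%N + f 5%N.

Fixpoint sumto (n : nat) (f : nat -> R) : R :=
  if n is m.+1 then sumto m f + f m else 0.

(** [sg] and [cj] encode the complex structure: J E_i is E_(cj i) with the sign given by [sg i]. *)
Definition sg (i : nat) (x : R) : R := if Nat.odd i then - x else x.

Definition cj (i : nat) : nat := if Nat.odd i then i.-1 else i.+1.

Fixpoint extract (x : nat) (t : seq nat) : option (bool * seq nat) :=
  if t is y :: t' then
    if Nat.eqb x y then Some (false, t')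
    else if extract x t' is Some (c, r) then Some (negb c, y :: r) else None
  else None.

(** Sign of the permutation taking one list to the other (true for odd), as the Laplace expansion of
    a 0-1 matrix along its rows; [None] stands for a vanishing determinant. *)
Fixpoint esign (s t : seq nat) : option bool :=
  if s is x :: s' then
    if extract x t is Some (c, t') then
      if esign s' t' is Some d then Some (if c then negb d else d) else None
    else None
  else if t is [::] then Some false else None.

(** The generalised Kronecker symbol: for distinct entries of t it is the value of the monomial e_t
    on the frame vectors E_s ([monomial_basis]). *)
Definition eps (s t : seq nat) : R :=
  if esign s t is Some c then if c then - 1 else 1 else 0.

Definition without (i : nat) (p : seq nat) := take i p ++ drop i.+1 p.

(** Exterior derivative of a k-form with constant components t in the moving frame: only the
    derivatives of the coframe contribute. *)
Definition ext (k : nat) (b : nat -> nat -> nat -> R) (t : seq nat -> R)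
    (p : seq nat) : R :=
  sumto k.+1 (fun i => sg i (sumto k (fun j => sum6 (fun l =>
    b (nth 0%N p i) (nth 0%N (without i p) j) l
    * t (set_nth 0%N (without i p) j l))))).

Fixpoint notin (x : nat) (s : seq nat) : bool :=
  if s is y :: s' then if Nat.eqb x y then false else notin x s' else true.

Fixpoint compl (r s : seq nat) : seq nat :=
  if r is x :: r' then if notin x s then x :: compl r' s else compl r' s
  else [::].

Definition six := [:: 0; 1; 2; 3; 4; 5]%N.

(** In the sum defining the Hodge star only the multi-index complementary to s survives. *)
Definition hod (t : seq nat -> R) (s : seq nat) : R :=
  t (compl six s) * eps (compl six s ++ s) six.

Definition wedge1 (k : nat) (a : nat -> R) (t : seq nat -> R) (p : seq nat) : R :=
  sumto k.+1 (fun i => sg i (a (nth 0%N p i) * t (without i p))).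

Definition tF (s : seq nat) : R :=
  - eps s [:: 0; 1]%N - eps s [:: 2; 3]%N - eps s [:: 4; 5]%N.
Definition tP (s : seq nat) : R :=
  - eps s [:: 0; 2; 4]%N + eps s [:: 1; 2; 5]%N + eps s [:: 0; 3; 5]%N
  + eps s [:: 1; 3; 4]%N.
Definition tQ (s : seq nat) : R :=
  - eps s [:: 0; 2; 5]%N - eps s [:: 0; 3; 4]%N - eps s [:: 1; 2; 4]%N
  + eps s [:: 1; 3; 5]%N.

Definition dotP (n : nat -> nat -> nat -> R) : R :=
  - n 0%N 2%N 4%N + n 1%N 2%N 5%N + n 0%N 3%N 5%N + n 1%N 3%N 4%N.
Definition dotQ (n : nat -> nat -> nat -> R) : R :=
  - n 0%N 2%N 5%N - n 0%N 3%N 4%N - n 1%N 2%N 4%N + n 1%N 3%N 5%N.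

(** Entry of D_(E_k) J in the frame, obtained by differentiating J e = e J_0 with J_0 constant. *)
Definition dacs (b : nat -> nat -> nat -> R) (k i j : nat) : R :=
  - sg j (b k i (cj j)) - sg i (b k (cj i) j).

Definition nijc (b : nat -> nat -> nat -> R) (u v j : nat) : R :=
  sg u (dacs b (cj u) v j) - sg v (dacs b (cj v) u j)
  + sg j (dacs b u v (cj j) - dacs b v u (cj j)).

Definition leec (b : nat -> nat -> nat -> R) (i : nat) : R :=
  - sg i (hod (ext 4 b (hod tF)) [:: cj i]).

(* the skew tensor with given components at increasing indices *)
Definition skew3 (t : nat -> nat -> nat -> R) (i j k : nat) : R :=
  if Nat.ltb i j then
    if Nat.ltb j k then t i j k else if Nat.eqb k j then 0
    else if Nat.ltb i k then - t i k j else if Nat.eqb i k then 0 else t k i j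
  else if Nat.eqb i j then 0
  else if Nat.ltb i k then - t j i k else if Nat.eqb i k then 0
  else if Nat.ltb j k then t j k i else if Nat.eqb j k then 0 else - t k j i.

(* [- (T_k12 + T_k34 + T_k56)], half of the trace of T_k against F *)
Definition leet (t : nat -> nat -> nat -> R) (k : nat) : R :=
  t k 0%N 1%N + t k 2%N 3%N + t k 4%N 5%N.

(** Like [skew3], it reads only entries at increasing indices, so a generic table parametrises the
    skew ones and identities become polynomial in free variables. *)
Definition skew2 (l : nat -> nat -> nat -> R) (k i j : nat) : R :=
  if Nat.ltb i j then l k i j else if Nat.eqb i j then 0 else - l k j i.

Definition sym12 (s : nat -> nat -> nat -> R) (k i j : nat) : R :=
  if Nat.ltb k i then s k i j else s i k j.

(* the general element of su(3), from 8 of its entries *)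
Definition su3 (w : nat -> nat -> R) (i j : nat) : R :=
  match i, j with
  | 0%N, 1%N => w 0%N 1%N | 1%N, 0%N => - w 0%N 1%N
  | 2%N, 3%N => w 2%N 3%N | 3%N, 2%N => - w 2%N 3%N
  | 4%N, 5%N => - w 0%N 1%N - w 2%N 3%N | 5%N, 4%N => w 0%N 1%N + w 2%N 3%N
  | 0%N, 2%N | 1%N, 3%N => w 0%N 2%N | 2%N, 0%N | 3%N, 1%N => - w 0%N 2%N
  | 0%N, 3%N | 2%N, 1%N => w 0%N 3%N | 3%N, 0%N | 1%N, 2%N => - w 0%N 3%N
  | 0%N, 4%N | 1%N, 5%N => w 0%N 4%N | 4%N, 0%N | 5%N, 1%N => - w 0%N 4%N
  | 0%N, 5%N | 4%N, 1%N => w 0%N 5%N | 5%N, 0%N | 1%N, 4%N => - w 0%N 5%N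
  | 2%N, 4%N | 3%N, 5%N => w 2%N 4%N | 4%N, 2%N | 5%N, 3%N => - w 2%N 4%N
  | 2%N, 5%N | 4%N, 3%N => w 2%N 5%N | 5%N, 2%N | 3%N, 4%N => - w 2%N 5%N
  | _, _ => 0
  end.

(** For the coefficients l of a torsion-free connection this is de_j(E_k, E_i), that is, minus the
    E_j-component of [E_k, E_i]. *)
Definition acoef (l : nat -> nat -> nat -> R) (k i j : nat) : R :=
  l i k j - l k i j.

(** Sum of g(R(E_a, E_b) E_b, E_a); here [dl a k i j] is the derivative of [l k i j] along E_a. *)
Definition scalc (l : nat -> nat -> nat -> R) (dl : nat -> nat -> nat -> nat -> R) : R :=
  sum6 (fun a => sum6 (fun b => dl a b b a - dl b a b a
    + sum6 (fun k => acoef l a b k * l k b a + l b b k * l a k a - l a b k * l b k a))).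

(** The value of d(de_j) on (E_a, E_b, E_c). Its vanishing is the Jacobi identity of the frame,
    equivalently the first Bianchi identity. *)
Definition jacobi (l : nat -> nat -> nat -> R) (dl : nat -> nat -> nat -> nat -> R)
    (a b c j : nat) : R :=
  let f a b c := acoef (dl a) b c j + sum6 (fun m => acoef l a b m * acoef l m c j) in
  f a b c + f b c a + f c a b.

(* [- * d * theta], where [dth i j] is the derivative of theta_j along E_i *)
Definition codiff1 (b : nat -> nat -> nat -> R) (th : nat -> R)
    (dth : nat -> nat -> R) : R :=
  - (sumto 6 (fun i => sg i (hod (fun s => dth i (nth 0%N s 0)) (without i six)))
     + ext 5 b (hod (fun s => th (nth 0%N s 0))) six).

End Tables.

(** At literal indices all tables reduce to polynomials in their entries, while the operations of R
    stay folded, so that [ring] and [lra] can finish. This is why indices are naturals with boolean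
    tests and not ordinals. *)
Ltac tab := cbv beta iota zeta delta
  [sum6 sumto sg cj extract esign eps without ext notin compl six hod wedge1 tF tP
   tQ dotP dotQ dacs nijc leec leet skew3 skew2 sym12 su3 acoef scalc jacobi codiff1
   Nat.ltb Nat.leb Nat.eqb Nat.odd Nat.even negb Nat.pred nth take drop cat set_nth
   ncons iter Nat.add].

Lemma incr3P (Q : nat -> nat -> nat -> Prop) :
  Q 0%N 1%N 2%N -> Q 0%N 1%N 3%N -> Q 0%N 1%N 4%N -> Q 0%N 1%N 5%N -> Q 0%N 2%N 3%N -> Q 0%N 2%N 4%N -> Q 0%N 2%N 5%N ->
  Q 0%N 3%N 4%N -> Q 0%N 3%N 5%N -> Q 0%N 4%N 5%N -> Q 1%N 2%N 3%N -> Q 1%N 2%N 4%N -> Q 1%N 2%N 5%N -> Q 1%N 3%N 4%N ->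
  Q 1%N 3%N 5%N -> Q 1%N 4%N 5%N -> Q 2%N 3%N 4%N -> Q 2%N 3%N 5%N -> Q 2%N 4%N 5%N -> Q 3%N 4%N 5%N ->
  forall i j k, (i < j)%N -> (j < k)%N -> (k < 6)%N -> Q i j k.
Proof.
move=> ? ? ? ? ? ? ? ? ? ? ? ? ? ? ? ? ? ? ? ? i j k.
by case: k => [//|[|[|[|[|[|[|//]]]]]]]; case: j => [//|[|[|[|[|//]]]]];
  case: i => [|[|[|[|//]]]].
Qed.

Lemma incr4P (Q : nat -> nat -> nat -> nat -> Prop) :
  Q 0%N 1%N 2%N 3%N -> Q 0%N 1%N 2%N 4%N -> Q 0%N 1%N 2%N 5%N -> Q 0%N 1%N 3%N 4%N -> Q 0%N 1%N 3%N 5%N -> Q 0%N 1%N 4%N 5%N ->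
  Q 0%N 2%N 3%N 4%N -> Q 0%N 2%N 3%N 5%N -> Q 0%N 2%N 4%N 5%N -> Q 0%N 3%N 4%N 5%N -> Q 1%N 2%N 3%N 4%N -> Q 1%N 2%N 3%N 5%N ->
  Q 1%N 2%N 4%N 5%N -> Q 1%N 3%N 4%N 5%N -> Q 2%N 3%N 4%N 5%N ->
  forall i j k m, (i < j)%N -> (j < k)%N -> (k < m)%N -> (m < 6)%N -> Q i j k m.
Proof.
move=> ? ? ? ? ? ? ? ? ? ? ? ? ? ? ? i j k m.
case: m => [//|[|[|[|[|[|//]]]]]]; case: k => [//|[|[|[|[|//]]]]];
case: j => [//|[|[|[|//]]]]; by case: i => [|[|[|//]]].
Qed.

Lemma eq_sumto (R : realFieldType) n (f g : nat -> R) :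
  (forall i, (i < n)%N -> f i = g i) -> sumto n f = sumto n g.
Proof.
elim: n => //= n IH fg; rewrite fg // IH // => i /ltnW ?; exact: fg.
Qed.

Lemma eq_wedge1 (R : realFieldType) k (a a' : nat -> R) t p :
  (forall i, (i < 6)%N -> a i = a' i) -> all (ltn^~ 6) p ->
  wedge1 k a t p = wedge1 k a' t p.
Proof.
move=> aa' /all_nthP p6; apply: eq_sumto => i _; congr (sg i (_ * _)); apply: aa'.
by have [/(p6 0%N) //|?] := ltnP i (size p); rewrite nth_default.
Qed.

(** * Identities when the Levi-Civita coefficients are su(3) minus a 3-form *)

Section Pointwise.
Variable R : realFieldType.
Variables s w t : nat -> nat -> nat -> R.
Let lc k i j : R := su3 (w k) i j - skew3 t k i j.
(** Every b splits in this way, with s = b + lc, because the Levi-Civita connection is torsion-free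
    ([koszul_decomposition]); s cancels in all antisymmetrised expressions. *)
Let b k i j : R := sym12 s k i j - lc k i j.

Let theta i : R := - sg i (2 * leet (skew3 t) (cj i)).

Lemma leec_su3 i : (i < 6)%N -> leec b i = theta i.
Proof. by rewrite /b /lc /theta; do 6 (case: i => [_|i]; [tab; ring|]). Qed.

(** Since w commutes with J, only t enters N. What remains is four times the part of type
    (3,0)+(0,3) of T = 2t, and this type is spanned by Psi+ and Psi-. *)
Lemma nijc_su3 i j k : (i < 6)%N -> (j < 6)%N -> (k < 6)%N ->
  nijc b i j k = 2 * dotP t * tP R [:: i; j; k] + 2 * dotQ t * tQ R [:: i; j; k].
Proof.
rewrite /b /lc.
by do 6 (case: i => [_|i]; [by do 6 (case: j => [_|j]; [
  by do 6 (case: k => [_|k]; [tab; ring|])|])|]).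
Qed.

(** Psi+ and Psi- are orthogonal of square norm 4, whence 8 = 2 * 4. *)
Lemma dotP_nijc_su3 : dotP (nijc b) = 8 * dotP t.
Proof. by rewrite {1}/dotP !nijc_su3 //; tab; ring. Qed.

Lemma dotQ_nijc_su3 : dotQ (nijc b) = 8 * dotQ t.
Proof. by rewrite {1}/dotQ !nijc_su3 //; tab; ring. Qed.

(** As su(3) annihilates Psi+, dPsi+ is linear in t alone: the Lee part of t produces the wedge with
    theta, the part of type (3,0)+(0,3) produces the multiple of *F, and the rest contributes
    nothing. *)
Lemma ext_tP_su3 i j k m : (i < j)%N -> (j < k)%N -> (k < m)%N -> (m < 6)%N ->
  ext 3 b (tP R) [:: i; j; k; m] =
  wedge1 3 (leec b) (tP R) [:: i; j; k; m]
  - 4^-1 * dotP (nijc b) * hod (tF R) [:: i; j; k; m].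
Proof.
rewrite dotP_nijc_su3 (_ : 4^-1 * (8 * dotP t) = 2 * dotP t); last by field.
move: i j k m; apply: incr4P; rewrite (eq_wedge1 _ _ leec_su3) //.
all: by rewrite /b /lc /theta; tab; ring.
Qed.

Lemma ext_tQ_su3 i j k m : (i < j)%N -> (j < k)%N -> (k < m)%N -> (m < 6)%N ->
  ext 3 b (tQ R) [:: i; j; k; m] =
  wedge1 3 (leec b) (tQ R) [:: i; j; k; m]
  - 4^-1 * dotQ (nijc b) * hod (tF R) [:: i; j; k; m].
Proof.
rewrite dotQ_nijc_su3 (_ : 4^-1 * (8 * dotQ t) = 2 * dotQ t); last by field.
move: i j k m; apply: incr4P; rewrite (eq_wedge1 _ _ leec_su3) //.
all: by rewrite /b /lc /theta; tab; ring.
Qed.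

(** As su(3) preserves F, dF is a linear image of T = 2t, and -*dF recovers T up to its Lee part and
    its part of type (3,0)+(0,3); the other terms make up for the difference. *)
Lemma torsion_su3 i j k : (i < j)%N -> (j < k)%N -> (k < 6)%N ->
  2 * skew3 t i j k =
  - hod (ext 2 b (tF R)) [:: i; j; k] + hod (wedge1 2 (leec b) (tF R)) [:: i; j; k]
  + 4^-1 * dotP (nijc b) * tP R [:: i; j; k]
  + 4^-1 * dotQ (nijc b) * tQ R [:: i; j; k].
Proof.
rewrite dotP_nijc_su3 (_ : 4^-1 * (8 * dotP t) = 2 * dotP t); last by field.
rewrite dotQ_nijc_su3 (_ : 4^-1 * (8 * dotQ t) = 2 * dotQ t); last by field.
move: i j k; apply: incr3P; rewrite /hod (eq_wedge1 _ _ leec_su3) //.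
all: by rewrite /b /lc /theta; tab; ring.
Qed.

Section SecondOrder.
Variables (dw dt : nat -> nat -> nat -> nat -> R).
Let dlc a k i j : R := su3 (dw a k) i j - skew3 (dt a) k i j.
Let dtheta a i : R := - sg i (2 * leet (skew3 (dt a)) (cj i)).

(** The right-hand side is minus the Levi-Civita divergence of theta, with the derivatives [dtheta]
    of its components kept as free data. *)
Lemma codiff1_su3 :
  codiff1 b theta dtheta =
  sum6 (fun a => sum6 (fun i => lc a a i * theta i) - dtheta a a).
Proof. by rewrite /b /lc /theta /dtheta; tab; ring. Qed.

(** The derivatives [dw] stay in su(3), hence are orthogonal to F, and the double F-trace of the
    Bianchi identity expresses the second-order terms through the derivative of theta. The remaining
    terms form a polynomial identity in s, w, t, dw, dt. *)
Lemma scalc_su3 :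
  (forall a b c j, (a < 6)%N -> (b < 6)%N -> (c < 6)%N -> (j < 6)%N ->
     jacobi lc dlc a b c j = 0) ->
  scalc lc dlc = 8 * dotP t ^+ 2 + 8 * dotQ t ^+ 2
    + 2 * sum6 (fun i => theta i ^+ 2)
    - 3^-1 * sum6 (fun i => sum6 (fun j => sum6 (fun k => skew3 t i j k ^+ 2)))
    + 3 * codiff1 b theta dtheta.
Proof.
(* [con] is the contraction with F, up to a sign that disappears since it is applied twice. *)
move=> J; pose con (f : nat -> nat -> R) := f 0%N 1%N - f 1%N 0%N
  + (f 2%N 3%N - f 3%N 2%N) + (f 4%N 5%N - f 5%N 4%N).
have {}J : con (fun i j => con (jacobi lc dlc i j)) = 0.
  by rewrite /con !J // !(subrr, addr0).
(* With these weights the derivatives of w cancel and those of t combine into [dtheta]; the overall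
   factor 6 clears the denominators for [ring]. *)
suff : 3 * (2 * scalc lc dlc + con (fun i j => con (jacobi lc dlc i j))) =
    48 * dotP t ^+ 2 + 48 * dotQ t ^+ 2
    + 12 * sum6 (fun i => theta i ^+ 2)
    - 2 * sum6 (fun i => sum6 (fun j => sum6 (fun k => skew3 t i j k ^+ 2)))
    + 18 * codiff1 b theta dtheta.
  rewrite J; set X := scalc _ _; set Y := dotP t; set Z := dotQ t.
  set Q := sum6 _; set S := sum6 _; set C := codiff1 _ _ _ => E.
  apply: (@mulfI _ 6); first by rewrite pnatr_eq0.
  transitivity (3 * (2 * X + 0)); [by ring | by rewrite E; field].
rewrite codiff1_su3 {J} /con /lc /dlc /theta /dtheta; tab.
ring.
Qed.
End SecondOrder.
End Pointwise.

(** * Recovering the torsion from N and the equations for dPsi *)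

Section HalfTorsion.
Variable R : realFieldType.
Variable l : nat -> nat -> nat -> R.

(** For even i and j, the two entries whose vanishing says that the (i, j) block of the skew matrix
    l_k commutes with J. *)
Let re (k i j : nat) : R := skew2 l k i j - skew2 l k (cj i) (cj j).
Let im (k i j : nat) : R := skew2 l k i (cj j) + skew2 l k (cj i) j.

(* Obtained by solving the equations which say that the [skew2 l k + skew3 t k]
   commute with J. *)
Definition half_torsion (i j k : nat) : R :=
  let x := 2^-1 * (re 2%N 0%N 4%N - re 0%N 2%N 4%N - im 5%N 0%N 2%N) in
  let y := 2^-1 * (im 2%N 0%N 4%N - im 0%N 2%N 4%N + im 4%N 0%N 2%N) in
  match i, j, k with
  | 0%N, 1%N, 2%N => - im 0%N 0%N 2%N | 0%N, 1%N, 3%N => re 0%N 0%N 2%N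
  | 0%N, 1%N, 4%N => - im 0%N 0%N 4%N | 0%N, 1%N, 5%N => re 0%N 0%N 4%N
  | 0%N, 2%N, 3%N => - im 2%N 2%N 0%N | 1%N, 2%N, 3%N => re 2%N 2%N 0%N
  | 2%N, 3%N, 4%N => - im 2%N 2%N 4%N | 2%N, 3%N, 5%N => re 2%N 2%N 4%N
  | 0%N, 4%N, 5%N => - im 4%N 4%N 0%N | 1%N, 4%N, 5%N => re 4%N 4%N 0%N
  | 2%N, 4%N, 5%N => - im 4%N 4%N 2%N | 3%N, 4%N, 5%N => re 4%N 4%N 2%N
  | 0%N, 2%N, 4%N => x | 0%N, 3%N, 5%N => x + re 0%N 2%N 4%N
  | 1%N, 2%N, 5%N => x - re 2%N 0%N 4%N | 1%N, 3%N, 4%N => x + re 4%N 0%N 2%N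
  | 0%N, 2%N, 5%N => y | 0%N, 3%N, 4%N => - im 0%N 2%N 4%N - y
  | 1%N, 2%N, 4%N => im 2%N 0%N 4%N - y
  | 1%N, 3%N, 5%N => im 2%N 0%N 4%N - y + re 1%N 2%N 4%N
  | _, _, _ => 0
  end.

(** The candidate connection matrices, Levi-Civita plus half the torsion. *)
Definition su3_part (k i j : nat) : R := skew2 l k i j + skew3 half_torsion k i j.

End HalfTorsion.

Lemma skew3_swap12 (R : realFieldType) (t : nat -> nat -> nat -> R) i j k :
  (i < 6)%N -> (j < 6)%N -> (k < 6)%N -> skew3 t j i k = - skew3 t i j k.
Proof.
by do 6 (case: i => [_|i]; [by do 6 (case: j => [_|j]; [
  by do 6 (case: k => [_|k]; [tab; ring|])|])|]).
Qed.

Lemma skew3_swap23 (R : realFieldType) (t : nat -> nat -> nat -> R) i j k :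
  (i < 6)%N -> (j < 6)%N -> (k < 6)%N -> skew3 t i k j = - skew3 t i j k.
Proof.
by do 6 (case: i => [_|i]; [by do 6 (case: j => [_|j]; [
  by do 6 (case: k => [_|k]; [tab; ring|])|])|]).
Qed.

(** A skew matrix lies in su(3) when its three complex off-diagonal blocks commute with J and its
    complex trace vanishes; skewness takes care of the diagonal and of the blocks below it. *)
Lemma su3_id (R : realFieldType) (o : nat -> nat -> R) :
  (forall i j, (i < 6)%N -> (j < 6)%N -> o j i = - o i j) ->
  (forall i j, (i, j) \in [:: (0%N, 2%N); (0%N, 4%N); (2%N, 4%N)] ->
     o i j = o (cj i) (cj j) /\ o i (cj j) = - o (cj i) j) ->
  o 4%N 5%N = - o 0%N 1%N - o 2%N 3%N ->
  forall i j, (i < 6)%N -> (j < 6)%N -> su3 o i j = o i j.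
Proof.
move=> skw com e45 i j.
have [/= e13 /eqP] := com 0%N 2%N isT; rewrite -eqr_oppLR => /eqP/esym e12.
have [/= e15 /eqP] := com 0%N 4%N isT; rewrite -eqr_oppLR => /eqP/esym e14.
have [/= e35 /eqP] := com 2%N 4%N isT; rewrite -eqr_oppLR => /eqP/esym e34.
have zero m : (m < 6)%N -> o m m = 0 by move=> m6; have := skw m m m6 m6; lra.
have w p q : (p < q)%N && (q < 6)%N -> o q p = - o p q.
  by case/andP=> pq q6; apply: skw => //; exact: ltn_trans pq q6.
have rules := (w 0%N 1%N isT, w 0%N 2%N isT, w 0%N 3%N isT, w 0%N 4%N isT, w 0%N 5%N isT,
  w 1%N 2%N isT, w 1%N 3%N isT, w 1%N 4%N isT, w 1%N 5%N isT, w 2%N 3%N isT, w 2%N 4%N isT,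
  w 2%N 5%N isT, w 3%N 4%N isT, w 3%N 5%N isT, w 4%N 5%N isT).
case: i => [|[|[|[|[|[|//]]]]]]; case: j => [|[|[|[|[|[|//]]]]]] _ _.
all: by rewrite /su3 ?zero // ?rules ?(e12, e14, e34, e45) -?(e13, e15, e35) ?opprD ?opprK.
Qed.

Section Converse.
Variable R : realFieldType.
Implicit Types s l : nat -> nat -> nat -> R.

Definition lc_coef s l (k i j : nat) : R := sym12 s k i j - skew2 l k i j.

(** N is skew in its first two arguments by definition, so skewness in the last two is the whole
    content of the hypothesis. The solution [half_torsion] satisfies part of the linear system by
    construction, and the rest of the system is compatible because of N. *)
Lemma half_torsion_commutes s l k x y :
  (forall i j k, (i < 6)%N -> (j < 6)%N -> (k < 6)%N ->
     nijc (lc_coef s l) i j k = - nijc (lc_coef s l) i k j) ->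
  (k < 6)%N -> (x, y) \in [:: (0%N, 2%N); (0%N, 4%N); (2%N, 4%N)] ->
  su3_part l k x y = su3_part l k (cj x) (cj y)
  /\ su3_part l k x (cj y) = - su3_part l k (cj x) y.
Proof.
pose N i j k := nijc (lc_coef s l) i j k + nijc (lc_coef s l) i k j = 0.
move=> skewN; have {skewN} N0 i j k' : (i < 6)%N && (j < 6)%N && (k' < 6)%N -> N i j k'.
  by move=> /andP[/andP[? ?] ?]; rewrite /N skewN // addNr.
move=> k6; rewrite !inE => xy.
case: k k6 => [|[|[|[|[|[|//]]]]]] _.
(* For even k the entries of [half_torsion] were solved from exactly these equations, so they hold
   identically in l. *)
- clear N0 N; case/or3P: xy => /eqP[-> ->]; rewrite /su3_part /half_torsion; tab; by split; lra.
(* For odd k the equations are linear combinations of the chosen components of the skewness of N. *)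
- have := @N0 3%N 1%N 1%N isT; have := @N0 2%N 0%N 0%N isT.
  have := @N0 4%N 0%N 1%N isT; have := @N0 1%N 0%N 5%N isT.
  have := @N0 3%N 5%N 0%N isT.
  clear N0; rewrite /N /lc_coef; tab => H1 H2 H3 H4 H5; clear N.
  case/or3P: xy => /eqP[-> ->]; rewrite /su3_part /half_torsion; tab; by split; lra.
- clear N0 N; case/or3P: xy => /eqP[-> ->]; rewrite /su3_part /half_torsion; tab; by split; lra.
- have := @N0 3%N 0%N 2%N isT.
  have := @N0 0%N 2%N 2%N isT; have := @N0 4%N 1%N 2%N isT.
  have := @N0 0%N 5%N 3%N isT; have := @N0 2%N 2%N 5%N isT.
  have := @N0 3%N 5%N 2%N isT.
  clear N0; rewrite /N /lc_coef; tab => H1 H2 H3 H4 H5 H6; clear N.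
  case/or3P: xy => /eqP[-> ->]; rewrite /su3_part /half_torsion; tab; by split; lra.
- clear N0 N; case/or3P: xy => /eqP[-> ->]; rewrite /su3_part /half_torsion; tab; by split; lra.
- have := @N0 3%N 1%N 5%N isT.
  have := @N0 0%N 4%N 5%N isT; have := @N0 4%N 1%N 5%N isT.
  have := @N0 4%N 5%N 2%N isT; have := @N0 4%N 4%N 2%N isT.
  clear N0; rewrite /N /lc_coef; tab => H1 H2 H3 H4 H5; clear N.
  case/or3P: xy => /eqP[-> ->]; rewrite /su3_part /half_torsion; tab; by split; lra.
Qed.

(** For each k, a single coefficient of the equation for dPsi+ or dPsi- determines the complex trace
    of the k-th matrix; for k = 0 and k = 4 it must be combined with one component of the skewness
    of N. *)
Lemma half_torsion_trace s l k :
  (forall i j k, (i < 6)%N -> (j < 6)%N -> (k < 6)%N ->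
     nijc (lc_coef s l) i j k = - nijc (lc_coef s l) i k j) ->
  (forall i j k m, (i < j)%N -> (j < k)%N -> (k < m)%N -> (m < 6)%N ->
     ext 3 (lc_coef s l) (tP R) [:: i; j; k; m] =
     wedge1 3 (leec (lc_coef s l)) (tP R) [:: i; j; k; m]
     - 4^-1 * dotP (nijc (lc_coef s l)) * hod (tF R) [:: i; j; k; m]) ->
  (forall i j k m, (i < j)%N -> (j < k)%N -> (k < m)%N -> (m < 6)%N ->
     ext 3 (lc_coef s l) (tQ R) [:: i; j; k; m] =
     wedge1 3 (leec (lc_coef s l)) (tQ R) [:: i; j; k; m]
     - 4^-1 * dotQ (nijc (lc_coef s l)) * hod (tF R) [:: i; j; k; m]) ->
  (k < 6)%N ->
  su3_part l k 4%N 5%N = - su3_part l k 0%N 1%N - su3_part l k 2%N 3%N.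
Proof.
move=> skewN structP structQ; rewrite /su3_part /half_torsion.
case: k => [|[|[|[|[|[|//]]]]]] _.
- have := @skewN 0%N 4%N 5%N isT isT isT.
  have := @structQ 0%N 1%N 3%N 4%N isT isT isT isT.
  clear skewN structP structQ; rewrite /lc_coef; tab => H1 H2; lra.
- have := @structQ 0%N 1%N 3%N 5%N isT isT isT isT.
  clear skewN structP structQ; rewrite /lc_coef; tab => H1; lra.
- have := @structP 1%N 2%N 3%N 5%N isT isT isT isT.
  clear skewN structP structQ; rewrite /lc_coef; tab => H1; lra.
- have := @structQ 1%N 2%N 3%N 5%N isT isT isT isT.
  clear skewN structP structQ; rewrite /lc_coef; tab => H1; lra.
- have := @skewN 4%N 0%N 1%N isT isT isT.
  have := @structQ 0%N 3%N 4%N 5%N isT isT isT isT.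
  clear skewN structP structQ; rewrite /lc_coef; tab => H1 H2; lra.
- have := @structQ 1%N 3%N 4%N 5%N isT isT isT isT.
  clear skewN structP structQ; rewrite /lc_coef; tab => H1; lra.
Qed.

Lemma su3_of_structure s l k i j :
  (forall i j k, (i < 6)%N -> (j < 6)%N -> (k < 6)%N ->
     nijc (lc_coef s l) i j k = - nijc (lc_coef s l) i k j) ->
  (forall i j k m, (i < j)%N -> (j < k)%N -> (k < m)%N -> (m < 6)%N ->
     ext 3 (lc_coef s l) (tP R) [:: i; j; k; m] =
     wedge1 3 (leec (lc_coef s l)) (tP R) [:: i; j; k; m]
     - 4^-1 * dotP (nijc (lc_coef s l)) * hod (tF R) [:: i; j; k; m]) ->
  (forall i j k m, (i < j)%N -> (j < k)%N -> (k < m)%N -> (m < 6)%N ->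
     ext 3 (lc_coef s l) (tQ R) [:: i; j; k; m] =
     wedge1 3 (leec (lc_coef s l)) (tQ R) [:: i; j; k; m]
     - 4^-1 * dotQ (nijc (lc_coef s l)) * hod (tF R) [:: i; j; k; m]) ->
  (k < 6)%N -> (i < 6)%N -> (j < 6)%N ->
  skew2 l k i j = su3 (su3_part l k) i j - skew3 (half_torsion l) k i j.
Proof.
move=> sN sP sQ k6 i6 j6; have := half_torsion_trace sN sP sQ k6.
have := half_torsion_commutes (x := 0) (y := 2) sN k6 isT.
have := half_torsion_commutes (x := 0) (y := 4) sN k6 isT.
have := half_torsion_commutes (x := 2) (y := 4) sN k6 isT.
rewrite -[skew2 l k i j](addrK (skew3 (half_torsion l) k i j)) -/(su3_part l k i j).
move=> e24 e04 e02 tr; congr (_ - _); symmetry; apply: su3_id => // [i' j' i6' j6'|p q].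
  rewrite /su3_part opprD -skew3_swap23 //; congr (_ + _).
  by move: {sN sP sQ k6 tr e02 e04 e24} i6' j6'; do 6 (case: i' => [_|i']; [
    by do 6 (case: j' => [_|j']; [tab; ring|])|]).
by rewrite !inE => /or3P[] /eqP[-> ->].
Qed.
End Converse.

(** * Koszul coefficients, the su(3) relation and its uniqueness *)

Section NormalForm.
Variable R : realFieldType.
Implicit Types b w t : nat -> nat -> nat -> R.

(* Koszul formula in a frame with [E_k, E_i] = - sum_j (b k i j - b i k j) E_j *)
Definition koszul b (k i j : nat) : R :=
  2^-1 * (b i k j - b k i j + (b i j k - b j i k) + (b k j i - b j k i)).

(** Zero outside the range, so that relations between components become equalities of functions by
    which one can rewrite. *)
Definition trunc3 b (k i j : nat) : R :=
  if [&& k < 6, i < 6 & j < 6]%N then b k i j else 0.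

(** The pointwise content of (a): the Levi-Civita connection is an su(3)-connection w minus half of
    its torsion, t = T/2. *)
Definition su3_relation b w t : Prop := forall k i j,
  (k < 6)%N -> (i < 6)%N -> (j < 6)%N ->
  koszul b k i j = su3 (w k) i j - skew3 t k i j.

Lemma koszul_skew b k i j : koszul b k j i = - koszul b k i j.
Proof. by rewrite /koszul; ring. Qed.

Lemma skew2_koszul b : skew2 (koszul b) = koszul b.
Proof.
apply/funext => k; apply/funext => i; apply/funext => j; rewrite /skew2.
case: Nat.ltb => //; have -> : Nat.eqb i j = (i == j) by [].
case: eqP => [->|_]; last by rewrite koszul_skew opprK.
by have := koszul_skew b k j j; lra.
Qed.

Lemma sym12_koszul b : let s := fun k i j => b k i j + koszul b k i j in sym12 s = s.
Proof.
apply/funext => k; apply/funext => i; apply/funext => j; rewrite /sym12.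
by case: Nat.ltb => //; rewrite /koszul; field.
Qed.

(** Vanishing of the Levi-Civita torsion means that b + koszul b is symmetric in its first two
    indices. *)
Lemma koszul_decomposition b :
  b = lc_coef (fun k i j => b k i j + koszul b k i j) (koszul b).
Proof.
apply/funext => k; apply/funext => i; apply/funext => j.
by rewrite /lc_coef sym12_koszul skew2_koszul addrK.
Qed.

Lemma koszul_trunc3 b k i j : ~~ [&& k < 6, i < 6 & j < 6]%N -> koszul (trunc3 b) k i j = 0.
Proof.
move=> /negbTE H; rewrite /koszul /trunc3.
have -> : [&& i < 6, k < 6 & j < 6]%N = false
  by rewrite -H; case: (k < 6)%N; case: (i < 6)%N; case: (j < 6)%N.
have -> : [&& i < 6, j < 6 & k < 6]%N = false
  by rewrite -H; case: (k < 6)%N; case: (i < 6)%N; case: (j < 6)%N.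
have -> : [&& j < 6, i < 6 & k < 6]%N = false
  by rewrite -H; case: (k < 6)%N; case: (i < 6)%N; case: (j < 6)%N.
have -> : [&& j < 6, k < 6 & i < 6]%N = false
  by rewrite -H; case: (k < 6)%N; case: (i < 6)%N; case: (j < 6)%N.
have -> : [&& k < 6, j < 6 & i < 6]%N = false
  by rewrite -H; case: (k < 6)%N; case: (i < 6)%N; case: (j < 6)%N.
by rewrite H !subr0 !addr0 mulr0.
Qed.

Lemma skew3_trunc3 t i j k :
  skew3 (trunc3 t) i j k = if [&& i < 6, j < 6 & k < 6]%N then skew3 t i j k else 0.
Proof.
have E b i' j' k' : trunc3 b i' j' k' = if [&& i' < 6, j' < 6 & k' < 6]%N then b i' j' k' else 0 by [].
rewrite /skew3 !E; case: (ltnP i 6) => _; case: (ltnP j 6) => _; case: (ltnP k 6) => _ //=;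
  by do !case: ifP; rewrite ?oppr0.
Qed.

(* The form in which the identities of [Pointwise] apply. *)
Lemma su3_normal_form b w t : su3_relation (trunc3 b) w t ->
  let w' := fun k => if (k < 6)%N then w k else fun _ _ => 0 in
  koszul (trunc3 b) = (fun k i j => su3 (w' k) i j - skew3 (trunc3 t) k i j) /\
  trunc3 b = (fun k i j => sym12 (fun k i j => trunc3 b k i j + koszul (trunc3 b) k i j) k i j
     - (su3 (w' k) i j - skew3 (trunc3 t) k i j)).
Proof.
move=> rel w'.
suff E k i j : koszul (trunc3 b) k i j = su3 (w' k) i j - skew3 (trunc3 t) k i j.
  split; first by do 3 apply/funext => ?.
  apply/funext => k; apply/funext => i; apply/funext => j.
  by rewrite sym12_koszul -E addrK.
rewrite skew3_trunc3; have [/and3P[k6 i6 j6]|H] := boolP [&& k < 6, i < 6 & j < 6]%N.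
  by rewrite /w' k6 rel.
(* Out of range both sides are zero: [w'] vanishes for k >= 6, and [su3] vanishes as soon as i or j
   exceeds 5. *)
rewrite koszul_trunc3 // subr0 /w'.
case: (ltnP k 6) H => [_ /= H|_ _]; last first.
  by rewrite /su3; do 6 (case: i => [|i]; [by do 6 (case: j => [|j]; [by rewrite ?oppr0 ?subr0 ?addr0|])|]).
rewrite /su3; case: (ltnP i 6) H => [i6 /= j6|i6 _]; last first.
  by move: i i6 => [|[|[|[|[|[|]]]]]].
by move: j j6 => [|[|[|[|[|[|j]]]]]] //; move: i i6 => [|[|[|[|[|[|]]]]]].
Qed.

(** Commutation with J and total skewness together leave no room: the 12 components of t containing
    an index pair {i, J i} vanish one by one, and each of the two remaining groups of 4 satisfies a
    nondegenerate system. *)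
Lemma su3_skew3_eq0 w t :
  (forall k i j, (k < 6)%N -> (i < 6)%N -> (j < 6)%N -> su3 (w k) i j = skew3 t k i j) ->
  forall k i j, (k < 6)%N -> (i < 6)%N -> (j < 6)%N -> skew3 t k i j = 0.
Proof.
move=> E.
have e k i j : [&& k < 6, i < 6 & j < 6]%N -> su3 (w k) i j = skew3 t k i j.
  by case/and3P; exact: E.
clear E.
(* Entry (1,2) of an su(3) matrix is minus entry (0,3); in the matrix with k = 0 the latter is t_003
   = 0. The next eleven cases have the same pattern. *)
have T012 : t 0%N 1%N 2%N = 0.
  have := e 0%N 1%N 2%N isT; have := e 0%N 0%N 3%N isT; clear e; tab; lra.
have T013 : t 0%N 1%N 3%N = 0.
  have := e 0%N 1%N 3%N isT; have := e 0%N 0%N 2%N isT; clear e; tab; lra.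
have T014 : t 0%N 1%N 4%N = 0.
  have := e 0%N 1%N 4%N isT; have := e 0%N 0%N 5%N isT; clear e; tab; lra.
have T015 : t 0%N 1%N 5%N = 0.
  have := e 0%N 1%N 5%N isT; have := e 0%N 0%N 4%N isT; clear e; tab; lra.
have T023 : t 0%N 2%N 3%N = 0.
  have := e 2%N 3%N 0%N isT; have := e 2%N 2%N 1%N isT; clear e; tab; lra.
have T123 : t 1%N 2%N 3%N = 0.
  have := e 2%N 3%N 1%N isT; have := e 2%N 2%N 0%N isT; clear e; tab; lra.
have T234 : t 2%N 3%N 4%N = 0.
  have := e 2%N 3%N 4%N isT; have := e 2%N 2%N 5%N isT; clear e; tab; lra.
have T235 : t 2%N 3%N 5%N = 0.
  have := e 2%N 3%N 5%N isT; have := e 2%N 2%N 4%N isT; clear e; tab; lra.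
have T045 : t 0%N 4%N 5%N = 0.
  have := e 4%N 5%N 0%N isT; have := e 4%N 4%N 1%N isT; clear e; tab; lra.
have T145 : t 1%N 4%N 5%N = 0.
  have := e 4%N 5%N 1%N isT; have := e 4%N 4%N 0%N isT; clear e; tab; lra.
have T245 : t 2%N 4%N 5%N = 0.
  have := e 4%N 5%N 2%N isT; have := e 4%N 4%N 3%N isT; clear e; tab; lra.
have T345 : t 3%N 4%N 5%N = 0.
  have := e 4%N 5%N 3%N isT; have := e 4%N 4%N 2%N isT; clear e; tab; lra.
(* The matrices k = 0, 2, 4 give t_024 = t_035 = t_125 = t_134, while k = 5 gives t_035 = -t_125. *)
have T024 : t 0%N 2%N 4%N = 0.
  have := e 0%N 2%N 4%N isT; have := e 0%N 3%N 5%N isT; have := e 2%N 0%N 4%N isT; have := e 2%N 1%N 5%N isT; have := e 4%N 0%N 2%N isT; have := e 4%N 1%N 3%N isT; have := e 5%N 0%N 3%N isT; have := e 5%N 1%N 2%N isT; clear e; tab; lra.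
have T035 : t 0%N 3%N 5%N = 0.
  have := e 0%N 2%N 4%N isT; have := e 0%N 3%N 5%N isT; have := e 2%N 0%N 4%N isT; have := e 2%N 1%N 5%N isT; have := e 4%N 0%N 2%N isT; have := e 4%N 1%N 3%N isT; have := e 5%N 0%N 3%N isT; have := e 5%N 1%N 2%N isT; clear e; tab; lra.
have T125 : t 1%N 2%N 5%N = 0.
  have := e 0%N 2%N 4%N isT; have := e 0%N 3%N 5%N isT; have := e 2%N 0%N 4%N isT; have := e 2%N 1%N 5%N isT; have := e 4%N 0%N 2%N isT; have := e 4%N 1%N 3%N isT; have := e 5%N 0%N 3%N isT; have := e 5%N 1%N 2%N isT; clear e; tab; lra.
have T134 : t 1%N 3%N 4%N = 0.
  have := e 0%N 2%N 4%N isT; have := e 0%N 3%N 5%N isT; have := e 2%N 0%N 4%N isT; have := e 2%N 1%N 5%N isT; have := e 4%N 0%N 2%N isT; have := e 4%N 1%N 3%N isT; have := e 5%N 0%N 3%N isT; have := e 5%N 1%N 2%N isT; clear e; tab; lra.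
have T025 : t 0%N 2%N 5%N = 0.
  have := e 0%N 2%N 5%N isT; have := e 0%N 3%N 4%N isT; have := e 2%N 0%N 5%N isT; have := e 2%N 1%N 4%N isT; have := e 4%N 0%N 3%N isT; have := e 4%N 1%N 2%N isT; have := e 1%N 2%N 4%N isT; have := e 1%N 3%N 5%N isT; clear e; tab; lra.
have T034 : t 0%N 3%N 4%N = 0.
  have := e 0%N 2%N 5%N isT; have := e 0%N 3%N 4%N isT; have := e 2%N 0%N 5%N isT; have := e 2%N 1%N 4%N isT; have := e 4%N 0%N 3%N isT; have := e 4%N 1%N 2%N isT; have := e 1%N 2%N 4%N isT; have := e 1%N 3%N 5%N isT; clear e; tab; lra.
have T124 : t 1%N 2%N 4%N = 0.
  have := e 0%N 2%N 5%N isT; have := e 0%N 3%N 4%N isT; have := e 2%N 0%N 5%N isT; have := e 2%N 1%N 4%N isT; have := e 4%N 0%N 3%N isT; have := e 4%N 1%N 2%N isT; have := e 1%N 2%N 4%N isT; have := e 1%N 3%N 5%N isT; clear e; tab; lra.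
have T135 : t 1%N 3%N 5%N = 0.
  have := e 0%N 2%N 5%N isT; have := e 0%N 3%N 4%N isT; have := e 2%N 0%N 5%N isT; have := e 2%N 1%N 4%N isT; have := e 4%N 0%N 3%N isT; have := e 4%N 1%N 2%N isT; have := e 1%N 2%N 4%N isT; have := e 1%N 3%N 5%N isT; clear e; tab; lra.
clear e; move=> k i j.
do 6 (case: k => [_|k]; [by do 6 (case: i => [_|i]; [
  by do 6 (case: j => [_|j]; [by tab; rewrite ?T012 ?T013 ?T014 ?T015 ?T023 ?T123 ?T234
    ?T235 ?T045 ?T145 ?T245 ?T345 ?T024 ?T035 ?T125 ?T134 ?T025 ?T034 ?T124 ?T135 ?oppr0
  |])|])|]); by [].
Qed.

End NormalForm.

(** * Action of su(3) on J and Psi; metric connections and their torsion *)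

Section SpecialUnitary.
Variable R : realFieldType.
Implicit Types (w o : nat -> nat -> R) (b t : nat -> nat -> nat -> R).

Definition su3_action o (t : seq nat -> R) (p : seq nat) : R :=
  sumto 3 (fun a => sum6 (fun l => o (nth 0%N p a) l * t (set_nth 0%N p a l))).

Lemma su3_skew w i j : (i < 6)%N -> (j < 6)%N -> su3 w j i = - su3 w i j.
Proof.
by do 6 (case: i => [_|i]; [by do 6 (case: j => [_|j]; [tab; ring|])|]).
Qed.

Lemma su3_acs w i j : (i < 6)%N -> (j < 6)%N ->
  - sg j (su3 w i (cj j)) = sg i (su3 w (cj i) j).
Proof.
by do 6 (case: i => [_|i]; [by do 6 (case: j => [_|j]; [tab; ring|])|]).
Qed.

Lemma su3_tP w i j k : (i < 6)%N -> (j < 6)%N -> (k < 6)%N ->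
  su3_action (su3 w) (tP R) [:: i; j; k] = 0.
Proof.
rewrite /su3_action.
by do 6 (case: i => [_|i]; [by do 6 (case: j => [_|j]; [
  by do 6 (case: k => [_|k]; [tab; ring|])|])|]).
Qed.

Lemma su3_tQ w i j k : (i < 6)%N -> (j < 6)%N -> (k < 6)%N ->
  su3_action (su3 w) (tQ R) [:: i; j; k] = 0.
Proof.
rewrite /su3_action.
by do 6 (case: i => [_|i]; [by do 6 (case: j => [_|j]; [
  by do 6 (case: k => [_|k]; [tab; ring|])|])|]).
Qed.

(** A metric connection is determined by its torsion: the usual combination of the three cyclic
    permutations of the torsion equation solves for o. *)
Lemma koszul_of_torsion b (o t : nat -> nat -> nat -> R) :
  (forall k i j, (k < 6)%N -> (i < 6)%N -> (j < 6)%N -> o k j i = - o k i j) ->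
  (forall k i j, (k < 6)%N -> (i < 6)%N -> (j < 6)%N ->
     o k i j - o i k j + (b k i j - b i k j) = 2 * skew3 t k i j) ->
  forall k i j, (k < 6)%N -> (i < 6)%N -> (j < 6)%N ->
    koszul b k i j = o k i j - skew3 t k i j.
Proof.
move=> skw tor k i j k6 i6 j6; rewrite /koszul.
have := tor k i j k6 i6 j6; have := tor i j k i6 j6 k6; have := tor j k i j6 k6 i6.
have := skw k i j k6 i6 j6; have := skw i j k i6 j6 k6; have := skw j k i j6 k6 i6.
have : skew3 t i j k = skew3 t k i j.
  by rewrite (skew3_swap12 _ j6 i6 k6) -(skew3_swap23 _ j6 i6 k6)
    (skew3_swap12 _ k6 j6 i6) (skew3_swap23 _ k6 i6 j6) opprK.
have : skew3 t j k i = skew3 t k i j.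
  by rewrite (skew3_swap12 _ k6 j6 i6) (skew3_swap23 _ k6 i6 j6) opprK.
clear; lra.
Qed.

Lemma torsion_of_koszul b (o t : nat -> nat -> nat -> R) :
  (forall k i j, (k < 6)%N -> (i < 6)%N -> (j < 6)%N ->
     koszul b k i j = o k i j - skew3 t k i j) ->
  forall k i j, (k < 6)%N -> (i < 6)%N -> (j < 6)%N ->
    o k i j - o i k j + (b k i j - b i k j) = 2 * skew3 t k i j.
Proof.
move=> rel k i j k6 i6 j6; have := rel k i j k6 i6 j6; have := rel i k j i6 k6 j6.
rewrite (skew3_swap12 _ k6 i6 j6) /koszul; clear; lra.
Qed.

End SpecialUnitary.

(** * Multilinear and alternating forms on a basis *)

Section Forms.
Context {R : realType}.

Definition multilinear_form k (a : form R k) : Prop :=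
  forall i v, scalar (fun u => a (set_row i u v)).

Lemma scalar_sum (V : lmodType R) (g : V -> R) (I : Type) (r : seq I) (P : pred I) c u :
  scalar g -> g (\sum_(i <- r | P i) c i *: u i) = \sum_(i <- r | P i) c i * g (u i).
Proof.
move=> lg; have g0 : g 0 = 0.
  by have := lg (-1) 0 0; rewrite scaler0 addr0 mulN1r addNr.
elim: r => [|i r IH]; first by rewrite !big_nil.
by rewrite !big_cons; case: ifP => // _; rewrite lg IH.
Qed.

Lemma set_rowE k (i : 'I_k) u (v : 'M[R]_(k, 6)) j :
  row j (set_row i u v) = if j == i then u else row j v.
Proof. by rewrite rowK. Qed.

Lemma set_row_id k (i : 'I_k) (v : 'M[R]_(k, 6)) : set_row i (row i v) v = v.
Proof. by apply/row_matrixP => j; rewrite set_rowE; case: eqP => [->|]. Qed.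

Lemma set_row_twice k (i : 'I_k) u u' (v : 'M[R]_(k, 6)) :
  set_row i u (set_row i u' v) = set_row i u v.
Proof. by apply/row_matrixP => j; rewrite !set_rowE; case: eqP. Qed.

Lemma set_row_swap k (i j : 'I_k) u w (v : 'M[R]_(k, 6)) : i != j ->
  set_row i u (set_row j w v) = set_row j w (set_row i u v).
Proof.
move=> ij; apply/row_matrixP => l; rewrite !set_rowE.
by case: (l =P i) => // ->; rewrite (negPf ij).
Qed.

Lemma row_sum_basis (E : 'M[R]_6) (u : vec R) : E \in unitmx ->
  u = \sum_(l < 6) (u *m invmx E) 0 l *: row l E.
Proof. by move=> EU; rewrite -mulmx_sum_row mulmxKV. Qed.

Lemma multilinear_expand_row k (a : form R k) (E : 'M[R]_6) i u v :
  multilinear_form a -> E \in unitmx ->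
  a (set_row i u v) = \sum_(l < 6) (u *m invmx E) 0 l * a (set_row i (row l E) v).
Proof. by move=> ma EU; rewrite {1}(row_sum_basis u EU) (scalar_sum _ _ _ _ (ma i v)). Qed.

Lemma multilinear_ext k (a b : form R k) (E : 'M[R]_6) : E \in unitmx ->
  multilinear_form a -> multilinear_form b ->
  (forall f : 'I_k -> 'I_6, a (rowsub f E) = b (rowsub f E)) -> a =1 b.
Proof.
move=> EU ma mb ab v.
(* Induction on the number n of leading rows still allowed to be arbitrary; the rows from n on are
   basis vectors. *)
suff: forall n (v : 'M[R]_(k, 6)), (forall i : 'I_k, (n <= i)%N -> exists l, row i v = row l E) ->
    a v = b v.
  by move/(_ k v); apply=> i; rewrite leqNgt ltn_ord.
elim=> [|n IH] {}v rowv.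
  have /fin_all_exists[f fE] : forall i, exists l, row i v = row l E.
    by move=> i; exact: rowv.
  have -> : v = rowsub f E by apply/row_matrixP => i; rewrite fE row_rowsub.
  exact: ab.
have [nk|kn] := ltnP n k; last first.
  by apply: IH => i ni; apply: rowv; have := ltn_ord i; rewrite ltnNge (leq_trans kn).
rewrite -(set_row_id (Ordinal nk) v) !(multilinear_expand_row _ _ _ _ EU) //.
apply: eq_bigr => l _; congr (_ * _); apply: IH => i ni; rewrite set_rowE.
case: eqP => [_|/eqP ne]; first by exists l.
by apply: rowv; rewrite ltn_neqAle ni andbT eq_sym; apply: contra_neqN ne => /eqP e; apply: val_inj.
Qed.

Lemma multilinear_expand k (a : form R k) (E : 'M[R]_6) v :
  E \in unitmx -> multilinear_form a ->
  a v = \sum_(f : {ffun 'I_k -> 'I_6}) (\prod_i (v *m invmx E) i (f i)) * a (rowsub f E).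
Proof.
move=> EU ma.
pose b (v : 'M[R]_(k, 6)) :=
  \sum_(f : {ffun 'I_k -> 'I_6}) (\prod_i (v *m invmx E) i (f i)) * a (rowsub f E).
rewrite -/(b v); move: v; apply: (multilinear_ext EU) => //.
  move=> i v c u w; rewrite /b mulr_sumr -big_split /=; apply: eq_bigr => f _.
  rewrite mulrA -mulrDl; congr (_ * _).
  have rowE u' j l : (set_row i u' v *m invmx E) j l =
      if j == i then (u' *m invmx E) 0 l else (v *m invmx E) j l.
    have rowl (A : 'M[R]_(k, 6)) p : A p l = row p A 0 l by rewrite mxE.
    by rewrite !rowl !row_mul set_rowE; case: eqP.
  have prodE u' : \prod_j (set_row i u' v *m invmx E) j (f j) =
      (u' *m invmx E) 0 (f i) * \prod_(j | j != i) (v *m invmx E) j (f j).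
    rewrite (bigD1 i) //= rowE eqxx; congr (_ * _).
    by apply: eq_bigr => j /negPf ji; rewrite rowE ji.
  rewrite !prodE mulmxDl -scalemxAl [fun_of_matrix (_ + _) _ _]mxE [fun_of_matrix (_ *: _) _ _]mxE.
  by rewrite mulrA -mulrDl.
move=> g; rewrite /b (bigD1 [ffun i => g i]) //= [X in _ + X]big1 => [|f fg].
  rewrite big1 ?mul1r ?addr0 => [|i _].
    by congr a; apply/row_matrixP => i; rewrite !row_rowsub ffunE.
  by rewrite mul_rowsub_mx mulmxV // mxE mxE ffunE eqxx.
have /existsP[i fgi] : [exists i, f i != g i].
  rewrite -negb_forall; apply: contra fg => /forallP H.
  by apply/eqP/ffunP => i; rewrite ffunE; apply/eqP.
rewrite (bigD1 i) //= mul_rowsub_mx mulmxV // mxE mxE eq_sym (negPf fgi).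
by rewrite !mul0r.
Qed.

Lemma form_swap_rows k (a : form R k) (i j : 'I_k) w : multilinear_form a ->
  (forall v, row i v = row j v -> a v = 0) -> i != j -> a (xrow i j w) = - a w.
Proof.
move=> ma aa ij; pose S p q := a (set_row i p (set_row j q w)).
have Spp p : S p p = 0.
  by apply: aa; rewrite !set_rowE !eqxx; case: eqP.
have SDl x y z : S (x + y) z = S x z + S y z.
  by have := ma i (set_row j z w) 1 x y; rewrite scale1r mul1r.
have SDr z x y : S z (x + y) = S z x + S z y.
  rewrite /S !(set_row_swap _ _ _ ij).
  by have := ma j (set_row i z w) 1 x y; rewrite scale1r mul1r.
have := Spp (row i w + row j w); rewrite SDl !SDr !Spp addr0 add0r.
have -> : S (row i w) (row j w) = a w by rewrite /S set_row_id set_row_id.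
have -> : S (row j w) (row i w) = a (xrow i j w).
  congr a; apply/row_matrixP => l; rewrite !set_rowE.
  have -> : row l (xrow i j w) = row (tperm i j l) w by apply/rowP => q; rewrite !mxE.
  case: (l =P i) => [->|/eqP li]; first by rewrite tpermL.
  case: (l =P j) => [->|/eqP lj]; first by rewrite tpermR.
  by rewrite tpermD // eq_sym.
by move/eqP; rewrite addrC addr_eq0 => /eqP.
Qed.

Lemma form_perm k (a : form R k) (s : 'S_k) v : is_form a ->
  a (row_perm s v) = (-1) ^+ s * a v.
Proof.
move=> [ma aa].
have swap i j w : i != j -> a (xrow i j w) = - a w.
  by move=> ij; apply: form_swap_rows => // u; apply: aa.
have [ts -> dts] := prod_tpermP s; elim: ts dts => [|t ts IH] /=.
  by rewrite big_nil odd_perm1 expr0 mul1r row_perm1.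
case/andP=> t12 /IH{}IH; rewrite big_cons row_permM swap // IH.
by rewrite odd_mul_tperm t12 signr_addb expr1 mulN1r mulNr.
Qed.

End Forms.

Section FormConstructions.
Context {R : realType}.

Lemma form_noninjective k (a : form R k) (E : 'M[R]_6) (f : 'I_k -> 'I_6) :
  is_form a -> ~ injective f -> a (rowsub f E) = 0.
Proof.
move=> [_ aa] nf; have [i [j [fij ij]]] : exists i j, f i = f j /\ i <> j.
  apply: contrapT => H; apply: nf => i j fij; apply: contrapT => ij.
  by apply: H; exists i, j.
by apply: (aa _ i j); [exact/eqP | rewrite !row_rowsub fij].
Qed.

Lemma form_rowsub_perm k (a : form R k) (E : 'M[R]_6) (f : 'I_k -> 'I_6) (s : 'S_k) :
  is_form a -> a (rowsub (f \o s) E) = (-1) ^+ s * a (rowsub f E).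
Proof.
move=> fa; rewrite -(form_perm s _ fa); congr a.
by apply/matrixP => i j; rewrite !mxE.
Qed.

(** Evaluating a form on these rows reads off its component at the multi-index p, in the list format
    of the tables. *)
Definition basis k (E : 'M[R]_6) (p : seq nat) : 'M[R]_(k, 6) :=
  rowsub (fun i : 'I_k => inord (nth 0%N p i) : 'I_6) E.

Definition codes k (f : 'I_k -> 'I_6) : seq nat := [seq val (f i) | i <- enum 'I_k].

Lemma size_codes k (f : 'I_k -> 'I_6) : size (codes f) = k.
Proof. by rewrite size_map size_enum_ord. Qed.

Lemma nth_codes k (f : 'I_k -> 'I_6) (i : 'I_k) : nth 0%N (codes f) i = f i.
Proof. by rewrite (nth_map i) ?size_enum_ord // nth_ord_enum. Qed.

Lemma codes_lt6 k (f : 'I_k -> 'I_6) : all (ltn^~ 6) (codes f).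
Proof. by apply/allP => x /mapP[i _ ->]; exact: ltn_ord. Qed.

Lemma basis_codes k (E : 'M[R]_6) (f : 'I_k -> 'I_6) : basis k E (codes f) = rowsub f E.
Proof. by apply/row_matrixP => i; rewrite !row_rowsub nth_codes inord_val. Qed.

Lemma sorting_perm k (f : 'I_k -> 'I_6) : injective f ->
  exists s : 'S_k, sorted ltn (codes (f \o s)).
Proof.
move=> fi; pose t := [tuple val (f i) | i < k].
have /tuple_permP[s ts] : perm_eq (sort_tuple leq t) t by rewrite perm_sort.
exists s; have -> : codes (f \o s) = sort leq t.
  by rewrite ts /codes; apply: eq_map => i /=; rewrite tnth_mktuple.
rewrite ltn_sorted_uniq_leq sort_sorted ?andbT; last exact: leq_total.
by rewrite sort_uniq map_inj_uniq ?enum_uniq // => i j /val_inj/fi.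
Qed.

Lemma form_ext k (a b : form R k) (E : 'M[R]_6) : E \in unitmx ->
  is_form a -> is_form b ->
  (forall p, size p = k -> sorted ltn p -> all (ltn^~ 6) p ->
     a (basis k E p) = b (basis k E p)) -> a =1 b.
Proof.
move=> EU fa fb ab; apply: (multilinear_ext EU); [exact: fa.1 | exact: fb.1 | move=> f].
have [fi|nf] := pselect (injective f); last by rewrite !form_noninjective.
have [s sf] := sorting_perm fi.
apply: (@mulfI _ ((-1) ^+ s)); first by rewrite signr_eq0.
rewrite -!form_rowsub_perm // -!basis_codes; apply: ab => //.
  exact: size_codes.
exact: codes_lt6.
Qed.

End FormConstructions.

Section Alternating.
Context {R : realType}.

(** Induction on the distance of the two equal rows: an adjacent exchange brings them one step
    closer and changes only the sign. *)
Lemma alternating_adjacent k (a : form R k) : multilinear_form a ->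
  (forall v (i j : 'I_k), j = i.+1 :> nat -> row i v = row j v -> a v = 0) -> is_form a.
Proof.
move=> ma aa; split=> //.
suff H n : forall v (i j : 'I_k), j = (i + n.+1)%N :> nat -> row i v = row j v -> a v = 0.
  move=> v i j ij rij; have [lij|lji|e] := ltngtP i j.
  - by apply: (H (j - i).-1 v i j); rewrite // prednK ?subn_gt0 // subnKC // ltnW.
  - by apply: (H (i - j).-1 v j i); rewrite // prednK ?subn_gt0 // subnKC // ltnW.
  - by case/eqP: ij; apply: val_inj.
elim: n => [|n IH] v i j ej rij; first by apply: (aa v i j) => //; rewrite ej addn1.
have j'k : (i + n.+1 < k)%N by have := ltn_ord j; lia.
pose j' := Ordinal j'k.
have j'j : j' != j by apply/eqP => /(congr1 val) /=; rewrite ej; lia.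
have ij' : i != j' by apply/eqP => /(congr1 val) /=; lia.
have ij : i != j by apply/eqP => /(congr1 val) /=; rewrite ej; lia.
apply/eqP; rewrite -oppr_eq0 -(form_swap_rows v ma _ j'j); last first.
  by move=> w; apply: aa; rewrite ej /= addnS.
apply/eqP; apply: (IH _ i j') => //.
have rE l : row l (xrow j' j v) = row (tperm j' j l) v by apply/rowP => q; rewrite !mxE.
by rewrite !rE tpermL tpermD // eq_sym.
Qed.

(** When rows i and i+1 agree, deleting either leaves the same rows and the two terms cancel; every
    other term contains both equal rows. Exterior derivatives and wedges with a 1-form are
    instances. *)
Lemma alternating_sum_is_form k (Phi : vec R -> form R k) :
  (forall m, scalar (Phi^~ m)) -> (forall u, is_form (Phi u)) ->
  is_form (fun v : 'M[R]_(k.+1, 6) =>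
    \sum_(i < k.+1) (-1) ^+ i * Phi (row i v) (row' i v)).
Proof.
move=> lin fPhi; apply: alternating_adjacent.
  move=> i0 v c u w; rewrite mulr_sumr -big_split /=; apply: eq_bigr => i _.
  rewrite mulrCA -mulrDr; congr (_ * _).
  have [->|ii0] := eqVneq i i0.
    have E x : row' i0 (set_row i0 x v) = row' i0 v.
      by apply/matrixP => a b; rewrite !mxE eq_sym (negPf (neq_lift _ _)) mxE.
    by rewrite !E !set_rowE eqxx lin.
  have [j ej _] := unlift_some ii0.
  have E x : row' i (set_row i0 x v) = set_row j x (row' i v).
    apply/matrixP => a b; rewrite !mxE ej (inj_eq lift_inj).
    by case: eqP => //; rewrite !mxE.
  by rewrite !E !set_rowE (negPf ii0) (fPhi _).1.
move=> v i j ej rij.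
have ij : i != j by apply/eqP => /(congr1 val) /=; lia.
rewrite (bigD1 i) //= (bigD1 j) 1?eq_sym //= big1 => [|l /andP[li lj]].
  have -> : row' j v = row' i v.
    apply/row_matrixP => a; rewrite !row_rowsub.
    have [ai|ai] := eqVneq (a : nat) (i : nat).
      have -> : lift j a = i by apply: val_inj; rewrite /= /bump ej ai ltnn.
      by have -> : lift i a = j by apply: val_inj; rewrite /= /bump ej ai leqnn.
    congr row; apply: val_inj; rewrite /= /bump ej; congr (nat_of_bool _ + _)%N.
    by rewrite ltn_neqAle eq_sym ai.
  by rewrite ej exprS rij mulN1r addr0 mulNr subrr.
have [i' ei _] := unlift_some li; have [j' ej' _] := unlift_some lj.
rewrite ((fPhi _).2 _ i' j') ?mulr0 //.
  by apply: contra_neq ij => e; rewrite ei ej' e.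
by rewrite !row_rowsub -ei -ej'.
Qed.

End Alternating.

(** * Monomials as determinants and permutation signs *)

Lemma eqbE x y : Nat.eqb x y = (x == y).
Proof. by []. Qed.

Lemma extractP x t : if extract x t is Some (c, r)
  then exists t1 t2, [/\ t = t1 ++ x :: t2, r = t1 ++ t2 & c = odd (size t1)]
  else x \notin t.
Proof.
elim: t => [|y t IH] //=; rewrite eqbE in_cons.
have [->|xy] := eqVneq x y; first by exists [::], t.
case: (extract x t) IH => [[c r]|] //= [t1 [t2 [-> -> ->]]].
by exists (y :: t1), t2.
Qed.

Lemma esign_perm s t : esign s t -> perm_eq s t.
Proof.
elim: s t => [|x s IH] t /=; first by case: t.
have := extractP x t; case: (extract x t) => [[c r]|] // [t1 [t2 [-> -> _]]].
have := IH (t1 ++ t2); case: (esign s _) => // d /(_ isT) E _.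
by rewrite perm_sym -cat_rcons -cats1 -catA perm_catCA /= perm_cons perm_sym.
Qed.

Section Determinants.
Context {R : realType}.

Lemma eps_perm_eq (s t : seq nat) : eps R s t != 0 -> perm_eq s t.
Proof. by rewrite /eps; case E: (esign s t) => [d|]; rewrite ?eqxx // => _; apply: esign_perm; rewrite E. Qed.

(** Laplace expansion along the first row follows the recursion of [esign]: distinctness of t leaves
    one nonzero entry, at the position found by [extract]. *)
Lemma det_eps n (s t : seq nat) : size s = n -> size t = n -> uniq t ->
  \det (\matrix_(a < n, b < n) (nth 0%N s a == nth 0%N t b)%:R : 'M[R]_n) = eps R s t.
Proof.
elim: n s t => [|n IH] [|x s] t //; first by case: t => // _ _ _; rewrite det_mx00.
move=> [ss] st ut; rewrite (expand_det_row _ ord0) /eps /=.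
have := extractP x t; case: (extract x t) => [[c r]|] => [[t1 [t2 [et er ec]]]|xt]; last first.
  rewrite big1 // => j _; rewrite mxE /=; case: eqP => [e|_]; last by rewrite mul0r.
  by move: xt; rewrite e mem_nth // st.
have lt1 : (size t1 < n.+1)%N by rewrite -st et size_cat /= addnS ltnS leq_addr.
rewrite (bigD1 (Ordinal lt1)) //= [X in _ + X]big1 => [|j jt1]; last first.
  rewrite mxE /=; case: eqP => [e|_]; last by rewrite mul0r.
  case/eqP: jt1; apply: val_inj => /=; apply/eqP.
  rewrite -(nth_uniq 0%N _ _ ut) ?st // -e et nth_cat ltnn subnn //.
rewrite addr0 mxE /= {1}et nth_cat ltnn subnn eqxx mul1r /cofactor /= add0n.
have sr : size r = n.
  by apply: succn_inj; rewrite -st et er !size_cat /= addnS.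
have ur : uniq r.
  by move: ut; rewrite et er !cat_uniq /= => /and3P[-> /norP[_ ->] /andP[_ ->]].
have -> : row' ord0 (col' (Ordinal lt1) (\matrix_(a, b) (nth 0%N (x :: s) a == nth 0%N t b)%:R))
   = \matrix_(a < n, b < n) (nth 0%N s a == nth 0%N r b)%:R :> 'M[R]_n.
  apply/matrixP => a b; rewrite !mxE /=; congr (_ == _)%:R.
  rewrite er et !nth_cat /bump /=.
  case: (ltnP b (size t1)) => lb; first by rewrite add0n lb.
  by rewrite add1n ltnNge (leqW lb) /= subSn.
rewrite IH // ec /eps; case: (esign s r) => [d|]; last by rewrite mulr0.
by rewrite -signr_odd; case: (odd _); case: d; rewrite ?expr0 ?expr1 ?mul1r ?mulN1r ?opprK.
Qed.

Lemma basis_mulmx k (E A : 'M[R]_6) p : basis k E p *m A = basis k (E *m A) p.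
Proof. by rewrite /basis mul_rowsub_mx. Qed.

Lemma monomial_basis k (e : 'M[R]_6) (t : k.-tuple nat) (p : seq nat) :
  e \in unitmx -> size p = k -> all (ltn^~ 6) p ->
  all (ltn^~ 6) (map predn t) -> uniq (map predn t) ->
  monomial e t (basis k (frame e) p) = eps R p (map predn t).
Proof.
move=> eU sp p6 t6 ut; rewrite -(@det_eps k) ?size_map ?size_tuple //.
rewrite /monomial basis_mulmx mulVmx //; congr (\det _); apply/matrixP => a b.
rewrite !mxE (tnth_nth 0%N) (nth_map 0%N) ?size_tuple //; congr (_ : bool)%:R.
rewrite -val_eqE /= !inordK //.
  by have /all_nthP := t6; move=> /(_ 0%N b); rewrite size_map size_tuple ltn_ord (nth_map 0%N) ?size_tuple //; exact.
by have /all_nthP := p6; apply; rewrite sp.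
Qed.

Lemma det_is_form (F : 'M[R]_6) k (S : 'M[R]_(k, 6) -> 'M[R]_k) (g : 'I_k -> 'I_6) :
  (forall v, S v = \matrix_(a, b) (v *m F) a (g b)) -> is_form (fun v => \det (S v)).
Proof.
move=> SE.
have rowS x y : row y (S x) = \row_b (row y x *m F) 0 (g b).
  by rewrite SE; apply/rowP => b; rewrite [LHS]mxE [LHS]mxE [RHS]mxE -row_mul [RHS]mxE.
split=> [i v c u w|v i j ij rij]; last first.
  apply: (determinant_alternate ij) => b.
  have E l : S v l b = row l (S v) 0 b by rewrite mxE.
  by rewrite !E !rowS rij.
have rowS' x y : row' i (S (set_row i x v)) = row' i (S (set_row i y v)).
  apply/row_matrixP => j; rewrite !row_rowsub !rowS !set_rowE.
  by rewrite eq_sym (negPf (neq_lift _ _)).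
rewrite (determinant_multilinear (A := S (set_row i (c *: u + w) v))
  (B := S (set_row i u v)) (C := S (set_row i w v)) (i0 := i) (b := c) (c := 1)) ?mul1r //.
rewrite !rowS !set_rowE eqxx; apply/rowP => b.
by rewrite mulmxDl -scalemxAl scale1r 5!mxE [RHS]mxE [fun_of_matrix (_ *: _) _ _]mxE !mxE.
Qed.

Lemma monomial_is_form k (e : 'M[R]_6) (t : k.-tuple nat) : is_form (monomial e t).
Proof.
by apply: (@det_is_form e k _ (fun b => inord (tnth t b).-1)) => v.
Qed.

Lemma is_formD k (a b : form R k) : is_form a -> is_form b -> is_form (fun v => a v + b v).
Proof.
move=> [ma aa] [mb ab]; split=> [i v c u w|v i j ij rij].
  by rewrite ma mb mulrDr addrACA.
by rewrite (aa _ i j) // (ab _ i j) // addr0.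
Qed.

Lemma is_formZ k (c : R) (a : form R k) : is_form a -> is_form (fun v => c * a v).
Proof.
move=> [ma aa]; split=> [i v d u w|v i j ij rij].
  by rewrite ma mulrDr mulrCA.
by rewrite (aa _ i j) // mulr0.
Qed.

Lemma is_formN k (a : form R k) : is_form a -> is_form (fun v => - a v).
Proof.
move=> [ma aa]; split=> [i v d u w|v i j ij rij].
  by rewrite ma opprD mulrN.
by rewrite (aa _ i j) // oppr0.
Qed.

Lemma is_form_sum k (I : Type) (r : seq I) (P : pred I) (a : I -> form R k) :
  (forall i, is_form (a i)) -> is_form (fun v => \sum_(i <- r | P i) a i v).
Proof.
move=> fa; split=> [j v d u w|v i j ij rij].
  rewrite mulr_sumr -big_split; apply: eq_bigr => i _; exact: (fa i).1.
by rewrite big1 // => l _; apply: ((fa l).2 _ i j).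
Qed.

End Determinants.

(** * Wedge product with a 1-form *)

Section WedgeOneForm.
Context {R : realType}.

Lemma sum_perm_lift k (F : 'S_k.+1 -> R) :
  \sum_s F s = \sum_(i < k.+1) \sum_(s : 'S_k) F (lift_perm ord0 i s).
Proof.
rewrite (reindex (fun is_ : 'I_k.+1 * 'S_k => lift_perm ord0 is_.1 is_.2)).
  by rewrite pair_bigA.
apply: onW_bij; apply: inj_card_bij; last by rewrite card_prod card_ord !card_Sn factS.
move=> [i s] [j t] /= /permP E.
have ij : i = j by have := E ord0; rewrite !lift_perm_id.
rewrite ij; congr pair; apply/permP => l.
by have := E (lift ord0 l); rewrite !lift_perm_lift ij => /lift_inj.
Qed.

(** Permutations are grouped by the argument fed to a; within a group the k! terms agree since b is
    alternating, which cancels the factor in [wedge]. *)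
Lemma wedge1E k (a : form R 1) (b : form R k) v : is_form b ->
  wedge a b v = \sum_(i < k.+1) (-1) ^+ i * (a (row i v) * b (row' i v)).
Proof.
move=> fb; rewrite /wedge (_ : (1`! * k`!)%N = k`!) ?sum_perm_lift; last by rewrite mul1n.
have kn0 : (k`!)%:R != 0 :> R by rewrite pnatr_eq0 -lt0n fact_gt0.
apply: (mulfI kn0); rewrite mulVKf // mulr_sumr; apply: eq_bigr => i _.
rewrite (eq_bigr (fun=> (-1) ^+ i * (a (row i v) * b (row' i v)))) => [|s _].
  by rewrite sumr_const card_Sn mulr_natl.
have -> : usubmx (row_perm (lift_perm ord0 i s) v : 'M[R]_(1 + k, 6)) = row i v.
  apply/matrixP => x y; rewrite !mxE; congr (v _ _).
  have -> : lshift k x = ord0 by apply: val_inj; rewrite /= ord1.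
  by rewrite lift_perm_id.
have -> : dsubmx (row_perm (lift_perm ord0 i s) v : 'M[R]_(1 + k, 6)) = row_perm s (row' i v).
  apply/matrixP => x y; rewrite !mxE; congr (v _ _).
  have -> : rshift 1 x = lift ord0 x by apply: val_inj.
  by rewrite lift_perm_lift.
rewrite form_perm // odd_lift_perm /= signr_addb signr_odd.
rewrite -!mulrA; congr (_ * _).
by rewrite mulrCA; congr (_ * _); rewrite mulrA -signr_addb addbb mul1r.
Qed.

Lemma wedge1_is_form k (a : form R 1) (b : form R k) : is_form a -> is_form b ->
  is_form (wedge a b).
Proof.
move=> fa fb; have -> : wedge a b =
    fun v : 'M[R]_(k.+1, 6) => \sum_(i < k.+1) (-1) ^+ i * (a (row i v) * b (row' i v)).
  by apply/funext => v; exact: wedge1E.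
apply: (alternating_sum_is_form (Phi := fun u m => a u * b m)) => [m c u w|u].
  have E x : set_row ord0 x 0 = x :> 'M[R]_(1, 6).
    by apply/row_matrixP => i; rewrite set_rowE ord1 eqxx row_id.
  by have := fa.1 ord0 0 c u w; rewrite !E => ->; rewrite mulrDl mulrA.
exact: is_formZ.
Qed.

Lemma sumtoE n (f : nat -> R) : sumto n f = \sum_(i < n) f i.
Proof. by elim: n => [|n IH]; rewrite ?big_ord0 //= big_ord_recr /= IH. Qed.

Lemma sgE i (x : R) : sg i x = (-1) ^+ i * x.
Proof.
rewrite -signr_odd /sg; have -> : Nat.odd i = odd i.
  have : Nat.odd i = odd i /\ Nat.odd i.+1 = odd i.+1; last by case.
  elim: i => [//|i [IH1 IH2]]; split=> //.
  by rewrite -[LHS]/(Nat.odd i) IH1 /= negbK.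
by case: odd; rewrite ?mulN1r ?mul1r.
Qed.

Lemma nth_without i j p : nth 0%N (without i p) j = nth 0%N p (bump i j).
Proof.
rewrite /without nth_cat size_take /bump; case: (ltnP i (size p)) => ip.
  case: ltnP => ji; first by rewrite nth_take // leqNgt ji.
  by rewrite nth_drop add1n; congr nth; lia.
case: ltnP => jp; first by rewrite nth_take ?(leq_trans jp) // leqNgt (leq_trans jp ip) add0n.
rewrite nth_drop [LHS]nth_default ?[RHS]nth_default //; lia.
Qed.

Lemma row'_basis k (E : 'M[R]_6) p (i : 'I_k.+1) :
  row' i (basis k.+1 E p) = basis k E (without i p).
Proof. by apply/matrixP => a b; rewrite !mxE nth_without. Qed.

Lemma row_basis k (E : 'M[R]_6) p (i : 'I_k) :
  row i (basis k E p) = row (inord (nth 0%N p i)) E.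
Proof. by apply/rowP => b; rewrite !mxE. Qed.

Lemma wedge1_basis k (E : 'M[R]_6) (a : form R 1) (b : form R k) p : is_form b ->
  wedge a b (basis k.+1 E p) =
  wedge1 k (fun i => a (row (inord i) E)) (fun q => b (basis k E q)) p.
Proof.
move=> fb; rewrite wedge1E // /wedge1 sumtoE; apply: eq_bigr => i _.
by rewrite sgE row_basis row'_basis.
Qed.

Lemma set_row_basis k (E : 'M[R]_6) p (i : 'I_k) l : (l < 6)%N -> size p = k ->
  set_row i (row (inord l) E) (basis k E p) = basis k E (set_nth 0%N p i l).
Proof.
move=> l6 sp; apply/row_matrixP => j; rewrite set_rowE !row_basis nth_set_nth /=.
by rewrite -val_eqE /=; case: eqP.
Qed.

Lemma sum6E (f : nat -> R) : \sum_(l < 6) f l = sum6 f.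
Proof. by rewrite !big_ord_recr big_ord0 /= add0r. Qed.

End WedgeOneForm.

(** * The Hodge star on frame vectors *)

Section Hodge.
Context {R : realType}.

Lemma row_stack_u p q n (pq : (p + q = n)%N) (A : 'M[R]_(p, 6)) (B : 'M[R]_(q, 6)) i :
  row (cast_ord pq (lshift q i)) (castmx (pq, erefl) (col_mx A B)) = row i A.
Proof. by apply/rowP => j; rewrite mxE castmxE cast_ord_id cast_ordK col_mxEu mxE. Qed.

Lemma row_stack_d p q n (pq : (p + q = n)%N) (A : 'M[R]_(p, 6)) (B : 'M[R]_(q, 6)) i :
  row (cast_ord pq (rshift p i)) (castmx (pq, erefl) (col_mx A B)) = row i B.
Proof. by apply/rowP => j; rewrite mxE castmxE cast_ord_id cast_ordK col_mxEd mxE. Qed.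

Lemma stack_ord p q n (pq : (p + q = n)%N) (l : 'I_n) :
  (exists i, l = cast_ord pq (lshift q i)) \/ (exists j, l = cast_ord pq (rshift p j)).
Proof.
have [i|j] := split_ordP (cast_ord (esym pq) l) => e.
  by left; exists i; rewrite -e cast_ordKV.
by right; exists j; rewrite -e cast_ordKV.
Qed.

Lemma stack_is_form_u p q n (pq : (p + q = n)%N) (b : form R n) (B : 'M[R]_(q, 6)) :
  is_form b -> is_form (fun A : 'M[R]_(p, 6) => b (castmx (pq, erefl) (col_mx A B))).
Proof.
move=> [mb ab]; split=> [i v c u w|v i j ij rij]; last first.
  apply: (ab _ (cast_ord pq (lshift q i)) (cast_ord pq (lshift q j))).
    by rewrite (inj_eq (@cast_ord_inj _ _ _)) (inj_eq (@lshift_inj _ _)).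
  by rewrite !row_stack_u.
have E x : castmx (pq, erefl) (col_mx (set_row i x v) B) =
    set_row (cast_ord pq (lshift q i)) x (castmx (pq, erefl) (col_mx v B)).
  apply/row_matrixP => l; rewrite set_rowE; case: (stack_ord pq l) => -[l' ->].
    by rewrite !row_stack_u set_rowE (inj_eq (@cast_ord_inj _ _ _)) (inj_eq (@lshift_inj _ _)).
  rewrite !row_stack_d (inj_eq (@cast_ord_inj _ _ _)).
  by case: eqP => // /eqP; rewrite eq_rlshift.
by rewrite !E mb.
Qed.

Lemma stack_is_form_d p q n (pq : (p + q = n)%N) (b : form R n) (A : 'M[R]_(p, 6)) :
  is_form b -> is_form (fun B : 'M[R]_(q, 6) => b (castmx (pq, erefl) (col_mx A B))).
Proof.
move=> [mb ab]; split=> [i v c u w|v i j ij rij]; last first.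
  apply: (ab _ (cast_ord pq (rshift p i)) (cast_ord pq (rshift p j))).
    by rewrite (inj_eq (@cast_ord_inj _ _ _)) (inj_eq (@rshift_inj _ _)).
  by rewrite !row_stack_d.
have E x : castmx (pq, erefl) (col_mx A (set_row i x v)) =
    set_row (cast_ord pq (rshift p i)) x (castmx (pq, erefl) (col_mx A v)).
  apply/row_matrixP => l; rewrite set_rowE; case: (stack_ord pq l) => -[l' ->].
    rewrite !row_stack_u (inj_eq (@cast_ord_inj _ _ _)).
    by case: eqP => // /eqP; rewrite eq_lrshift.
  by rewrite !row_stack_d set_rowE (inj_eq (@cast_ord_inj _ _ _)) (inj_eq (@rshift_inj _ _)).
by rewrite !E mb.
Qed.

Lemma hodge_is_form p q (pq : (p + q = 6)%N) (e : 'M[R]_6) (a : form R p) :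
  is_form (hodge pq e a).
Proof.
apply: is_formZ; apply: is_form_sum => f; apply: is_formZ.
exact: stack_is_form_d (monomial_is_form _ _).
Qed.

Lemma stack_basis p q (pq : (p + q = 6)%N) (E : 'M[R]_6) f s :
  castmx (pq, erefl) (col_mx (rowsub f E) (basis q E s)) = basis 6 E (codes f ++ s).
Proof.
apply/row_matrixP => l; rewrite row_basis nth_cat size_codes.
case: (stack_ord pq l) => -[l' ->].
  by rewrite row_stack_u row_rowsub /= ltn_ord nth_codes inord_val.
by rewrite row_stack_d row_basis /= ltnNge leq_addr /= addKn.
Qed.

Lemma sum_perm_orbit p (F : {ffun 'I_p -> 'I_6} -> R) (f0 : 'I_p -> 'I_6) : injective f0 ->
  (forall s : 'S_p, F [ffun i => f0 (s i)] = F [ffun i => f0 i]) ->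
  (forall f, F f != 0 -> exists s : 'S_p, f =1 f0 \o s) ->
  \sum_f F f = (p`!)%:R * F [ffun i => f0 i].
Proof.
move=> f0i Fs F0; pose h (s : 'S_p) : {ffun 'I_p -> 'I_6} := [ffun i => f0 (s i)].
have hi : injective h.
  move=> s t hst; apply/permP => i; apply: f0i.
  by have := congr1 (fun f : {ffun 'I_p -> 'I_6} => f i) hst; rewrite !ffunE.
rewrite (bigID (mem (h @: [set: 'S_p]))) /= [X in _ + X]big1 => [|f nf]; last first.
  apply/eqP; apply: contraNT nf => /F0[s fs]; apply/imsetP; exists s; rewrite ?inE //.
  by apply/ffunP => i; rewrite ffunE fs.
rewrite addr0 big_imset /=; last by move=> s t _ _ /hi.
rewrite (eq_bigr (fun=> F [ffun i => f0 i])) => [|s _]; last exact: Fs.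
by rewrite sumr_const cardsT card_Sn mulr_natl.
Qed.

Lemma notinE x s : notin x s = (x \notin s).
Proof. by elim: s => //= y s IH; rewrite eqbE in_cons IH; case: eqP. Qed.

Lemma complE r s : compl r s = [seq x <- r | x \notin s].
Proof. by elim: r => //= x r ->; rewrite notinE; case: ifP. Qed.

Lemma all_six p : perm_eq p six -> all (ltn^~ 6) p.
Proof. by move=> /perm_all ->. Qed.

(** Only rearrangements of the complement of s contribute. All p! of them give the same term,
    because the sign of a cancels that of the volume form, and the factor 1/p! disappears. *)
Lemma hodge_basis p q (pq : (p + q = 6)%N) (e : 'M[R]_6) (a : form R p) s :
  e \in unitmx -> is_form a -> size s = q -> all (ltn^~ 6) s ->
  hodge pq e a (basis q (frame e) s) = hod (fun c => a (basis p (frame e) c)) s.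
Proof.
move=> eU fa ss s6; rewrite /hodge /hod.
have pn0 : (p`!)%:R != 0 :> R by rewrite pnatr_eq0 -lt0n fact_gt0.
apply: (mulfI pn0); rewrite mulVKf //.
pose b (N : 'M[R]_(p, 6)) := monomial e [tuple 1; 2; 3; 4; 5; 6]%N
  (castmx (pq, erefl) (col_mx N (basis q (frame e) s))).
have fb : is_form b := stack_is_form_u pq _ (monomial_is_form _ _).
have bE f : b (rowsub f (frame e)) = eps R (codes f ++ s) six.
  rewrite /b stack_basis monomial_basis //.
    by rewrite size_cat size_codes ss.
  by rewrite all_cat codes_lt6.
rewrite (eq_bigr (fun f : {ffun 'I_p -> 'I_6} =>
  a (rowsub f (frame e)) * b (rowsub f (frame e)))) //.
set c := compl six s.
(* A repeated index in s makes every volume factor vanish, on both sides. *)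
have [us|nus] := boolP (uniq s); last first.
  have eps0 t : eps R (t ++ s) six = 0.
    apply/eqP; apply: contraNT nus => /eps_perm_eq/perm_uniq.
    by rewrite cat_uniq /= => /and3P[].
  by rewrite big1 => [|f _]; rewrite ?bE eps0 !mulr0.
have pc : perm_eq (c ++ s) six.
  rewrite /c complE perm_sym -(perm_filterC (fun x => x \notin s) six) perm_cat2l.
  apply: uniq_perm => // [|x]; first by rewrite filter_uniq.
  rewrite mem_filter /= negbK; case: (boolP (x \in s)) => //= /(allP s6).
  by move: x => [|[|[|[|[|[|//]]]]]].
have sc : size c = p.
  by have := perm_size pc; rewrite size_cat ss => E; apply/eqP; rewrite -(eqn_add2r q) E pq.
have c6 : all (ltn^~ 6) c by have := all_six pc; rewrite all_cat => /andP[].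
have uc : uniq c by have := perm_uniq pc; rewrite cat_uniq /= => /and3P[].
pose f0 (i : 'I_p) : 'I_6 := inord (nth 0%N c i).
have cf0 : codes f0 = c.
  apply: (@eq_from_nth _ 0%N); rewrite size_codes // => i ip.
  rewrite (nth_codes f0 (Ordinal ip)) /f0 inordK //=.
  by apply: (allP c6); rewrite mem_nth // sc.
have f0i : injective f0.
  move=> i j; rewrite /f0 => /(congr1 val); rewrite /= !inordK; last 2 first.
  - by apply: (allP c6); rewrite mem_nth // sc.
  - by apply: (allP c6); rewrite mem_nth // sc.
  by move/eqP; rewrite nth_uniq ?sc // => /eqP/val_inj.
have Ef (f : 'I_p -> 'I_6) : rowsub [ffun i => f i] (frame e) = rowsub f (frame e).
  by apply/row_matrixP => i; rewrite !row_rowsub ffunE.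
rewrite (sum_perm_orbit (f0 := f0)) //.
- by rewrite !Ef bE cf0.
- move=> s'; rewrite !Ef -/(f0 \o s') !form_rowsub_perm //.
  by rewrite mulrACA -signr_addb addbb mul1r.
move=> f; rewrite bE mulf_eq0 negb_or => /andP[_ /eps_perm_eq pf].
have {}pf : perm_eq (codes f) c.
  by rewrite -(perm_cat2r s) (perm_trans pf) // perm_sym.
rewrite -cf0 in pf.
pose t := [tuple val (f0 i) | i < p].
have /tuple_permP[s' E] : perm_eq (codes f) t by [].
exists s' => i; apply: val_inj => /=.
by rewrite -nth_codes E -tnth_nth !tnth_mktuple.
Qed.

End Hodge.

(** * Inner products and norms as sums over lists of indices *)

Section Inner.
Context {R : realType}.

Fixpoint sumlist (k : nat) (G : seq nat -> R) : R :=
  if k is k'.+1 then sum6 (fun l => sumlist k' (fun s => G (l :: s))) else G [::].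

Lemma sum_codes k (G : seq nat -> R) :
  \sum_(f : {ffun 'I_k -> 'I_6}) G (codes f) = sumlist k G.
Proof.
elim: k G => [|k IH] G.
  have c0 (f : {ffun 'I_0 -> 'I_6}) : codes f = [::].
    by apply: size0nil; rewrite size_codes.
  rewrite (eq_bigr (fun=> G [::])) => [|f _]; last by rewrite c0.
  by rewrite sumr_const card_ffun !card_ord expn0 mulr1n.
pose h (lf : 'I_6 * {ffun 'I_k -> 'I_6}) : {ffun 'I_k.+1 -> 'I_6} :=
  [ffun i => if unlift ord0 i is Some j then lf.2 j else lf.1].
pose h' (f : {ffun 'I_k.+1 -> 'I_6}) := (f ord0, [ffun j => f (lift ord0 j)]).
have hK : cancel h h'.
  move=> [l f]; rewrite /h /h' ffunE unlift_none /=; congr pair.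
  by apply/ffunP => j; rewrite !ffunE liftK.
have h'K : cancel h' h.
  move=> f; apply/ffunP => i; rewrite ffunE /=.
  by case: unliftP => [j|] ->; rewrite ?ffunE.
rewrite (reindex h); last by exists h' => x _; [exact: hK | exact: h'K].
rewrite /= -sum6E.
rewrite (eq_bigr (fun lf : 'I_6 * {ffun 'I_k -> 'I_6} => G (val lf.1 :: codes lf.2))) => [|[l f] _].
  rewrite -(pair_bigA _ (fun (l : 'I_6) (f : {ffun 'I_k -> 'I_6}) => G (val l :: codes f))) /=.
  by apply: eq_bigr => l _; rewrite (IH (fun s => G (val l :: s))).
congr G; rewrite /codes enum_ordSl /= ffunE unlift_none -map_comp; congr (_ :: _).
by apply: eq_map => j /=; rewrite ffunE liftK.
Qed.

Lemma codes_increasing k (f : {ffun 'I_k -> 'I_6}) :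
  [forall i : 'I_k, forall j : 'I_k, (i < j)%N ==> (f i < f j)%N] = sorted ltn (codes f).
Proof.
apply/idP/(sortedP 0%N) => [/'forall_forallP H i|H].
  rewrite size_codes => ik; have ik' := ltnW ik.
  have := H (Ordinal ik') (Ordinal ik); rewrite /= ltnSn /=.
  by rewrite (nth_codes f (Ordinal ik')) (nth_codes f (Ordinal ik)).
apply/'forall_forallP => i j; apply/implyP => ij.
have srt : sorted ltn (codes f) by apply/(sortedP 0%N).
rewrite -!nth_codes; apply: (sorted_ltn_nth ltn_trans 0%N srt) => //;
  by rewrite inE size_codes ltn_ord.
Qed.

Lemma inner_codes k (e : 'M[R]_6) (a b : form R k) : inner e a b =
  sumlist k (fun s => if sorted ltn s then a (basis k (frame e) s) * b (basis k (frame e) s) else 0).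
Proof.
rewrite -sum_codes /inner [LHS]big_mkcond; apply: eq_bigr => f _.
by rewrite codes_increasing !basis_codes.
Qed.

Lemma sqnorm3_codes (e : 'M[R]_6) (T : form R 3) : sqnorm3 e T =
  sum6 (fun i => sum6 (fun j => sum6 (fun k => T (basis 3 (frame e) [:: i; j; k]) ^+ 2))).
Proof.
rewrite -[RHS]/(sumlist 3 (fun s => T (basis 3 (frame e) s) ^+ 2)) -sum_codes.
by apply: eq_bigr => f _; rewrite basis_codes.
Qed.

Lemma inner1_codes (e : 'M[R]_6) (a b : form R 1) : inner e a b =
  sum6 (fun i => a (row (inord i) (frame e)) * b (row (inord i) (frame e))).
Proof.
rewrite inner_codes /=; have E i : basis 1 (frame e) [:: i] = row (inord i) (frame e).
  by apply/matrixP => a' b'; rewrite !mxE ord1.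
by rewrite /sum6 !E.
Qed.

Lemma inner_dotP (e : 'M[R]_6) (a P : form R 3) :
  (forall i j k, (i < 6)%N -> (j < 6)%N -> (k < 6)%N ->
    P (basis 3 (frame e) [:: i; j; k]) = tP R [:: i; j; k]) ->
  inner e a P = dotP (fun i j k => a (basis 3 (frame e) [:: i; j; k])).
Proof.
move=> PE; rewrite inner_codes /= /sum6 /=.
rewrite !PE //; set A := fun i j k => a (basis 3 (frame e) [:: i; j; k]).
have E i j k : a (basis 3 (frame e) [:: i; j; k]) = A i j k by [].
rewrite !E; clearbody A; tab; ring.
Qed.

Lemma inner_dotQ (e : 'M[R]_6) (a Q : form R 3) :
  (forall i j k, (i < 6)%N -> (j < 6)%N -> (k < 6)%N ->
    Q (basis 3 (frame e) [:: i; j; k]) = tQ R [:: i; j; k]) ->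
  inner e a Q = dotQ (fun i j k => a (basis 3 (frame e) [:: i; j; k])).
Proof.
move=> PE; rewrite inner_codes /= /sum6 /=.
rewrite !PE //; set A := fun i j k => a (basis 3 (frame e) [:: i; j; k]).
have E i j k : a (basis 3 (frame e) [:: i; j; k]) = A i j k by [].
rewrite !E; clearbody A; tab; ring.
Qed.

End Inner.

Local Open Scope classical_set_scope.
Local Open Scope ring_scope.

(** * From directional derivatives to differentiability and symmetric second derivatives *)

Section MeanValue.
Context {R : realType}.
Implicit Types (f g : vec R -> R) (U : set (vec R)) (p u v w x : vec R).

Lemma is_derive_line f p h (s : R) :
  derivable f (p + s *: h) h ->
  is_derive s 1 (fun t : R => f (p + t *: h)) ('D_h f (p + s *: h)).
Proof.
have E : (fun t : R => t^-1 *: (((fun t : R => f (p + t *: h)) \o shift s) (t *: (1 : R)) - f (p + s *: h)))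
   = (fun t : R => t^-1 *: ((f \o shift (p + s *: h)) (t *: h) - f (p + s *: h))).
  apply/funext => t /=; congr (_ *: (f _ - _)).
  by rewrite [t *: 1]mulr1 scalerDl addrCA.
move=> df; split; first by rewrite /derivable E.
by rewrite /derive E.
Qed.

Lemma mean_value_line f p h :
  (forall s : R, 0 <= s <= 1 -> derivable f (p + s *: h) h) ->
  exists2 c : R, 0 <= c <= 1 & f (p + h) - f p = 'D_h f (p + c *: h).
Proof.
move=> df.
have [|||c c01] := @MVT_segment R (fun t : R => f (p + t *: h))
  (fun t => 'D_h f (p + t *: h)) 0 1.
- exact: ler01.
- by move=> s; rewrite in_itv /= => /andP[/ltW s0 /ltW s1]; apply/is_derive_line/df; rewrite s0.
- apply: derivable_within_continuous => s; rewrite in_itv /= => s01.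
  by have [] := is_derive_line (df s s01).
by rewrite scale1r scale0r addr0 subr0 mulr1 => ->; exists c; rewrite -?in_itv.
Qed.

Lemma derive_line f x v : 'D_v f x = 'D_1 (fun t : R => f (t *: v + x)) 0.
Proof.
rewrite /derive; set g1 := fun h => h^-1 *: _; set g2 := fun h => h^-1 *: _.
suff -> : g1 = g2 by []; apply/funext => h; rewrite /g1 /g2 /=.
by rewrite addr0 scale0r add0r [h *: 1]mulr1.
Qed.

Lemma is_deriveZv f x v (a : R) : derivable f x v ->
  is_derive x (a *: v) f (a * 'D_v f x).
Proof.
rewrite derivable1P => /derivable1_diffP dv.
have E : (fun t : R => f (t *: (a *: v) + x)) = (fun t : R => f (t *: v + x)) \o ( *%R a).
  by apply/funext => t /=; rewrite scalerA mulrC.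
have [da Da] : is_derive (0 : R) 1 ( *%R a : R -> R) a.
  by have := is_deriveZ a (is_derive_id (0 : R) 1); rewrite [a *: 1]mulr1.
have d0 : derivable (fun t : R => f (t *: v + x)) (a * 0) 1.
  by rewrite mulr0; exact/derivable1_diffP.
split.
  rewrite derivable1P E; apply/derivable1_diffP/differentiable_comp.
    exact/derivable1_diffP.
  exact/derivable1_diffP.
rewrite !derive_line E -!derive1E derive1_comp //.
by rewrite [X in _ * X]derive1E Da mulr0 mulrC.
Qed.

Lemma is_derive_translate f (y c v : vec R) (d : R) :
  is_derive (y + c) v f d -> is_derive y v (fun z => f (z + c)) d.
Proof.
have E : (fun h : R => h^-1 *: (((fun z => f (z + c)) \o shift y) (h *: v) - f (y + c)))
   = (fun h : R => h^-1 *: ((f \o shift (y + c)) (h *: v) - f (y + c))).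
  by apply/funext => h /=; rewrite addrA.
by case=> df <-; split; [rewrite /derivable E | rewrite /derive E].
Qed.

Lemma open_normP U x : open U -> U x ->
  exists2 r : R, 0 < r & forall h, `|h| < r -> U (x + h).
Proof.
move=> oU Ux; have /nbhs_normP[r r0 rU] := open_nbhs_nbhs (conj oU Ux).
by exists r => // h hr; apply: rU => /=; rewrite opprD addNKr normrN.
Qed.

Lemma continuous_normP f x : {for x, continuous f} ->
  forall e : R, 0 < e -> exists2 r : R, 0 < r & forall h, `|h| < r -> `|f (x + h) - f x| < e.
Proof.
move=> /cvgrPdist_lt fx e e0; have /nbhs_normP[r r0 rU] := fx e e0.
exists r => // h hr; rewrite distrC; apply: rU => /=; by rewrite opprD addNKr normrN.
Qed.

Lemma Ck_onP k U f : Ck_on k.+1 U f ->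
  [/\ {in U, continuous f}, forall v x, U x -> derivable f x v
    & forall v, Ck_on k U ('D_v f)].
Proof. by case=> cf df; split=> // v; have [] := df v. Qed.

Lemma Ck_on_continuous k U f : Ck_on k U f -> {in U, continuous f}.
Proof. by case: k => [|k] []. Qed.

(* The increment of f along t u, starting from x + t w. *)
Lemma increment_cvg U f x u w : open U -> Ck_on 1 U f -> U x ->
  (fun t : R => t^-1 *: (f (x + t *: w + t *: u) - f (x + t *: w))) @ 0^' --> 'D_u f x.
Proof.
move=> oU /Ck_onP[_ df /(_ u)/Ck_on_continuous cf] Ux.
have [r r0 rU] := open_normP oU Ux.
apply/cvgrPdist_lt => e e0.
have [d d0 dU] := continuous_normP (cf x (mem_set Ux)) e0.
pose m := Num.min r d / (`|w| + `|u| + 1).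
have n0 : 0 < `|w| + `|u| + 1 by rewrite ltr_wpDl // addr_ge0.
have m0 : 0 < m by rewrite divr_gt0 // lt_min r0.
near=> t.
have t0 : t != 0 by near: t; exact: nbhs_dnbhs_neq.
have tm : `|t| < m by near: t; exact: dnbhs0_lt.
have small (s : R) : 0 <= s <= 1 -> `|t *: w + s *: (t *: u)| < Num.min r d.
  move=> /andP[s0 s1]; rewrite -(@ltr_pM2r _ (`|w| + `|u| + 1)^-1) ?invr_gt0 //.
  apply: le_lt_trans tm; rewrite ler_pdivrMr // (le_trans (ler_normD _ _)) //.
  rewrite !normrZ (ger0_norm s0) !mulrDr -addrA lerD2l // ler_wpDr ?mulr1 //.
  by rewrite ler_piMl // mulr_ge0.
have [|c /small c01 ->] := @mean_value_line f (x + t *: w) (t *: u).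
  move=> s /small; rewrite lt_min -addrA => /andP[/rU Us _].
  by have [] := is_deriveZv t (df u _ Us).
have [/rU Uc /dU] : `|t *: w + c *: (t *: u)| < r /\ `|t *: w + c *: (t *: u)| < d.
  by move: c01; rewrite lt_min => /andP[].
rewrite addrA in Uc *; rewrite distrC => Dc; have [_ ->] := is_deriveZv t (df u _ Uc).
rewrite (_ : t^-1 *: (t * _) = 'D_u f (x + t *: w + c *: (t *: u))); last exact: mulKf.
exact: Dc.
Unshelve. all: by end_near. Qed.

(** The increment along t(u + v) is the increment along tv followed by that along tu from the moved
    point x + tv; [increment_cvg] handles this moving base point. *)
Lemma deriveDv U f x u v : open U -> Ck_on 1 U f -> U x ->
  'D_(u + v) f x = 'D_u f x + 'D_v f x.
Proof.
move=> oU Cf Ux.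
have Du := @increment_cvg U f x u v oU Cf Ux.
have Dv := @increment_cvg U f x v 0 oU Cf Ux.
have Duv := @increment_cvg U f x (u + v) 0 oU Cf Ux.
have E : (fun t : R => t^-1 *: (f (x + t *: 0 + t *: (u + v)) - f (x + t *: 0))) =
    (fun t : R => t^-1 *: (f (x + t *: v + t *: u) - f (x + t *: v)))
    + (fun t : R => t^-1 *: (f (x + t *: 0 + t *: v) - f (x + t *: 0))).
  apply/funext => t; rewrite -[LHS]/(t^-1 * _) -[RHS]/(t^-1 * _ + t^-1 * _) -mulrDr.
  rewrite scaler0 !addr0; congr (_ * _).
  by rewrite addrA subrK scalerDr [t *: u + _]addrC addrA.
by rewrite E in Duv; apply: (cvg_unique _ Duv) (cvgD Du Dv).
Qed.

Lemma derive_sum_delta U f x v : open U -> Ck_on 1 U f -> U x ->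
  'D_v f x = \sum_(i < 6) v 0 i * 'D_(delta_mx 0 i) f x.
Proof.
move=> oU Cf Ux; have /Ck_onP[_ df _] := Cf.
pose L u := 'D_u f x.
have L0 : L 0 = 0 by exact: derive0.
have LD : {morph L : u w / u + w} by move=> u w; exact: deriveDv Cf Ux.
rewrite -/(L v) {1}(row_sum_delta v) (big_morph L LD L0).
by apply: eq_bigr => i _; have [] := is_deriveZv (v 0 i) (df (delta_mx 0 i) x Ux).
Qed.

(** By the mean value theorem on the segment, the error of the linear map h -> sum_i h_i D_i f(x) is
    sum_i h_i (D_i f(x + s h) - D_i f(x)), which is o(h) by continuity of the partial
    derivatives. *)
Lemma differentiable_C1 U f x : open U -> Ck_on 1 U f -> U x -> differentiable f x.
Proof.
move=> oU Cf Ux; have /Ck_onP[_ df cf] := Cf.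
pose c i : R := 'D_(delta_mx 0 i) f x.
pose df0 (h : vec R) : R := \sum_(i < 6) h 0 i * c i.
have lin_df0 : linear df0.
  move=> a u v; rewrite /df0 scaler_sumr -big_split /=; apply: eq_bigr => i _.
  by rewrite !mxE mulrDl -mulrA.
pose L := GRing.isLinear.Build R (vec R) R *:%R df0 lin_df0.
pose l : {linear vec R -> R} := HB.pack df0 L.
have cl : continuous l.
  have -> : (l : vec R -> R) = \sum_(i < 6) ((fun h : vec R => h 0 i) * cst (c i)).
    by apply/funext => h; rewrite fct_sumE.
  move=> h; apply/differentiable_continuous/differentiable_sum => i.
  by apply: differentiableM => //; exact: differentiable_coord.
have E := @diff_unique R (vec R) R f l x cl.
have E2 := @diff_locallyP R (vec R) R x f.
move: E; set Q := (X in (X -> _) -> _) => E.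
suff q : Q by apply/E2; rewrite (E q); split.
clear E E2; rewrite {}/Q.
  apply/eqaddoP => e e0; have [r r0 rU] := open_normP oU Ux.
  have cc i : \forall h \near (0 : vec R), forall s : R, 0 <= s <= 1 ->
      `|'D_(delta_mx 0 i) f (x + s *: h) - c i| <= e / 6.
    have [||d d0 dU] := @continuous_normP ('D_(delta_mx 0 i) f) x _ (e / 6).
    - by have [/(_ x (mem_set Ux))] := cf (delta_mx 0 i).
    - by rewrite divr_gt0.
    near=> h; move=> s /andP[s0 s1]; apply/ltW/dU; rewrite normrZ ger0_norm //.
    have : `|h| < d by near: h; exact: (@nbhs0_lt R (vec R) d d0).
    by apply: le_lt_trans; rewrite ler_piMl.
  have {}cc := @filter_forall _ _ _ (nbhs (0 : vec R)) _ cc.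
  near=> h.
  have ch : forall i (s : R), 0 <= s <= 1 ->
      `|'D_(delta_mx 0 i) f (x + s *: h) - c i| <= e / 6 by near: h; exact: cc.
  have hr : `|h| < r by near: h; exact: (@nbhs0_lt R (vec R) r r0).
  have Us (s : R) : 0 <= s <= 1 -> U (x + s *: h).
    move=> /andP[s0 s1]; apply: rU; apply: le_lt_trans hr.
    by rewrite normrZ ger0_norm // ler_piMl.
  have [s s01 Ds] := @mean_value_line f x h (fun s s01 => df h _ (Us s s01)).
  have -> : (f \o shift x - (cst (f x) + (l : vec R -> R))) h
      = \sum_(i < 6) h 0 i * ('D_(delta_mx 0 i) f (x + s *: h) - c i).
    transitivity (f (x + h) - f x - df0 h); first by rewrite opprD addrA [x + h]addrC.
    rewrite Ds (derive_sum_delta h oU Cf (Us s s01)) -sumrB.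
    by apply: eq_bigr => i _; rewrite mulrBr.
  rewrite (le_trans (ler_norm_sum _ _ _)) //.
  have -> : e * `|h| = \sum_(i < 6) `|h| * (e / 6).
    by rewrite sumr_const card_ord -mulr_natr; field.
  apply: ler_sum => i _; rewrite normrM ler_pM //.
    by rewrite [leRHS]/Num.Def.normr /= mx_normrE (le_bigmax _ (fun ij => `|h ij.1 ij.2|) (0, i)).
  exact: ch.
Unshelve. all: by end_near. Qed.

(* Both mixed derivatives are the limit of the same second difference quotient. *)
Lemma second_difference_cvg U f x u v : open U -> Ck_on 2 U f -> U x ->
  (fun t : R => t^-1 *: (t^-1 *: (f (x + t *: u + t *: v) - f (x + t *: u)
      - (f (x + t *: v) - f x)))) @ 0^' --> 'D_v ('D_u f) x.
Proof.
move=> oU /Ck_onP[_ df Cf] Ux.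
have [r r0 rU] := open_normP oU Ux.
have C1 := Cf u; have /Ck_onP[_ dduf /(_ v)/Ck_on_continuous cD] := C1.
apply/cvgrPdist_lt => e e0.
have [d d0 dU] := continuous_normP (cD x (mem_set Ux)) e0.
pose m := Num.min r d / (`|u| + `|v| + 1).
have n0 : 0 < `|u| + `|v| + 1 by rewrite ltr_wpDl // addr_ge0.
have m0 : 0 < m by rewrite divr_gt0 // lt_min r0.
near=> t.
have t0 : t != 0 by near: t; exact: nbhs_dnbhs_neq.
have tm : `|t| < m by near: t; exact: dnbhs0_lt.
have small (a b : R) : 0 <= a <= 1 -> 0 <= b <= 1 ->
    `|a *: (t *: u) + b *: (t *: v)| < Num.min r d.
  move=> /andP[a0 a1] /andP[b0 b1].
  rewrite -(@ltr_pM2r _ (`|u| + `|v| + 1)^-1) ?invr_gt0 //.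
  apply: le_lt_trans tm; rewrite ler_pdivrMr // (le_trans (ler_normD _ _)) //.
  rewrite !normrZ (ger0_norm a0) (ger0_norm b0) !mulrDr mulr1 ler_wpDr //.
  by rewrite lerD // ler_piMl // mulr_ge0.
have Us (a b : R) : 0 <= a <= 1 -> 0 <= b <= 1 -> U (x + a *: (t *: u) + b *: (t *: v)).
  by move=> a01 b01; have := small a b a01 b01; rewrite lt_min -addrA => /andP[/rU].
have i01 : 0 <= (1 : R) <= (1 : R) by rewrite ler01 lexx.
have i00 : 0 <= (0 : R) <= (1 : R) by rewrite ler01 lexx.
pose g (y : vec R) := f (y + t *: v) - f y.
have dg (s : R) : 0 <= s <= 1 -> is_derive (x + s *: (t *: u)) (t *: u) g
    (t * ('D_u f (x + s *: (t *: u) + t *: v) - 'D_u f (x + s *: (t *: u)))).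
  move=> s01; rewrite mulrBr; apply: is_deriveB.
    have U1 := Us s 1 s01 i01; rewrite scale1r in U1.
    exact/is_derive_translate/is_deriveZv/df.
  have U0 := Us s 0 s01 i00; rewrite scale0r addr0 in U0.
  exact: is_deriveZv (df u _ U0).
have [|a a01] := @mean_value_line g x (t *: u); first by move=> s /dg[].
have [_ ->] := dg a a01.
have [|b b01] := @mean_value_line ('D_u f) (x + a *: (t *: u)) (t *: v).
  move=> s s01; have [] // := is_deriveZv t (dduf v _ (Us a s a01 s01)).
have [_ ->] := is_deriveZv t (dduf v _ (Us a b a01 b01)) => Eb Ea.
have -> : f (x + t *: u + t *: v) - f (x + t *: u) - (f (x + t *: v) - f x)
   = t * (t * 'D_v ('D_u f) (x + a *: (t *: u) + b *: (t *: v))).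
  by rewrite -Eb -Ea.
rewrite (_ : t^-1 *: (t^-1 *: (t * (t * _))) = 'D_v ('D_u f) (x + a *: (t *: u) + b *: (t *: v))).
  rewrite distrC -addrA; apply: dU.
  by have := small a b a01 b01; rewrite lt_min => /andP[].
by rewrite -[LHS]/(t^-1 * (t^-1 * (t * (t * _)))) !mulKf.
Unshelve. all: by end_near. Qed.

Lemma deriveC U f x u v : open U -> Ck_on 2 U f -> U x ->
  'D_v ('D_u f) x = 'D_u ('D_v f) x.
Proof.
move=> oU Cf Ux; have D := second_difference_cvg (u := u) (v := v) oU Cf Ux.
have D' := second_difference_cvg (u := v) (v := u) oU Cf Ux.
have E (t : R) : t^-1 *: (t^-1 *: (f (x + t *: v + t *: u) - f (x + t *: v)
      - (f (x + t *: u) - f x)))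
    = t^-1 *: (t^-1 *: (f (x + t *: u + t *: v) - f (x + t *: u)
      - (f (x + t *: v) - f x))).
  by do 2 congr (_ *: _); rewrite [x + t *: v + _]addrAC; ring.
by rewrite (funext E) in D'; exact: (cvg_unique _ D D').
Qed.
End MeanValue.

(** * Locality and algebraic stability of smoothness *)

Section SmoothGeneral.
Context {R : realType} {W : normedModType R}.
Implicit Types (f g : vec R -> W) (U D : set (vec R)).

Lemma near_open U (x : vec R) (P : vec R -> Prop) : open U -> U x ->
  (forall y, U y -> P y) -> \forall y \near x, P y.
Proof. by move=> oU Ux UP; apply: filterS (open_nbhs_nbhs (conj oU Ux)). Qed.

Lemma near_continuous f g (x : vec R) : (\forall y \near x, f y = g y) ->
  {for x, continuous f} -> {for x, continuous g}.
Proof.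
move=> fg; rewrite /prop_for /continuous_at -(nbhs_singleton fg).
exact: cvg_trans (near_eq_cvg fg).
Qed.

Lemma Ck_on_local k D f :
  (forall x, D x -> exists U g,
     [/\ open U, U x, Ck_on k U g & forall y, U y -> f y = g y]) -> Ck_on k D f.
Proof.
elim: k D f => [|k IH] D f loc.
  split=> // x /set_mem/loc[U [g [oU Ux [cg _] fg]]].
  apply: near_continuous (cg x (mem_set Ux)).
  by apply: near_open Ux _ => // y /fg.
split=> [x /set_mem/loc[U [g [oU Ux [cg _] fg]]]|v].
  apply: near_continuous (cg x (mem_set Ux)).
  by apply: near_open Ux _ => // y /fg.
split=> [x /loc[U [g [oU Ux [_ /(_ v)[dg _]] fg]]]|].
  apply: near_eq_derivable (dg x Ux).
  by apply: near_open Ux _ => // y /fg.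
apply: IH => x /loc[U [g [oU Ux [_ /(_ v)[dg Cg]] fg]]].
exists U, ('D_v g); split=> // y Uy; apply: near_eq_derive.
exact: near_open Uy _.
Qed.

Lemma Ck_on_sub k U D f : U `<=` D -> Ck_on k D f -> Ck_on k U f.
Proof.
move=> UD; elim: k f => [|k IH] f [cf df].
  by split=> // x /set_mem/UD/mem_set/cf.
split=> [x /set_mem/UD/mem_set/cf //|v]; split=> [x /UD|]; first exact: (df v).1.
exact/IH/(df v).2.
Qed.

Lemma Ck_onW k D f : Ck_on k.+1 D f -> Ck_on k D f.
Proof.
elim: k f => [|k IH] f [cf df]; split=> // v; have [dfv Cf] := df v.
by split=> //; exact: IH.
Qed.

Lemma Ck_on_ext k U f g : open U -> (forall x, U x -> f x = g x) ->
  Ck_on k U f -> Ck_on k U g.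
Proof. by move=> oU fg Cf; apply: Ck_on_local => x Ux; exists U, f; split=> // y /fg. Qed.

Lemma smooth_on_local D f :
  (forall x, D x -> exists U g,
     [/\ open U, U x, smooth_on U g & forall y, U y -> f y = g y]) -> smooth_on D f.
Proof.
move=> loc k; apply: Ck_on_local => x /loc[U [g [oU Ux sg fg]]].
by exists U, g; split=> //; exact: sg.
Qed.

Lemma smooth_on_ext U f g : open U -> (forall x, U x -> f x = g x) ->
  smooth_on U f -> smooth_on U g.
Proof. by move=> oU fg sf k; exact: Ck_on_ext (sf k). Qed.

Lemma smooth_on_derivable D f x v : smooth_on D f -> D x -> derivable f x v.
Proof. by move=> /(_ 1%N)[_ /(_ v)[df _]] /df. Qed.

Lemma smooth_on_continuous D f x : smooth_on D f -> D x -> {for x, continuous f}.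
Proof. by move=> /(_ 0%N)[cf _] /mem_set/cf. Qed.

Lemma smooth_on_derive D f v : smooth_on D f -> smooth_on D ('D_v f).
Proof. by move=> sf k; have [_ /(_ v)[]] := sf k.+1. Qed.

Lemma smooth_on_cst D (c : W) : smooth_on D (fun=> c).
Proof.
move=> k; elim: k c => [|k IH] c; split=> //.
- by move=> x _; exact: cst_continuous.
- by move=> x _; exact: cst_continuous.
move=> v; split=> [x _|]; first exact: derivable_cst.
rewrite (_ : 'D_v (fun=> c) = fun=> 0) //; apply/funext => x; exact: derive_cst.
Qed.

Lemma Ck_onD k U f g : open U -> Ck_on k U f -> Ck_on k U g ->
  Ck_on k U (fun x => f x + g x).
Proof.
move=> oU; elim: k f g => [|k IH] f g [cf df] [cg dg].
  by split=> // x Ux; exact: (continuousD (cf x Ux) (cg x Ux)).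
split=> [x Ux|v]; first by exact: (continuousD (cf x Ux) (cg x Ux)).
have [dfv Cf] := df v; have [dgv Cg] := dg v; split=> [x Ux|].
  by apply: derivableD; [exact: dfv | exact: dgv].
apply: Ck_on_ext (IH _ _ Cf Cg) => // x Ux.
by rewrite [RHS]deriveD //; [exact: dfv | exact: dgv].
Qed.

Lemma smooth_onD U f g : open U -> smooth_on U f -> smooth_on U g ->
  smooth_on U (fun x => f x + g x).
Proof. by move=> oU sf sg k; apply: Ck_onD. Qed.

Lemma smooth_on_sum U (I : Type) (r : seq I) (P : pred I) (F : I -> vec R -> W) :
  open U -> (forall i, P i -> smooth_on U (F i)) ->
  smooth_on U (fun x => \sum_(i <- r | P i) F i x).
Proof.
move=> oU sF; elim: r => [|i r IH].
  under eq_fun do rewrite big_nil; exact: smooth_on_cst.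
under eq_fun do rewrite big_cons; move: (sF i); case: (P i) => // sFi.
by apply: smooth_onD => //; exact: sFi.
Qed.

End SmoothGeneral.

Section SmoothScalar.
Context {R : realType}.
Implicit Types (f g : vec R -> R) (U D : set (vec R)).

Lemma Ck_onM k U f g : open U -> Ck_on k U f -> Ck_on k U g ->
  Ck_on k U (fun x => f x * g x).
Proof.
move=> oU; elim: k f g => [|k IH] f g Cf Cg; have [cf df] := Cf; have [cg dg] := Cg.
  by split=> // x Ux; exact: (continuousM (cf x Ux) (cg x Ux)).
split=> [x Ux|v]; first by exact: (continuousM (cf x Ux) (cg x Ux)).
have [dfv Dfv] := df v; have [dgv Dgv] := dg v; split=> [x Ux|].
  by apply: derivableM; [exact: dfv | exact: dgv].
apply: Ck_on_ext (Ck_onD oU (IH _ _ (Ck_onW Cf) Dgv) (IH _ _ (Ck_onW Cg) Dfv)) => // x Ux.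
by rewrite [RHS]deriveM //; [exact: dfv | exact: dgv].
Qed.

Lemma smooth_onM U f g : open U -> smooth_on U f -> smooth_on U g ->
  smooth_on U (fun x => f x * g x).
Proof. by move=> oU sf sg k; apply: Ck_onM. Qed.

Lemma smooth_onN U f : open U -> smooth_on U f -> smooth_on U (fun x => - f x).
Proof.
move=> oU sf; under eq_fun do rewrite -mulN1r.
by apply: smooth_onM => //; exact: smooth_on_cst.
Qed.

Lemma smooth_onB U f g : open U -> smooth_on U f -> smooth_on U g ->
  smooth_on U (fun x => f x - g x).
Proof. by move=> oU sf sg; apply: smooth_onD => //; exact: smooth_onN. Qed.

Lemma smooth_on_prod U (I : Type) (r : seq I) (P : pred I) (F : I -> vec R -> R) :
  open U -> (forall i, P i -> smooth_on U (F i)) ->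
  smooth_on U (fun x => \prod_(i <- r | P i) F i x).
Proof.
move=> oU sF; elim: r => [|i r IH].
  under eq_fun do rewrite big_nil; exact: smooth_on_cst.
under eq_fun do rewrite big_cons; move: (sF i); case: (P i) => // sFi.
by apply: smooth_onM => //; exact: sFi.
Qed.

Lemma Ck_onV k U f : open U -> (forall x, U x -> f x != 0) -> Ck_on k U f ->
  Ck_on k U (fun x => (f x)^-1).
Proof.
move=> oU f0; elim: k f f0 => [|k IH] f f0 Cf; have [cf df] := Cf.
  by split=> // x Ux; exact: (continuousV (f0 x (set_mem Ux)) (cf x Ux)).
split=> [x Ux|v]; first by exact: (continuousV (f0 x (set_mem Ux)) (cf x Ux)).
have [dfv Dfv] := df v; split=> [x Ux|].
  by apply: derivableV; [exact: f0 | exact: dfv].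
have C0 : Ck_on k U (fun=> -1 : R) by exact: smooth_on_cst.
have CV := IH _ f0 (Ck_onW Cf).
apply: Ck_on_ext (Ck_onM oU C0 (Ck_onM oU (Ck_onM oU CV CV) Dfv)) => // x Ux.
rewrite [RHS]deriveV //; [|exact: f0 | exact: dfv].
by rewrite -invfM -expr2 mulrA mulN1r.
Qed.

Lemma smooth_onV U f : open U -> (forall x, U x -> f x != 0) -> smooth_on U f ->
  smooth_on U (fun x => (f x)^-1).
Proof. by move=> oU f0 sf k; apply: Ck_onV. Qed.

End SmoothScalar.

Section SmoothMatrix.
Context {R : realType} {m n : nat}.
Implicit Types (f g : vec R -> 'M[R]_(m, n)) (U D : set (vec R)).

Lemma Ck_on_mxP k U f : open U ->
  Ck_on k U f <-> forall i j, Ck_on k U (fun x => f x i j).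
Proof.
move=> oU; split.
  elim: k f => [|k IH] f [cf df] i j.
    split=> // x Ux; exact: (continuous_comp (cf x Ux) (@coord_continuous _ _ _ i j (f x))).
  split=> [x Ux|v]; first by exact: (continuous_comp (cf x Ux) (@coord_continuous _ _ _ i j (f x))).
  have [dfv Dfv] := df v; split=> [x Ux|].
    by have /derivable_mxP := dfv x Ux.
  apply: Ck_on_ext (IH _ Dfv i j) => // x Ux.
  by rewrite derive_mx ?mxE //; exact: dfv.
have cont (f' : vec R -> 'M[R]_(m, n)) : (forall i j, {in U, continuous (fun x => f' x i j)}) -> {in U, continuous f'}.
  move=> cf x Ux; suff : f' @ nbhs x --> nbhs (f' x) by [].
  apply/(@cvgrPdist_lt _ _ _ (nbhs x)) => e e0.
  have cc (ij : 'I_m * 'I_n) : \forall y \near x, `|f' x ij.1 ij.2 - f' y ij.1 ij.2| < e.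
    have H : {for x, continuous (fun x => f' x ij.1 ij.2)} := cf ij.1 ij.2 x Ux.
    by move/cvgrPdist_lt: H; exact.
  have {}cc : \forall y \near x, forall ij : 'I_m * 'I_n,
      `|f' x ij.1 ij.2 - f' y ij.1 ij.2| < e.
    exact: (@filter_forall _ _ _ (nbhs x) _ cc).
  near=> y; have cy : forall ij, `|f' x ij.1 ij.2 - f' y ij.1 ij.2| < e by near: y.
  rewrite /Num.Def.normr/= mx_normrE (bigmax_lt _ e0)//= => ij _.
  by rewrite !mxE.
elim: k f => [|k IH] f Cf.
  by split=> //; apply: cont => i j; have [] := Cf i j.
split=> [|v]; first by apply: cont => i j; have [] := Cf i j.
have df x : U x -> derivable f x v.
  by move=> Ux; apply/derivable_mxP => i j; have [_ /(_ v)[dij _]] := Cf i j; exact: dij.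
split=> //; apply: IH => i j; have [_ /(_ v)[_ Dij]] := Cf i j.
apply: Ck_on_ext Dij => // x Ux; by rewrite derive_mx ?mxE //; exact: df.
Unshelve. all: by end_near. Qed.

Lemma smooth_on_mxP U f : open U ->
  smooth_on U f <-> forall i j, smooth_on U (fun x => f x i j).
Proof.
move=> oU; split=> [sf i j k|sf k]; first exact: ((Ck_on_mxP k f oU).1 (sf k) i j).
by apply/(Ck_on_mxP k f oU) => i j; exact: sf.
Qed.

End SmoothMatrix.

Section SmoothMatrixAlgebra.
Context {R : realType}.
Implicit Types (U D : set (vec R)).

Lemma smooth_on_mulmx m n p U (f : vec R -> 'M[R]_(m, n)) (g : vec R -> 'M[R]_(n, p)) :
  open U -> smooth_on U f -> smooth_on U g -> smooth_on U (fun x => f x *m g x).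
Proof.
move=> oU /(smooth_on_mxP f oU) sf /(smooth_on_mxP g oU) sg.
apply/(smooth_on_mxP _ oU) => i j; under eq_fun do rewrite mxE.
by apply: smooth_on_sum => // k _; apply: smooth_onM.
Qed.

Lemma smooth_on_det n U (f : vec R -> 'M[R]_n) :
  open U -> smooth_on U f -> smooth_on U (fun x => \det (f x)).
Proof.
move=> oU /(smooth_on_mxP f oU) sf; apply: smooth_on_sum => // s _.
apply: smooth_onM => //; first exact: smooth_on_cst.
by apply: smooth_on_prod.
Qed.

Lemma smooth_on_invmx n U (f : vec R -> 'M[R]_n) :
  open U -> (forall x, U x -> f x \in unitmx) -> smooth_on U f ->
  smooth_on U (fun x => invmx (f x)).
Proof.
move=> oU fU sf; apply/(smooth_on_mxP _ oU) => i j.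
apply: (@smooth_on_ext _ _ _ (fun x => (\det (f x))^-1 * ((-1) ^+ (j + i) *
   \det (row' j (col' i (f x)))))) => //.
  by move=> x Ux; rewrite /invmx fU // !mxE.
apply: smooth_onM => //; first apply: smooth_onV => //.
- by move=> x /fU; rewrite unitmxE unitfE.
- exact: smooth_on_det.
apply: smooth_onM => //; first exact: smooth_on_cst.
apply: smooth_on_det => //; apply/(smooth_on_mxP _ oU) => a b.
under eq_fun do rewrite !mxE; exact: (smooth_on_mxP f oU).1.
Qed.

End SmoothMatrixAlgebra.

(** * Derivatives of matrix-valued functions *)

Section MatrixCalculus.
Context {R : realType}.
Implicit Types (x u v : vec R) (U : set (vec R)).

Lemma differentiable_mxP m n (f : vec R -> 'M[R]_(m, n)) x :
  differentiable f x <-> forall i j, differentiable (fun y => f y i j) x.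
Proof.
split=> [df i j|df].
  apply: (@differentiable_comp _ _ _ _ f (fun M : 'M[R]_(m, n) => M i j)) => //.
  exact: differentiable_coord.
have -> : f = \sum_(i < m) \sum_(j < n) (fun y => f y i j *: (delta_mx i j : 'M[R]_(m, n))).
  apply/funext => y; rewrite {1}(matrix_sum_delta (f y)) fct_sumE.
  by apply: eq_bigr => i _; rewrite fct_sumE.
apply: differentiable_sum => i; apply: differentiable_sum => j.
exact: differentiableZl.
Qed.

Lemma smooth_on_differentiable m n (f : vec R -> 'M[R]_(m, n)) U x :
  open U -> smooth_on U f -> U x -> differentiable f x.
Proof.
move=> oU /(smooth_on_mxP f oU) sf Ux; apply/differentiable_mxP => i j.
exact: differentiable_C1 oU (sf i j 1%N) Ux.
Qed.

Lemma smooth_on_differentiableR (f : vec R -> R) U x :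
  open U -> smooth_on U f -> U x -> differentiable f x.
Proof. by move=> oU sf Ux; exact: differentiable_C1 oU (sf 1%N) Ux. Qed.

Lemma derive_is_linear (W : normedModType R) (f : vec R -> W) x :
  differentiable f x -> linear (fun v => 'D_v f x).
Proof. by move=> df a u v; rewrite !deriveE // linearP. Qed.

Lemma deriveC_mx m n (f : vec R -> 'M[R]_(m, n)) U x u v :
  open U -> smooth_on U f -> U x -> 'D_v ('D_u f) x = 'D_u ('D_v f) x.
Proof.
move=> oU sf Ux; have sij := (smooth_on_mxP f oU).1 sf.
have E w y i j : U y -> ('D_w f y) i j = 'D_w (fun y => f y i j) y.
  by move=> Uy; rewrite derive_mx ?mxE //; exact: smooth_on_derivable sf Uy.
have D w w' : derivable ('D_w f) x w'.
  exact: smooth_on_derivable (smooth_on_derive w sf) Ux.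
rewrite (derive_mx (D u v)) (derive_mx (D v u)); apply/matrixP => i j; rewrite [LHS]mxE [RHS]mxE.
rewrite (near_eq_derive _ (near_open oU Ux (fun y Uy => E u y i j Uy))).
rewrite (near_eq_derive _ (near_open oU Ux (fun y Uy => E v y i j Uy))).
exact: deriveC oU (sij i j 2%N) Ux.
Qed.

Lemma is_derive_mulmx m n p (f : vec R -> 'M[R]_(m, n)) (g : vec R -> 'M[R]_(n, p))
    x v df dg :
  is_derive x v f df -> is_derive x v g dg ->
  is_derive x v (fun y => f y *m g y) (df *m g x + f x *m dg).
Proof.
move=> [Df <-] [Dg <-].
have /derivable_mxP Dfij := Df; have /derivable_mxP Dgij := Dg.
have E i j : is_derive x v (fun y => (f y *m g y) i j)
    (('D_v f x *m g x + f x *m 'D_v g x) i j).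
  have -> : (fun y => (f y *m g y) i j) = \sum_(k < n) ((fun y => f y i k) * (fun y => g y k j)).
    by apply/funext => y; rewrite mxE fct_sumE.
  have := @is_derive_sum _ _ _ n (fun k => (fun y => f y i k) * (fun y => g y k j)) x v
    (fun k => f x i k *: 'D_v (fun y => g y k j) x + g x k j *: 'D_v (fun y => f y i k) x).
  move/(_ (fun k => is_deriveM (derivableP (Dfij i k)) (derivableP (Dgij k j)))).
  move/is_derive_eq; apply; rewrite !mxE -big_split /=; apply: eq_bigr => k _.
  rewrite !derive_mx // !mxE addrC; congr (_ + _); exact: mulrC.
have D : derivable (fun y => f y *m g y) x v.
  by apply/derivable_mxP => i j; have [] := E i j.
by split=> //; rewrite derive_mx //; apply/matrixP => i j; rewrite mxE; have [_ ->] := E i j.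
Qed.

Lemma is_derive_mulmxl m n p (A : 'M[R]_(m, n)) (g : vec R -> 'M[R]_(n, p)) x v dg :
  is_derive x v g dg -> is_derive x v (fun y => A *m g y) (A *m dg).
Proof.
move=> Dg; have := is_derive_mulmx (is_derive_cst A x v) Dg.
by rewrite mul0mx add0r.
Qed.

Lemma is_derive_mulmxr m n p (A : 'M[R]_(n, p)) (g : vec R -> 'M[R]_(m, n)) x v dg :
  is_derive x v g dg -> is_derive x v (fun y => g y *m A) (dg *m A).
Proof.
move=> Dg; have := is_derive_mulmx Dg (is_derive_cst A x v).
by rewrite mulmx0 addr0.
Qed.

Lemma is_derive_trmx m n (g : vec R -> 'M[R]_(m, n)) x v dg :
  is_derive x v g dg -> is_derive x v (fun y => (g y)^T) dg^T.
Proof.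
move=> [Dg <-]; have /derivable_mxP Dij := Dg.
have E i j : (fun y => (g y)^T i j) = fun y => g y j i by apply/funext => y; rewrite mxE.
have D : derivable (fun y => (g y)^T) x v.
  by apply/derivable_mxP => i j; rewrite E.
by split=> //; rewrite (derive_mx D) (derive_mx Dg); apply/matrixP => i j;
  rewrite [LHS]mxE [RHS]mxE [RHS]mxE E.
Qed.

Lemma is_derive_entry m n (g : vec R -> 'M[R]_(m, n)) x v dg i j :
  is_derive x v g dg -> is_derive x v (fun y => g y i j) (dg i j).
Proof.
move=> [Dg <-]; split; first by have /derivable_mxP := Dg.
by rewrite derive_mx ?mxE.
Qed.

Lemma differentiable_mulmx m n p (f : vec R -> 'M[R]_(m, n)) (g : vec R -> 'M[R]_(n, p)) x :
  differentiable f x -> differentiable g x -> differentiable (fun y => f y *m g y) x.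
Proof.
move=> /differentiable_mxP df /differentiable_mxP dg; apply/differentiable_mxP => i j.
have -> : (fun y => (f y *m g y) i j) = \sum_(k < n) ((fun y => f y i k) * (fun y => g y k j)).
  by apply/funext => y; rewrite mxE fct_sumE.
by apply: differentiable_sum => k; exact: differentiableM.
Qed.

Lemma derive_comp (W : normedModType R) (f : vec R -> vec R) (g : vec R -> W) x v :
  differentiable f x -> differentiable g (f x) ->
  'D_v (g \o f) x = 'D_('D_v f x) g (f x).
Proof.
move=> df dg; rewrite deriveE; last exact: differentiable_comp.
by rewrite diff_comp //= !deriveE.
Qed.

(* Differentiate [invmx f *m f = 1]. *)
Lemma is_derive_invmx n (f : vec R -> 'M[R]_n) x v df :
  (\forall y \near x, f y \in unitmx) -> derivable (fun y => invmx (f y)) x v ->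
  is_derive x v f df ->
  is_derive x v (fun y => invmx (f y)) (- (invmx (f x) *m df *m invmx (f x))).
Proof.
move=> fU Di Df; split=> //.
have := is_derive_mulmx (derivableP Di) Df => -[_ D1].
have D0 : 'D_v (fun y => invmx (f y) *m f y) x = 0.
  rewrite (_ : 0 = 'D_v (fun=> 1%:M : 'M[R]_n) x); last by rewrite [RHS]derive_cst.
  by apply: near_eq_derive; apply: filterS fU => y fy; rewrite mulVmx.
have fx := nbhs_singleton fU.
move: D1; rewrite D0 => /esym/eqP; rewrite addr_eq0 => /eqP E.
by rewrite -[LHS](mulmxK fx) E mulNmx.
Qed.

End MatrixCalculus.

(** * Exterior derivatives in a moving frame *)

Section ExteriorDerivative.
Context {R : realType}.
Implicit Types (x u v : vec R).

Lemma is_derive_bigsum (I : Type) (r : seq I) (h : I -> vec R -> R) dh x v :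
  (forall i, is_derive x v (h i) (dh i)) ->
  is_derive x v (fun y => \sum_(i <- r) h i y) (\sum_(i <- r) dh i).
Proof.
move=> dhi; elim: r => [|i r IH].
  by rewrite big_nil; under eq_fun do rewrite big_nil; exact: is_derive_cst.
rewrite big_cons; under eq_fun do rewrite big_cons.
exact: (is_deriveD (f := h i) (g := fun y => \sum_(j <- r) h j y)).
Qed.

Lemma is_derive_bigprod n (h : 'I_n -> vec R -> R) dh x v :
  (forall i, is_derive x v (h i) (dh i)) ->
  is_derive x v (fun y => \prod_(i < n) h i y)
    (\sum_(j < n) \prod_(i < n) if i == j then dh i else h i x).
Proof.
elim: n h dh => [|n IH] h dh dhi.
  by rewrite big_ord0; under eq_fun do rewrite big_ord0; exact: is_derive_cst.
under eq_fun do rewrite big_ord_recl.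
have D := IH _ _ (fun i => dhi (lift ord0 i)).
have := is_deriveM (dhi ord0) D; move/is_derive_eq; apply.
rewrite big_ord_recl big_ord_recl eqxx addrC; congr (_ + _).
  by rewrite mulrC; congr (_ * _); apply: eq_bigr => i _; rewrite eq_sym (negPf (neq_lift _ _)).
rewrite scaler_sumr; apply: eq_bigr => j _.
by rewrite big_ord_recl (negPf (neq_lift _ _)).
Qed.

Variables (k : nat) (alpha : vec R -> form R k) (e : vec R -> 'M[R]_6) (x : vec R).
Hypothesis eU : \forall y \near x, e y \in unitmx.
Hypothesis de : differentiable e x.
Hypothesis ma : \forall y \near x, is_form (alpha y).
Hypothesis dt : forall f : {ffun 'I_k -> 'I_6},
  differentiable (fun y => alpha y (rowsub f (frame (e y))) : R) x.

Let eUx : e x \in unitmx := nbhs_singleton eU.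

(** Fixed vectors m have frame components m e(y). The product rule applied to the expansion of
    alpha(m) separates the variation of the components of alpha from the motion of the coframe,
    argument by argument. *)
Lemma is_derive_form v (m : 'M[R]_(k, 6)) :
  is_derive x v (fun y => alpha y m : R)
   (\sum_(f : {ffun 'I_k -> 'I_6}) (\prod_i (m *m e x) i (f i))
      * 'D_v (fun y => alpha y (rowsub f (frame (e y))) : R) x
    + \sum_(j < k) alpha x (set_row j (row j m *m 'D_v e x *m frame (e x)) m)).
Proof.
have E y : e y \in unitmx -> is_form (alpha y) -> alpha y m =
    \sum_(f : {ffun 'I_k -> 'I_6}) (\prod_i (m *m e y) i (f i)) * alpha y (rowsub f (frame (e y))).
  move=> ey [my _]; rewrite (multilinear_expand (E := frame (e y)) m _ my) ?unitmx_inv //.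
  by apply: eq_bigr => f _; rewrite invmxK.
have {}E : \near x, \sum_(f : {ffun 'I_k -> 'I_6}) (\prod_i (m *m e x) i (f i))
      * alpha x (rowsub f (frame (e x))) = alpha x m.
  by near=> y; rewrite E //; near: y.
apply: (near_eq_is_derive E).
have De : is_derive x v e ('D_v e x) by exact/derivableP/diff_derivable.
have Dm := is_derive_mulmxl m De.
pose dprod (f : {ffun 'I_k -> 'I_6}) :=
  \sum_(j < k) \prod_i if i == j then (m *m 'D_v e x) i (f i) else (m *m e x) i (f i).
have Dprod (f : {ffun 'I_k -> 'I_6}) :
    is_derive x v (fun y => \prod_i (m *m e y) i (f i)) (dprod f).
  by apply: is_derive_bigprod => i; exact: is_derive_entry.
have D := is_derive_bigsum (index_enum {ffun 'I_k -> 'I_6})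
  (fun f => is_deriveM (Dprod f) (derivableP (diff_derivable (dt f)))).
apply: (is_derive_eq D); rewrite big_split /=; congr (_ + _).
under eq_bigr do rewrite /dprod scaler_sumr.
rewrite exchange_big /=; apply: eq_bigr => j _.
have [mx _] := nbhs_singleton ma.
rewrite (multilinear_expand (E := frame (e x)) _ _ mx) ?unitmx_inv //.
apply: eq_bigr => f _; rewrite -[LHS]/(_ * _) mulrC; congr (_ * _); apply: eq_bigr => i _.
have rowl (A : 'M[R]_(k, 6)) p l : A p l = row p A 0 l by rewrite mxE.
rewrite !rowl !row_mul set_rowE /frame invmxK; case: eqP => [->|] //.
by rewrite -mulmxA mulVmx // mulmx1.
Unshelve. all: by end_near. Qed.

Lemma derive_form_basis v p : size p = k -> all (ltn^~ 6) p ->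
  'D_v (fun y => alpha y (basis k (frame (e x)) p) : R) x =
  'D_v (fun y => alpha y (basis k (frame (e y)) p) : R) x
  + \sum_(j < k) \sum_(l < 6) (frame (e x) *m 'D_v e x) (inord (nth 0%N p j)) l
      * alpha x (basis k (frame (e x)) (set_nth 0%N p j l)).
Proof.
move=> sp p6; have [_ ->] := is_derive_form v (basis k (frame (e x)) p).
congr (_ + _).
  pose g : {ffun 'I_k -> 'I_6} := [ffun i : 'I_k => inord (nth 0%N p i) : 'I_6].
  have Eg (E : 'M[R]_6) : rowsub g E = basis k E p.
    by apply/row_matrixP => i; rewrite row_basis row_rowsub ffunE.
  rewrite (bigD1 g) //= [X in _ + X]big1 => [|f fg].
    have -> : (fun y => alpha y (rowsub g (frame (e y)))) =
        (fun y => alpha y (basis k (frame (e y)) p)) by apply/funext => y; rewrite Eg.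
    rewrite addr0 basis_mulmx mulVmx // big1 ?mul1r // => i _.
    by rewrite mxE mxE ffunE eqxx.
  have /existsP[i fgi] : [exists i, f i != g i].
    rewrite -negb_forall; apply: contra fg => /forallP H.
    by apply/eqP/ffunP => i; apply/eqP.
  rewrite basis_mulmx mulVmx // (bigD1 i) //= mxE mxE.
  by rewrite ffunE eq_sym in fgi; rewrite (negPf fgi) !mul0r.
apply: eq_bigr => j _; have [mx _] := nbhs_singleton ma.
rewrite (multilinear_expand_row (E := frame (e x)) _ _ _ mx) ?unitmx_inv //.
apply: eq_bigr => l _; rewrite /frame invmxK -/(frame (e x)) -[in LHS]mulmxA mulVmx //.
rewrite mulmx1 row_basis -row_mul mxE; congr (_ * alpha x _).
by rewrite -(set_row_basis _ _ (ltn_ord l) sp) inord_val.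
Qed.

(** The numbers b_kij = (E_k e_j)(E_i), the derivative being taken on the chart coefficients of e_j.
    The guard makes this an instance of [trunc3]. *)
Definition coframe_deriv (k i j : nat) : R :=
  if [&& k < 6, i < 6 & j < 6]%N then
    (frame (e x) *m 'D_(row (inord k) (frame (e x))) e x) (inord i) (inord j)
  else 0.

Lemma ext_deriv_basis p : size p = k.+1 -> all (ltn^~ 6) p ->
  ext_deriv alpha x (basis k.+1 (frame (e x)) p) =
  \sum_(i < k.+1) sg i ('D_(row (inord (nth 0%N p i)) (frame (e x)))
     (fun y => alpha y (basis k (frame (e y)) (without i p)) : R) x)
  + ext k coframe_deriv (fun q => alpha x (basis k (frame (e x)) q)) p.
Proof.
move=> sp p6; rewrite /ext_deriv /ext sumtoE -big_split /=; apply: eq_bigr => i _.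
rewrite row_basis row'_basis !sgE -mulrDr; congr (_ * _).
rewrite derive_form_basis; last 2 first.
- by rewrite /without size_cat size_take size_drop sp ltn_ord; have := ltn_ord i; lia.
- by rewrite /without all_cat; apply/andP; split; apply/allP => a H; apply: (allP p6);
    [exact: mem_take H | exact: mem_drop H].
congr (_ + _); rewrite sumtoE; apply: eq_bigr => j _; rewrite -sum6E.
have p6' i' : (nth 0%N p i' < 6)%N.
  have [ip|ip] := ltnP i' (size p); last by rewrite nth_default.
  exact: (elimT (all_nthP 0%N) p6).
by apply: eq_bigr => l _; rewrite /coframe_deriv nth_without !p6' ltn_ord inord_val.
Qed.

Lemma ext_deriv_is_form : is_form (ext_deriv alpha x).
Proof.
apply: (alternating_sum_is_form (Phi := fun u m => 'D_u (fun y => alpha y m : R) x)) => [m c u w|u].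
  have D v := @derive_val _ _ _ _ _ _ _ (is_derive_form v m).
  rewrite !D.
  have le := derive_is_linear de; rewrite mulrDr addrACA; congr (_ + _).
    rewrite mulr_sumr -big_split /=; apply: eq_bigr => f _.
    by rewrite (derive_is_linear (dt f)) mulrDr -[c *: _]/(c * _) mulrCA.
  rewrite mulr_sumr -big_split /=; apply: eq_bigr => j _.
  rewrite le mulmxDr mulmxDl -scalemxAr -scalemxAl.
  exact: (nbhs_singleton ma).1.
split=> [i m c w w'|m i j ij rij].
  have D1 := is_derive_form u (set_row i w m).
  have D2 := is_derive_form u (set_row i w' m).
  have E : \near x, c * alpha x (set_row i w m) + alpha x (set_row i w' m)
      = alpha x (set_row i (c *: w + w') m).
    near=> y; have [my _] : is_form (alpha y) by near: y.
    by rewrite my.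
  rewrite -(near_eq_derive _ E) -[c * 'D_u _ _]/(c *: 'D_u _ _).
  have := is_deriveD (is_deriveZ c D1) D2 => -[_ D].
  have [_ ->] := D1; have [_ ->] := D2; exact: D.
rewrite (near_eq_derive (g := fun=> 0 : R)); first exact: derive_cst.
near=> y; have [_ ay] : is_form (alpha y) by near: y.
exact: ay ij rij.
Unshelve. all: by end_near. Qed.

End ExteriorDerivative.

(** * The SU(3)-structure and its complex structure in an adapted frame *)

Lemma cj_lt6 i : (i < 6)%N -> (cj i < 6)%N.
Proof. by case: i => [|[|[|[|[|[|]]]]]]. Qed.

Lemma ord6P (T : 'I_6 -> Prop) : (forall i, (i < 6)%N -> T (inord i)) -> forall i, T i.
Proof. by move=> H i; rewrite -(inord_val i); exact: H. Qed.

Section PointwiseDictionary.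
Context {R : realType}.
Variables (G J e : 'M[R]_6) (P Q : form R 3).
Hypothesis ad : adapted_at G J P Q e.

Lemma adapted_unit : e \in unitmx.
Proof. by case: ad. Qed.

Lemma adapted_metric : G = e *m e^T.
Proof.
have [_ + _ _ _] := ad; move=> GE; apply/matrixP => i j.
have := GE (delta_mx 0 i) (delta_mx 0 j).
rewrite /bilin -rowE trmx_delta -colE [X in X = _ -> _]mxE [X in X = _ -> _]mxE => ->.
rewrite mxE; apply: eq_bigr => k _; rewrite -!rowE.
by rewrite [X in X * _]mxE [X in _ * X]mxE [X in _ = _ * X]mxE.
Qed.

Lemma bilin_frame v w : bilin G v w = \sum_(i < 6) (v *m e) 0 i * (w *m e) 0 i.
Proof. by case: ad. Qed.

Lemma fundamental_is_form : is_form (fundamental G J).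
Proof.
have [_ _ FE _ _] := ad; rewrite (funext FE).
do ![apply: is_formD | apply: is_formN]; exact: monomial_is_form.
Qed.

Lemma fundamental_basis p : size p = 2 -> all (ltn^~ 6) p ->
  fundamental G J (basis 2 (frame e) p) = tF R p.
Proof.
by move=> sp p6; have [eU _ FE _ _] := ad; rewrite FE !monomial_basis.
Qed.

Lemma Psip_is_form : is_form P.
Proof.
have [_ _ _ PE _] := ad; rewrite (funext PE).
do ![apply: is_formD | apply: is_formN]; exact: monomial_is_form.
Qed.

Lemma Psip_basis p : size p = 3 -> all (ltn^~ 6) p -> P (basis 3 (frame e) p) = tP R p.
Proof.
by move=> sp p6; have [eU _ _ PE _] := ad; rewrite PE !monomial_basis.
Qed.

Lemma Psim_is_form : is_form Q.
Proof.
have [_ _ _ _ QE] := ad; rewrite (funext QE).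
do ![apply: is_formD | apply: is_formN]; exact: monomial_is_form.
Qed.

Lemma Psim_basis p : size p = 3 -> all (ltn^~ 6) p -> Q (basis 3 (frame e) p) = tQ R p.
Proof.
by move=> sp p6; have [eU _ _ _ QE] := ad; rewrite QE !monomial_basis.
Qed.

Lemma bilin_basis v k : bilin G v (row k (frame e)) = (v *m e) 0 k.
Proof.
have Ek i : (row k (frame e) *m e) 0 i = (k == i)%:R.
  by rewrite -row_mul mulVmx ?adapted_unit // mxE mxE.
rewrite bilin_frame (bigD1 k) //= Ek eqxx mulr1 big1 ?addr0 // => i ik.
by rewrite Ek eq_sym (negPf ik) mulr0.
Qed.

Lemma bilinC v w : bilin G v w = bilin G w v.
Proof. by rewrite !bilin_frame; apply: eq_bigr => i _; rewrite mulrC. Qed.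

Lemma lower_basis (B : vec R -> vec R -> vec R) i j k :
  lower G B (basis 3 (frame e) [:: i; j; k]) =
  (B (row (inord i) (frame e)) (row (inord j) (frame e)) *m e) 0 (inord k).
Proof. by rewrite /lower !row_basis !inordK //= bilin_basis. Qed.

End PointwiseDictionary.

Section ComplexStructure.
Context {R : realType}.

(* J in an adapted frame *)
Definition acs0 : 'M[R]_6 := \matrix_(i, j) sg i (cj i == j)%:R.

(** As F = g(., J .) and the frame is orthonormal, the components of F are the matrix entries of
    J. *)
Lemma adapted_acs0 (G J e : 'M[R]_6) (P Q : form R 3) : adapted_at G J P Q e ->
  frame e *m J *m e = acs0.
Proof.
move=> ad; apply/matrixP; apply: ord6P => i i6; apply: ord6P => a a6.
have : fundamental G J (basis 2 (frame e) [:: a; i]) = tF R [:: a; i].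
  by rewrite (fundamental_basis ad) //= a6 i6.
rewrite /fundamental !row_basis !inordK //= (bilinC ad) (bilin_basis ad) -!row_mul.
rewrite mxE => ->; rewrite mxE !inordK //.
move: i6 a6; do 6 (case: i => [_|i]; [by do 6 (case: a => [_|a]; [by tab; rewrite /=; ring|])|]); by [].
Qed.

Lemma adapted_acs (G J e : 'M[R]_6) (P Q : form R 3) : adapted_at G J P Q e ->
  J *m e = e *m acs0.
Proof.
move=> ad; rewrite -(adapted_acs0 ad) /frame !mulmxA mulmxV ?mul1mx //.
exact: adapted_unit ad.
Qed.

Lemma acs0_mul n (M : 'M[R]_(6, n)) i j : (i < 6)%N ->
  (acs0 *m M) (inord i) j = sg i (M (inord (cj i)) j).
Proof.
move=> i6; rewrite mxE (bigD1 (inord (cj i))) //= big1 => [|k ki].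
  rewrite mxE !inordK ?cj_lt6 // eqxx addr0 /sg.
  by case: Nat.odd; rewrite ?mulN1r ?mul1r.
rewrite mxE !inordK //; case: eqP => [e|_].
  by case/eqP: ki; rewrite e inord_val.
by rewrite /sg; case: Nat.odd; rewrite ?oppr0 mul0r.
Qed.

Lemma mul_acs0 n (M : 'M[R]_(n, 6)) i j : (j < 6)%N ->
  (M *m acs0) i (inord j) = - sg j (M i (inord (cj j))).
Proof.
have cjK k : (k < 6)%N -> cj (cj k) = k by case: k => [|[|[|[|[|[|]]]]]].
have sgcj k (x : R) : (k < 6)%N -> sg (cj k) x = - sg k x.
  by case: k => [|[|[|[|[|[|]]]]]] // _; rewrite /sg /= ?opprK.
move=> j6; rewrite mxE (bigD1 (inord (cj j))) //= big1 => [|k kj].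
  rewrite mxE !inordK ?cj_lt6 // cjK // eqxx addr0 sgcj // /sg.
  by case: Nat.odd; rewrite ?opprK ?mulrN ?mulr1 ?opprK.
rewrite mxE !inordK //; case: eqP => [e|_].
  by case/eqP: kj; rewrite -e cjK // inord_val.
by rewrite /sg; case: Nat.odd; rewrite ?oppr0 mulr0.
Qed.

Lemma row_acs (G J e : 'M[R]_6) (P Q : form R 3) i : adapted_at G J P Q e -> (i < 6)%N ->
  row (inord i) (frame e) *m J = sg i 1 *: row (inord (cj i)) (frame e).
Proof.
move=> ad i6; have eU := adapted_unit ad.
apply: (can_inj (mulmxK eU)).
have E k : row k (frame e) *m e = delta_mx 0 k by rewrite -row_mul mulVmx // row1.
rewrite -mulmxA (adapted_acs ad) mulmxA -scalemxAl !E -rowE.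
apply/rowP; apply: ord6P => j j6; rewrite !mxE !inordK // eqxx /= -val_eqE /= !inordK ?cj_lt6 //.
by rewrite eq_sym /sg; case: Nat.odd; rewrite ?mulN1r ?mul1r.
Qed.

End ComplexStructure.

Section NearDifferentiable.
Context {R : realType}.

(** Functions with the same germ have the same first-order expansion, so the differential of f also
    serves for g. *)
Lemma near_eq_differentiable (f g : vec R -> R) x :
  (\near x, f x = g x) -> differentiable f x -> differentiable g x.
Proof.
move=> fg df; have [cl E1] := (diff_locallyP x f).1 df.
have E := @diff_unique R (vec R) R g ('d f x) x cl.
have E2 := @diff_locallyP R (vec R) R x g.
move: E; set q := (X in (X -> _) -> _) => E.
suff Hq : q by apply/E2; rewrite (E Hq); split.
clear E E2; rewrite {}/q.
apply/eqaddoP => eps eps0; have /eqaddoP/(_ eps eps0) := E1.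
have fgx := nbhs_singleton fg.
have : \forall h \near (0 : vec R), f (h + x) = g (h + x).
  by rewrite (near_shift x) /=; apply: filterS fg => y; rewrite sub0r /= addrNK.
apply: filterS2 => h fgh.
have -> : (f \o shift x - (cst (f x) + ('d f x : vec R -> R))) h
    = f (h + x) - (f x + 'd f x h) by [].
have -> : (g \o shift x - (cst (g x) + ('d f x : vec R -> R))) h
    = g (h + x) - (g x + 'd f x h) by [].
by rewrite fgh fgx.
Qed.

End NearDifferentiable.

(** * Forms with constant components in the frame *)

Section FirstOrder.
Context {R : realType}.
Variables (e : vec R -> 'M[R]_6) (x : vec R).
Hypothesis de : differentiable e x.
Hypothesis eU : \forall y \near x, e y \in unitmx.

Let b := coframe_deriv e x.

Lemma all_set_nth p j l : all (ltn^~ 6) p -> (j < size p)%N -> (l < 6)%N ->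
  all (ltn^~ 6) (set_nth 0%N p j l).
Proof.
move=> p6 jp l6; apply/(all_nthP 0%N) => i _; rewrite nth_set_nth /=; case: eqP => // _.
have [ip|ip] := ltnP i (size p); last by rewrite nth_default.
exact: (elimT (all_nthP 0%N) p6).
Qed.

Lemma all_without p i : all (ltn^~ 6) p -> all (ltn^~ 6) (without i p).
Proof.
move=> p6; rewrite /without all_cat; apply/andP; split; apply/allP => a H; apply: (allP p6).
  exact: mem_take H.
exact: mem_drop H.
Qed.

Lemma size_without k p i : size p = k.+1 -> (i < k.+1)%N -> size (without i p) = k.
Proof. by move=> sp ik; rewrite /without size_cat size_take size_drop sp ik; lia. Qed.

Lemma eq_ext k (b' : nat -> nat -> nat -> R) (t1 t2 : seq nat -> R) p :
  (forall q, size q = k -> all (ltn^~ 6) q -> t1 q = t2 q) ->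
  size p = k.+1 -> all (ltn^~ 6) p -> ext k b' t1 p = ext k b' t2 p.
Proof.
move=> t12 sp p6; apply: eq_sumto => i ik; congr (sg i _); apply: eq_sumto => j jk.
have E l : (l < 6)%N -> t1 (set_nth 0%N (without i p) j l) = t2 (set_nth 0%N (without i p) j l).
  move=> l6; apply: t12.
    by rewrite size_set_nth (size_without sp ik); apply/maxn_idPr.
  by apply: all_set_nth => //; [exact: all_without | rewrite (size_without sp ik)].
by rewrite /sum6 !E.
Qed.

Lemma ext_deriv_const k (alpha : vec R -> form R k) (t : seq nat -> R) :
  (\forall y \near x, is_form (alpha y)) ->
  (\forall y \near x, forall p, size p = k -> all (ltn^~ 6) p ->
     alpha y (basis k (frame (e y)) p) = t p) ->
  is_form (ext_deriv alpha x) /\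
  forall p, size p = k.+1 -> all (ltn^~ 6) p ->
    ext_deriv alpha x (basis k.+1 (frame (e x)) p) = ext k b t p.
Proof.
move=> fa at_; have atx := nbhs_singleton at_.
have dt (f : {ffun 'I_k -> 'I_6}) :
    differentiable (fun y => alpha y (rowsub f (frame (e y))) : R) x.
  apply: (near_eq_differentiable (f := fun=> t (codes f))); last exact: differentiable_cst.
  near=> y; rewrite -basis_codes; have ty : forall p, size p = k -> all (ltn^~ 6) p ->
     alpha y (basis k (frame (e y)) p) = t p by near: y.
  by rewrite ty ?size_codes ?codes_lt6.
split=> [|p sp p6]; first exact: (ext_deriv_is_form eU de fa dt).
rewrite (ext_deriv_basis eU de fa dt) // big1 ?add0r => [|i _].
  exact: eq_ext.
rewrite (near_eq_derive (g := fun=> t (without i p))).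
  by rewrite derive_cst /sg; case: Nat.odd; rewrite ?oppr0.
near=> y; have ty : forall p, size p = k -> all (ltn^~ 6) p ->
     alpha y (basis k (frame (e y)) p) = t p by near: y.
by apply: ty; [exact: size_without | exact: all_without].
Unshelve. all: by end_near. Qed.

End FirstOrder.

(** * Components of the Nijenhuis tensor and of the Lee form *)

Section Dictionary.
Context {R : realType}.
Variables (G J e : vec R -> 'M[R]_6) (P Q : vec R -> form R 3) (x : vec R).
Hypothesis de : differentiable e x.
Hypothesis dJ : differentiable J x.
Hypothesis ad : \forall y \near x, adapted_at (G y) (J y) (P y) (Q y) (e y).

Let b := coframe_deriv e x.
Let E i := row (inord i) (frame (e x)).
Let adx := nbhs_singleton ad.

Lemma near_unit : \forall y \near x, e y \in unitmx.
Proof. by apply: filterS ad => y /adapted_unit. Qed.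

Lemma frame_coframe_deriv k i j : (k < 6)%N -> (i < 6)%N -> (j < 6)%N ->
  (frame (e x) *m 'D_(E k) e x) (inord i) (inord j) = b k i j.
Proof. by move=> k6 i6 j6; rewrite /b /coframe_deriv k6 i6 j6. Qed.

Lemma derive_acs v : 'D_v J x *m e x = 'D_v e x *m acs0 - J x *m 'D_v e x.
Proof.
have De : is_derive x v e ('D_v e x) by exact/derivableP/diff_derivable.
have DJ : is_derive x v J ('D_v J x) by exact/derivableP/diff_derivable.
have [_ E1] := is_derive_mulmx DJ De; have [_ E2] := is_derive_mulmxr acs0 De.
apply/eqP; rewrite eq_sym subr_eq -E1 -E2; apply/eqP; apply: near_eq_derive.
by apply: filterS ad => y /adapted_acs.
Qed.

Lemma frame_derive_acs k i j : (k < 6)%N -> (i < 6)%N -> (j < 6)%N ->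
  (frame (e x) *m 'D_(E k) J x *m e x) (inord i) (inord j) = dacs b k i j.
Proof.
move=> k6 i6 j6; rewrite -mulmxA derive_acs mulmxBr.
have eUx := adapted_unit adx.
have -> : frame (e x) *m (J x *m 'D_(E k) e x) = acs0 *m (frame (e x) *m 'D_(E k) e x).
  rewrite -(adapted_acs0 adx) !mulmxA; congr (_ *m _).
  by rewrite -[in RHS]mulmxA mulmxV ?mulmx1.
rewrite [LHS]mxE [X in _ + X]mxE [frame (e x) *m (_ *m acs0)]mulmxA mul_acs0 // acs0_mul // /dacs.
by rewrite !frame_coframe_deriv ?cj_lt6.
Qed.

Lemma nijenhuisE u v : nijenhuis J x u v =
  v *m 'D_(u *m J x) J x - u *m 'D_(v *m J x) J x
  + u *m 'D_v J x *m J x - v *m 'D_u J x *m J x.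
Proof.
have DJ u' v' : 'D_u' (fun y => v' *m J y) x = v' *m 'D_u' J x.
  by apply: derive_val; apply: is_derive_mulmxl; exact/derivableP/diff_derivable.
have Dc (w u' : vec R) : 'D_u' (fun=> w) x = 0 by exact: derive_cst.
have l1 : lie_bracket (fun y => u *m J y) (fun y => v *m J y) x =
    v *m 'D_(u *m J x) J x - u *m 'D_(v *m J x) J x.
  by congr (_ - _); exact: DJ.
have l2 : lie_bracket (cst u) (cst v) x = 0.
  by rewrite -[RHS](subrr 0); congr (_ - _); exact: Dc.
have l3 : lie_bracket (fun y => u *m J y) (cst v) x = - (u *m 'D_v J x).
  by rewrite -[RHS]add0r; congr (_ - _); [exact: Dc | exact: DJ].
have l4 : lie_bracket (cst u) (fun y => v *m J y) x = v *m 'D_u J x.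
  by rewrite -[RHS]subr0; congr (_ - _); [exact: DJ | exact: Dc].
by rewrite /nijenhuis l1 l2 l3 l4 subr0 mulNmx opprK.
Qed.

Lemma nij_basis i j k : (i < 6)%N -> (j < 6)%N -> (k < 6)%N ->
  lower (G x) (nijenhuis J x) (basis 3 (frame (e x)) [:: i; j; k]) = nijc b i j k.
Proof.
move=> i6 j6 k6; rewrite (lower_basis adx) -/(E i) -/(E j) nijenhuisE.
pose D v := 'D_v J x; rewrite -![derive J x _]/(D _).
have scD c u : D (c *: u) = c *: D u.
  have D0 : D 0 = 0 by exact: derive0.
  by have := derive_is_linear dJ c u 0; rewrite addr0 -![derive J x _]/(D _) D0 addr0.
have dacsE k' i' j' : (k' < 6)%N -> (i' < 6)%N -> (j' < 6)%N ->
    (frame (e x) *m D (E k') *m e x) (inord i') (inord j') = dacs b k' i' j'.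
  exact: frame_derive_acs.
rewrite (row_acs adx i6) (row_acs adx j6) !scD.
clearbody D.
have rowE u A : row u (frame (e x)) *m A *m e x = row u (frame (e x) *m A *m e x).
  by rewrite !row_mul.
rewrite mulmxBl mulmxDl mulmxBl -!scalemxAr -!scalemxAl.
rewrite -![_ *m J x *m e x]mulmxA (adapted_acs adx) !mulmxA !rowE.
have addE (A A' : vec R) l : (A + A') 0 l = A 0 l + A' 0 l by rewrite mxE.
have oppE (A : vec R) l : (- A) 0 l = - A 0 l by rewrite mxE.
have sclE c (A : vec R) l : (c *: A) 0 l = c * A 0 l by rewrite mxE.
have entE (A : 'M[R]_6) u l : row u A 0 l = A u l by rewrite mxE.
rewrite !addE !oppE !sclE !mul_acs0 // !entE !dacsE ?cj_lt6 // /nijc.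
by rewrite /sg; do 3 case: Nat.odd; ring.
Qed.

Lemma star_fund_basis y p : adapted_at (G y) (J y) (P y) (Q y) (e y) ->
  size p = 4 -> all (ltn^~ 6) p ->
  hodge (p := 2) (q := 4) erefl (e y) (fundamental (G y) (J y)) (basis 4 (frame (e y)) p)
  = hod (tF R) p.
Proof.
move=> ady sp p6; rewrite hodge_basis //; [|exact: adapted_unit ady | exact: fundamental_is_form ady].
rewrite /hod; case: (eqVneq (eps R (compl six p ++ p) six) 0) => [->|/eps_perm_eq pe].
  by rewrite !mulr0.
rewrite (fundamental_basis ady) //.
  by have := perm_size pe; rewrite size_cat sp /=; lia.
by have := all_six pe; rewrite all_cat => /andP[].
Qed.

Lemma hod_compl (q p : nat) (s : seq nat) (t1 t2 : seq nat -> R) :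
  size s = q -> (p + q = 6)%N ->
  (forall c, size c = p -> all (ltn^~ 6) c -> t1 c = t2 c) -> hod t1 s = hod t2 s.
Proof.
move=> ss pq t12; rewrite /hod.
case: (eqVneq (eps R (compl six s ++ s) six) 0) => [->|/eps_perm_eq pe].
  by rewrite !mulr0.
rewrite t12 //.
  by apply/eqP; rewrite -(eqn_add2r q) pq -{1}ss -size_cat (perm_size pe).
by have := all_six pe; rewrite all_cat => /andP[].
Qed.

Lemma codiff_fund_is_form :
  is_form (codiff (p := 1) (q := 4) erefl erefl e (fun y => fundamental (G y) (J y)) x).
Proof. by apply: is_formN; exact: hodge_is_form. Qed.

Lemma lee_is_form :
  is_form (fun v : 'M[R]_(1, 6) =>
    codiff (p := 1) (q := 4) erefl erefl e (fun y => fundamental (G y) (J y)) x (v *m J x)).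
Proof.
have [m a] := codiff_fund_is_form; split=> [i v c u w|v i j]; last by rewrite !ord1 eqxx.
have EJ u' : set_row i u' v *m J x = set_row i (u' *m J x) (v *m J x).
  by apply/row_matrixP => l; rewrite row_mul !set_rowE !ord1 eqxx.
by rewrite !EJ mulmxDl -scalemxAl m.
Qed.

Lemma lee_basis i : (i < 6)%N ->
  codiff (p := 1) (q := 4) erefl erefl e (fun y => fundamental (G y) (J y)) x (E i *m J x)
  = leec b i.
Proof.
move=> i6; rewrite (row_acs adx) //.
have [m _] := codiff_fund_is_form.
have sE c u : codiff (p := 1) (q := 4) erefl erefl e (fun y => fundamental (G y) (J y)) x (c *: u)
   = c * codiff (p := 1) (q := 4) erefl erefl e (fun y => fundamental (G y) (J y)) x u.
  have E0 w : set_row ord0 w 0 = w :> 'M[R]_(1, 6).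
    by apply/row_matrixP => l; rewrite set_rowE ord1 eqxx row_id.
  have f0 := m ord0 0 (-1) 0 0; rewrite scaler0 addr0 E0 mulN1r addNr in f0.
  by have := m ord0 0 c u 0; rewrite !E0 addr0 f0 addr0.
rewrite sE /codiff.
have -> : row (inord (cj i)) (frame (e x)) = basis 1 (frame (e x)) [:: cj i].
  by apply/row_matrixP => l; rewrite row_basis !ord1 row_id.
have [fd dE] := ext_deriv_const (k := 4) de near_unit
  (alpha := fun y => hodge (p := 2) (q := 4) erefl (e y) (fundamental (G y) (J y)))
  (t := hod (tF R))
  (filterS (fun y _ => hodge_is_form _ _ _) ad)
  (filterS (fun y ady p => star_fund_basis ady) ad).
rewrite hodge_basis //=; [|exact: adapted_unit adx| by rewrite cj_lt6].
rewrite (hod_compl (q := 1) (p := 5) (t2 := ext 4 b (hod (tF R)))) //.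
by rewrite /leec /sg; case: Nat.odd; rewrite ?mulN1r ?mul1r ?mulrN ?opprK.
Qed.

End Dictionary.

(** * The 3-form of a vector-valued bilinear map *)

Section LowerForms.
Context {R : realType}.

Lemma bilin_linear_l (G : 'M[R]_6) v : scalar (bilin G ^~ v).
Proof. by move=> c u w; rewrite /bilin !mulmxDl -!scalemxAl !mxE. Qed.

Lemma bilin_linear_r (G : 'M[R]_6) v : scalar (bilin G v).
Proof. by move=> c u w; rewrite /bilin linearP mulmxDr -scalemxAr !mxE. Qed.

Lemma lower_multilinear (G : 'M[R]_6) (B : vec R -> vec R -> vec R) :
  (forall v, linear (B ^~ v)) -> (forall u, linear (B u)) -> multilinear_form (lower G B).
Proof.
move=> Bl Br i m c u w; rewrite /lower !set_rowE.
case: (eqVneq (inord 0) i) => [<-|n0].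
  rewrite -!val_eqE /= !inordK //= Bl; exact: bilin_linear_l.
case: (eqVneq (inord 1) i) => [<-|n1].
  rewrite -!val_eqE /= !inordK //= Br; exact: bilin_linear_l.
case: (eqVneq (inord 2) i) => [_|n2]; first exact: bilin_linear_r.
case/eqP: (n2); apply: val_inj; rewrite /= inordK //.
move: n0 n1; rewrite -!val_eqE /= !inordK //.
by case: i {n2} => [[|[|[|]]]].
Qed.

Lemma codes3 (f : 'I_3 -> 'I_6) :
  codes f = [:: val (f (inord 0)); val (f (inord 1)); val (f (inord 2))].
Proof.
rewrite /codes (_ : enum 'I_3 = [:: inord 0; inord 1; inord 2]) //.
by apply: (inj_map val_inj); rewrite val_enum_ord /= !inordK.
Qed.

Lemma xrow_basis (E : 'M[R]_6) (a b : 'I_3) p :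
  xrow a b (basis 3 E p) = rowsub (fun l => inord (nth 0%N p (tperm a b l))) E.
Proof. by apply/matrixP => l q; rewrite !mxE. Qed.

Lemma xrow12_basis (E : 'M[R]_6) i j k :
  xrow (inord 1) (inord 2) (basis 3 E [:: i; j; k]) = basis 3 E [:: i; k; j].
Proof.
rewrite xrow_basis; apply/row_matrixP => l; rewrite row_rowsub row_basis; congr (row (inord _) E).
case: tpermP => [->|->|]; rewrite ?inordK //=.
by case: l => [[|[|[|//]]] l3] //= n1 n2; [case: n1|case: n2]; apply: val_inj; rewrite /= inordK.
Qed.

Lemma xrow01_basis (E : 'M[R]_6) i j k :
  xrow (inord 0) (inord 1) (basis 3 E [:: i; j; k]) = basis 3 E [:: j; i; k].
Proof.
rewrite xrow_basis; apply/row_matrixP => l; rewrite row_rowsub row_basis; congr (row (inord _) E).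
case: tpermP => [->|->|]; rewrite ?inordK //=.
by case: l => [[|[|[|//]]] l3] //= n1 n2; [case: n1|case: n2]; apply: val_inj; rewrite /= inordK.
Qed.

Lemma form3_swap12 (a : form R 3) (E : 'M[R]_6) i j k : is_form a ->
  a (basis 3 E [:: i; k; j]) = - a (basis 3 E [:: i; j; k]).
Proof.
move=> [ma aa]; rewrite -xrow12_basis (form_swap_rows _ ma) // => [v|].
  by apply: aa; rewrite -val_eqE /= !inordK.
by rewrite -val_eqE /= !inordK.
Qed.

Lemma form3_swap01 (a : form R 3) (E : 'M[R]_6) i j k : is_form a ->
  a (basis 3 E [:: j; i; k]) = - a (basis 3 E [:: i; j; k]).
Proof.
move=> [ma aa]; rewrite -xrow01_basis (form_swap_rows _ ma) // => [v|].
  by apply: aa; rewrite -val_eqE /= !inordK.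
by rewrite -val_eqE /= !inordK.
Qed.

End LowerForms.

(** * The structure equations and the torsion formula at a point *)

Section PointwiseTheorem.
Context {R : realType}.
Variables (G J e : vec R -> 'M[R]_6) (P Q : vec R -> form R 3) (x : vec R).
Hypothesis de : differentiable e x.
Hypothesis dJ : differentiable J x.
Hypothesis ad : \forall y \near x, adapted_at (G y) (J y) (P y) (Q y) (e y).

Let b := coframe_deriv e x.
Let adx := nbhs_singleton ad.
Let eUx : frame (e x) \in unitmx.
Proof. by rewrite unitmx_inv; exact: adapted_unit adx. Qed.

Let F y := fundamental (G y) (J y).
Let nijf : form R 3 := lower (G x) (nijenhuis J x).
Let leef : form R 1 := fun v => codiff (p := 1) (q := 4) erefl erefl e F x (v *m J x).

Lemma ext_deriv_fund : is_form (ext_deriv F x) /\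
  forall p, size p = 3 -> all (ltn^~ 6) p ->
    ext_deriv F x (basis 3 (frame (e x)) p) = ext 2 b (tF R) p.
Proof.
apply: (ext_deriv_const de (near_unit ad)).
  by apply: filterS ad => y /fundamental_is_form.
by apply: filterS ad => y ady p; exact: (fundamental_basis ady).
Qed.

Lemma ext_deriv_Psip : is_form (ext_deriv P x) /\
  forall p, size p = 4 -> all (ltn^~ 6) p ->
    ext_deriv P x (basis 4 (frame (e x)) p) = ext 3 b (tP R) p.
Proof.
apply: (ext_deriv_const de (near_unit ad)).
  by apply: filterS ad => y /Psip_is_form.
by apply: filterS ad => y ady p; exact: (Psip_basis ady).
Qed.

Lemma ext_deriv_Psim : is_form (ext_deriv Q x) /\
  forall p, size p = 4 -> all (ltn^~ 6) p ->
    ext_deriv Q x (basis 4 (frame (e x)) p) = ext 3 b (tQ R) p.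
Proof.
apply: (ext_deriv_const de (near_unit ad)).
  by apply: filterS ad => y /Psim_is_form.
by apply: filterS ad => y ady p; exact: (Psim_basis ady).
Qed.

Lemma wedge_lee k (a : form R k) (t : seq nat -> R) p : is_form a ->
  (forall q, size q = k -> all (ltn^~ 6) q -> a (basis k (frame (e x)) q) = t q) ->
  size p = k.+1 -> all (ltn^~ 6) p ->
  wedge leef a (basis k.+1 (frame (e x)) p) = wedge1 k (leec b) t p.
Proof.
move=> fa at_ sp p6; rewrite wedge1_basis //; apply: eq_sumto => i ik; congr (sg i (_ * _)).
  by rewrite /leef (lee_basis de ad) //; apply: (elimT (all_nthP 0%N) p6); rewrite sp.
by apply: at_; [exact: size_without | exact: all_without].
Qed.

Lemma dotP_nij : inner (e x) nijf (P x) = dotP (nijc b).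
Proof.
rewrite (inner_dotP _ (P := P x)) => [|i j k i6 j6 k6]; last first.
  by rewrite (Psip_basis adx) //= i6 j6 k6.
by rewrite /dotP /nijf !(nij_basis de dJ ad).
Qed.

Lemma dotQ_nij : inner (e x) nijf (Q x) = dotQ (nijc b).
Proof.
rewrite (inner_dotQ _ (Q := Q x)) => [|i j k i6 j6 k6]; last first.
  by rewrite (Psim_basis adx) //= i6 j6 k6.
by rewrite /dotQ /nijf !(nij_basis de dJ ad).
Qed.

Lemma lower_nij_multilinear : multilinear_form nijf.
Proof.
have comb4 (c : R) (a1 a2 a3 a4 b1 b2 b3 b4 : vec R) :
    (c *: a1 + b1) - (c *: a2 + b2) + (c *: a3 + b3) - (c *: a4 + b4)
    = c *: (a1 - a2 + a3 - a4) + (b1 - b2 + b3 - b4).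
  by rewrite !opprD !scalerDr !scalerN [c *: a1 + b1 + _]addrACA
    [c *: a1 - c *: a2 + _ + _]addrACA [LHS]addrACA.
have [D linD DE] : exists2 D : vec R -> 'M[R]_6, linear D & forall v, 'D_v J x = D v.
  by exists (fun v => 'D_v J x) => //; exact: derive_is_linear.
apply: lower_multilinear => [v c u w|u c v w]; rewrite !(nijenhuisE dJ) !DE -comb4; f_equal.
all: by rewrite ?mulmxDl -?scalemxAl ?linD ?mulmxDr -?scalemxAr ?mulmxDl -?scalemxAl.
Qed.

Lemma struct_rhs_is_form (c : R) (a : form R 3) : is_form a ->
  is_form (fun m : 'M[R]_(4, 6) => wedge leef a m - c * hodge (p := 2) (q := 4) erefl (e x) (F x) m).
Proof.
move=> fa; apply: is_formD.
  exact: (wedge1_is_form (lee_is_form G J e x)).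
by apply: is_formN; apply: is_formZ; exact: hodge_is_form.
Qed.

(** Both sides are 4-forms, so the tensor equation amounts to its components at increasing
    multi-indices. *)
Lemma struct_eqE (a : vec R -> form R 3) (t : seq nat -> R) (c : R) :
  is_form (a x) ->
  (forall p, size p = 3 -> all (ltn^~ 6) p -> a x (basis 3 (frame (e x)) p) = t p) ->
  is_form (ext_deriv a x) /\
  (forall p, size p = 4 -> all (ltn^~ 6) p ->
    ext_deriv a x (basis 4 (frame (e x)) p) = ext 3 b t p) ->
  (forall m, ext_deriv a x m =
     wedge leef (a x) m - c * hodge (p := 2) (q := 4) erefl (e x) (F x) m) <->
  (forall i j k l, (i < j)%N -> (j < k)%N -> (k < l)%N -> (l < 6)%N ->
     ext 3 b t [:: i; j; k; l] =
     wedge1 3 (leec b) t [:: i; j; k; l] - c * hod (tF R) [:: i; j; k; l]).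
Proof.
move=> fa at_ [fda da]; have fr := struct_rhs_is_form c fa.
have E p : size p = 4 -> all (ltn^~ 6) p ->
    wedge leef (a x) (basis 4 (frame (e x)) p)
      - c * hodge (p := 2) (q := 4) erefl (e x) (F x) (basis 4 (frame (e x)) p)
    = wedge1 3 (leec b) t p - c * hod (tF R) p.
  move=> sp p6; rewrite (wedge_lee fa at_) //; congr (_ - c * _).
  exact: (star_fund_basis adx).
split=> [H i j k l ij jk kl l6|H m].
  have p6 : all (ltn^~ 6) [:: i; j; k; l] by rewrite /= l6 andbT; apply/and3P; split; lia.
  by rewrite -da // H E.
move: m; apply: (form_ext eUx fda fr) => p sp srt p6; rewrite da // E //.
move: p sp srt p6 => [|i [|j [|k [|l [|]]]]] //= _ /and4P[ij jk kl _] /and5P[_ _ _ l6 _].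
exact: H.
Qed.

(** Transfers all identities of [Pointwise] to the coframe. The table t is truncated to t', which
    agrees with it in range, since b has to be rewritten as a function. *)
Lemma su3_relation_nij_comps w t : su3_relation b w t ->
  exists t', (forall i j k, (i < 6)%N -> (j < 6)%N -> (k < 6)%N ->
     skew3 t' i j k = skew3 t i j k) /\
   [/\ forall i j k, (i < 6)%N -> (j < 6)%N -> (k < 6)%N ->
     nijc b i j k = 2 * dotP t' * tP R [:: i; j; k] + 2 * dotQ t' * tQ R [:: i; j; k],
   dotP (nijc b) = 8 * dotP t' /\ dotQ (nijc b) = 8 * dotQ t',
   forall i, (i < 6)%N -> leec b i = - sg i (2 * leet (skew3 t') (cj i)),
   (forall i j k m, (i < j)%N -> (j < k)%N -> (k < m)%N -> (m < 6)%N ->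
  ext 3 b (tP R) [:: i; j; k; m] =
  wedge1 3 (leec b) (tP R) [:: i; j; k; m]
  - 4^-1 * dotP (nijc b) * hod (tF R) [:: i; j; k; m]) /\
   (forall i j k m, (i < j)%N -> (j < k)%N -> (k < m)%N -> (m < 6)%N ->
  ext 3 b (tQ R) [:: i; j; k; m] =
  wedge1 3 (leec b) (tQ R) [:: i; j; k; m]
  - 4^-1 * dotQ (nijc b) * hod (tF R) [:: i; j; k; m]) &
  forall i j k, (i < j)%N -> (j < k)%N -> (k < 6)%N ->
  2 * skew3 t' i j k =
  - hod (ext 2 b (tF R)) [:: i; j; k] + hod (wedge1 2 (leec b) (tF R)) [:: i; j; k]
  + 4^-1 * dotP (nijc b) * tP R [:: i; j; k]
  + 4^-1 * dotQ (nijc b) * tQ R [:: i; j; k]].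
Proof.
(* [coframe_deriv] is by definition the truncation of this table of matrix entries. *)
move=> /(@su3_normal_form _ (fun k i j =>
   (frame (e x) *m 'D_(row (inord k) (frame (e x))) e x) (inord i) (inord j)))[_].
rewrite -[trunc3 _]/b => Eb; exists (trunc3 t); split.
  by move=> i j k i6 j6 k6; rewrite skew3_trunc3 i6 j6 k6.
rewrite {}Eb; split.
- exact: nijc_su3.
- by split; [exact: dotP_nijc_su3 | exact: dotQ_nijc_su3].
- exact: leec_su3.
- by split; [exact: ext_tP_su3 | exact: ext_tQ_su3].
- exact: torsion_su3.
Qed.

End PointwiseTheorem.

Section PointwiseTheorem.
Context {R : realType}.
Variables (G J e : vec R -> 'M[R]_6) (P Q : vec R -> form R 3) (x : vec R).
Hypothesis de : differentiable e x.
Hypothesis dJ : differentiable J x.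
Hypothesis ad : \forall y \near x, adapted_at (G y) (J y) (P y) (Q y) (e y).

Let b := coframe_deriv e x.
Let adx := nbhs_singleton ad.
Let eUx : frame (e x) \in unitmx.
Proof. by rewrite unitmx_inv; exact: adapted_unit adx. Qed.

Let F y := fundamental (G y) (J y).
Let nijf : form R 3 := lower (G x) (nijenhuis J x).
Let leef : form R 1 := fun v => codiff (p := 1) (q := 4) erefl erefl e F x (v *m J x).
Let starF := hodge (p := 2) (q := 4) erefl (e x) (F x).

(** N is identified with a combination of Psi+ and Psi-; multilinearity of N lets the comparison be
    made on frame vectors. *)
Lemma nij_is_form_of_su3 w t : su3_relation b w t -> is_form nijf.
Proof.
move=> /(su3_relation_nij_comps (x := x))[t' [_ [nE _ _ _ _]]].
have fr : is_form (fun m => 2 * dotP t' * P x m + 2 * dotQ t' * Q x m).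
  by apply: is_formD; apply: is_formZ; [exact: Psip_is_form adx | exact: Psim_is_form adx].
suff -> : nijf = fun m => 2 * dotP t' * P x m + 2 * dotQ t' * Q x m by [].
apply/funext; apply: (multilinear_ext eUx (lower_nij_multilinear _ dJ) fr.1) => f.
rewrite -basis_codes (Psip_basis adx) ?size_codes ?codes_lt6 //.
rewrite (Psim_basis adx) ?size_codes ?codes_lt6 // codes3.
by rewrite /nijf (nij_basis de dJ ad) ?ltn_ord // -nE ?ltn_ord.
Qed.

Lemma structure_of_su3 w t : su3_relation b w t ->
  (forall m, ext_deriv P x m = wedge leef (P x) m - 4^-1 * inner (e x) nijf (P x) * starF m) /\
  (forall m, ext_deriv Q x m = wedge leef (Q x) m - 4^-1 * inner (e x) nijf (Q x) * starF m).
Proof.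
move=> /(su3_relation_nij_comps (x := x))[t' [_ [_ _ _ [sP sQ] _]]].
rewrite (dotP_nij de dJ ad) (dotQ_nij de dJ ad); split.
  apply/(struct_eqE de ad (4^-1 * dotP (nijc b)) (Psip_is_form adx) (fun p => Psip_basis adx (p := p))).
    exact: ext_deriv_Psip de ad.
  exact: sP.
apply/(struct_eqE de ad (4^-1 * dotQ (nijc b)) (Psim_is_form adx) (fun p => Psim_basis adx (p := p))).
  exact: ext_deriv_Psim de ad.
exact: sQ.
Qed.

Lemma su3_of_structure_at : is_form nijf ->
  (forall m, ext_deriv P x m = wedge leef (P x) m - 4^-1 * inner (e x) nijf (P x) * starF m) ->
  (forall m, ext_deriv Q x m = wedge leef (Q x) m - 4^-1 * inner (e x) nijf (Q x) * starF m) ->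
  su3_relation b (su3_part (koszul b)) (half_torsion (koszul b)).
Proof.
rewrite (dotP_nij de dJ ad) (dotQ_nij de dJ ad) => fN.
move/(struct_eqE de ad (4^-1 * dotP (nijc b)) (Psip_is_form adx)
  (fun p => Psip_basis adx (p := p)) (ext_deriv_Psip de ad)) => sP.
move/(struct_eqE de ad (4^-1 * dotQ (nijc b)) (Psim_is_form adx)
  (fun p => Psim_basis adx (p := p)) (ext_deriv_Psim de ad)) => sQ.
have sN i j k : (i < 6)%N -> (j < 6)%N -> (k < 6)%N -> nijc b i j k = - nijc b i k j.
  move=> i6 j6 k6; rewrite -!(nij_basis de dJ ad) // -(form3_swap12 _ _ _ _ fN).
  by [].
move=> k i j k6 i6 j6; have Eb := koszul_decomposition b.
rewrite -/b Eb in sN sP sQ.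
rewrite -{1}(skew2_koszul b).
exact: (su3_of_structure sN sP sQ).
Qed.

Lemma torsion_formula w t (T : form R 3) : su3_relation b w t -> is_form T ->
  (forall i j k, (i < 6)%N -> (j < 6)%N -> (k < 6)%N ->
     T (basis 3 (frame (e x)) [:: i; j; k]) = 2 * skew3 t i j k) ->
  forall m, T m =
    - hodge (p := 3) (q := 3) erefl (e x) (ext_deriv F x) m
    + hodge (p := 3) (q := 3) erefl (e x) (wedge leef (F x)) m
    + 4^-1 * inner (e x) nijf (P x) * P x m
    + 4^-1 * inner (e x) nijf (Q x) * Q x m.
Proof.
move=> /(su3_relation_nij_comps (x := x))[t' [tt' [_ _ _ _ TE]]] fT Tt.
rewrite (dotP_nij de dJ ad) (dotQ_nij de dJ ad) => m.
have [fF dF] := ext_deriv_fund de ad.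
have fFx := fundamental_is_form adx.
have fr : is_form (fun m : 'M[R]_(3, 6) =>
    - hodge (p := 3) (q := 3) erefl (e x) (ext_deriv F x) m
    + hodge (p := 3) (q := 3) erefl (e x) (wedge leef (F x)) m
    + 4^-1 * dotP (nijc b) * P x m + 4^-1 * dotQ (nijc b) * Q x m).
  pose sF := hodge (p := 3) (q := 3) erefl (e x) (ext_deriv F x).
  pose sL := hodge (p := 3) (q := 3) erefl (e x) (wedge leef (F x)).
  apply: (is_formD (a := fun m => - sF m + sL m + 4^-1 * dotP (nijc b) * P x m)); last first.
    by apply: is_formZ; exact: Psim_is_form adx.
  apply: (is_formD (a := fun m => - sF m + sL m)); last first.
    by apply: is_formZ; exact: Psip_is_form adx.
  apply: (is_formD (b := sL)); last exact: hodge_is_form.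
  by apply: is_formN; exact: hodge_is_form.
move: m; apply: (form_ext eUx fT fr) => p sp srt p6.
have eUx' : e x \in unitmx := adapted_unit adx.
rewrite (hodge_basis _ eUx' fF) // (hodge_basis _ eUx' (wedge1_is_form (lee_is_form G J e x) fFx)) //.
rewrite (Psip_basis adx) // (Psim_basis adx) //.
rewrite (hod_compl sp (p := 3) (t2 := ext 2 b (tF R))) //.
rewrite [X in - _ + X](hod_compl sp (p := 3) (t2 := wedge1 2 (leec b) (tF R))) //; last first.
  by move=> c sc c6; exact: (wedge_lee de ad fFx (fun p => fundamental_basis adx (p := p))).
move: p sp srt p6 => [|i [|j [|k [|]]]] //= _ /and3P[ij jk _] /and4P[i6 j6 k6 _].
by rewrite Tt // -?tt' ?TE //; lia.
Qed.

End PointwiseTheorem.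

(** * Parallel tensors in terms of the connection matrix *)

Section Connection.
Context {R : realType}.
Variables (G J e : vec R -> 'M[R]_6) (P Q : vec R -> form R 3) (x : vec R).
Hypothesis de : differentiable e x.
Hypothesis dJ : differentiable J x.
Hypothesis ad : \forall y \near x, adapted_at (G y) (J y) (P y) (Q y) (e y).

Let b := coframe_deriv e x.
Let E i := row (inord i) (frame (e x)).
Let adx := nbhs_singleton ad.
Let eU : e x \in unitmx := adapted_unit adx.
Let fU : frame (e x) \in unitmx.
Proof. by rewrite unitmx_inv. Qed.

Variables (Gam : vec R -> vec R -> vec R -> vec R) (Om : vec R -> 'M[R]_6).
Hypothesis linOm : linear Om.
(* [Om v] is the connection matrix in the moving frame dual to [e]. *)
Hypothesis GamE : forall v w,
  Gam x v w = w *m (e x *m Om v + 'D_v e x) *m frame (e x).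

Let o k i j := Om (E k) (inord i) (inord j).

Lemma mulGam v w : Gam x v w *m e x = w *m (e x *m Om v + 'D_v e x).
Proof. by rewrite GamE mulmxKV. Qed.

Lemma row_frame k : row k (frame (e x)) *m e x = delta_mx 0 k.
Proof. by rewrite -row_mul mulVmx // row1. Qed.

Lemma Gam_basis k i j : (k < 6)%N -> (i < 6)%N -> (j < 6)%N ->
  (Gam x (E k) (E i) *m e x) 0 (inord j) = o k i j + b k i j.
Proof.
move=> k6 i6 j6; rewrite mulGam mulmxDr mxE; congr (_ + _).
  by rewrite mulmxA row_frame -rowE mxE.
by rewrite -row_mul mxE (frame_coframe_deriv e x).
Qed.

Lemma is_derive_metric v : is_derive x v G ('D_v e x *m (e x)^T + e x *m ('D_v e x)^T).
Proof.
have De : is_derive x v e ('D_v e x) by exact/derivableP/diff_derivable.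
apply: (near_eq_is_derive _ (is_derive_mulmx De (is_derive_trmx De))).
by apply: filterS ad => y /adapted_metric.
Qed.

(** In the moving frame g is the identity matrix, so its covariant derivative is given by Om + Om^T.
    In the same way J yields the commutator with [acs0], and a form with constant components yields
    the derivation action of Om. *)
Lemma parallel_metricE : parallel_metric Gam G x <-> forall v, Om v + (Om v)^T = 0.
Proof.
have E1 v w z : 'D_v (fun y => bilin (G y) w z) x =
    bilin (G x) (Gam x v w) z + bilin (G x) w (Gam x v z)
    - (w *m e x *m (Om v + (Om v)^T) *m (z *m e x)^T) 0 0.
  have := is_derive_entry 0 0 (is_derive_mulmxr z^T (is_derive_mulmxl w (is_derive_metric v))).
  case=> _ ->.
  have GE u u' : bilin (G x) u u' = (u *m e x *m (u' *m e x)^T) 0 0.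
    by rewrite /bilin (adapted_metric adx) trmx_mul !mulmxA.
  have ent (A B C D : 'M[R]_1) : A = B + C - D -> A 0 0 = B 0 0 + C 0 0 - D 0 0.
    by move=> ->; rewrite !mxE.
  rewrite !GE !mulGam; apply: ent.
  rewrite !trmx_mul [(e x *m Om v + _)^T]linearD /= trmx_mul !(mulmxDr, mulmxDl) !mulmxA.
  set A := _ *m Om v *m _ *m _; set B := _ *m 'D_v e x *m _ *m _.
  set C := _ *m _ *m (Om v)^T *m _ *m _; set D := _ *m _ *m ('D_v e x)^T *m _.
  by rewrite [A + B + _]addrACA [RHS]addrC addKr.
split=> [pG v|H v w z]; last by rewrite E1 H mulmx0 mul0mx mxE subr0.
have H (w z : vec R) : (w *m e x *m (Om v + (Om v)^T) *m (z *m e x)^T) 0 0 = 0.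
  by have := E1 v w z; rewrite pG -[X in X = _ -> _]addr0 => /addrI/esym/eqP;
    rewrite oppr_eq0 => /eqP.
apply/matrixP => i j; have := H (row i (frame (e x))) (row j (frame (e x))).
by rewrite !row_frame -rowE trmx_delta -colE [X in X = _ -> _]mxE [X in X = _ -> _]mxE => ->; rewrite mxE.
Qed.

Lemma parallel_endoE : parallel_endo Gam J x <-> forall v, acs0 *m Om v = Om v *m acs0.
Proof.
have Dc (w u : vec R) : 'D_u (cst w : vec R -> vec R) x = 0 by exact: derive_cst.
have DJ v w : 'D_v (fun y => w *m J y) x = w *m 'D_v J x.
  by apply: derive_val; apply: is_derive_mulmxl; exact/derivableP/diff_derivable.
have E1 v w : cov Gam (cst v) (fun y => w *m J y) x *m e x =
    cov Gam (cst v) (cst w) x *m J x *m e x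
    + w *m e x *m (acs0 *m Om v - Om v *m acs0).
  have aux (A B C D : vec R) : A - B + (C + B) = D + A + (C - D).
    by rewrite [C + B]addrC addrA subrK [D + A]addrC -addrA [C - D]addrC addNKr.
  rewrite /cov Dc add0r DJ /cst mulmxDl mulGam -(mulmxA w) (derive_acs de dJ ad).
  rewrite -(mulmxA (Gam x v w)) (adapted_acs adx) (mulmxA (Gam x v w)) mulGam.
  rewrite !(mulmxDr, mulmxDl, mulmxBr) !mulmxN !mulmxA -(mulmxA w (J x) (e x)) (adapted_acs adx) !mulmxA.
  exact: aux.
split=> [pJ v|H v w].
  apply/eqP; rewrite -subr_eq0; apply/eqP.
  have H (w : vec R) : w *m e x *m (acs0 *m Om v - Om v *m acs0) = 0.
    by have := E1 v w; rewrite pJ -[X in X = _ -> _]addr0 => /addrI.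
  apply/row_matrixP => i; rewrite rowE row0 -(row_frame i).
  exact: H.
by apply: (can_inj (mulmxK eU)); rewrite E1 H subrr mulmx0 addr0.
Qed.

Section ParallelForm.
Variables (a : vec R -> form R 3) (t : seq nat -> R).
Hypothesis fa : \forall y \near x, is_form (a y).
Hypothesis at_ : \forall y \near x, forall p, size p = 3 -> all (ltn^~ 6) p ->
  a y (basis 3 (frame (e y)) p) = t p.

Let act v : form R 3 := fun m =>
  \sum_(j < 3) a x (set_row j (row j m *m (e x *m Om v *m frame (e x))) m).

Lemma act_multilinear v : multilinear_form (act v).
Proof.
have [ma _] := nbhs_singleton fa.
move=> i m c u w; rewrite /act mulr_sumr -big_split /=; apply: eq_bigr => j _.
rewrite !set_rowE; have [->|ij] := eqVneq j i.
  by rewrite !set_row_twice mulmxDl -scalemxAl ma.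
by rewrite !(set_row_swap _ _ _ ij) ma.
Qed.

Lemma act_basis v p : size p = 3 -> all (ltn^~ 6) p ->
  act v (basis 3 (frame (e x)) p) = su3_action (fun i j => Om v (inord i) (inord j)) t p.
Proof.
move=> sp p6; rewrite /act /su3_action sumtoE; apply: eq_bigr => j _.
have [ma _] := nbhs_singleton fa.
rewrite (multilinear_expand_row (E := frame (e x)) _ _ _ ma) // -sum6E; apply: eq_bigr => l _.
have -> : row l (frame (e x)) = row (inord l) (frame (e x)) by rewrite inord_val.
rewrite (set_row_basis _ _ (ltn_ord l) sp).
rewrite (nbhs_singleton at_) ?size_set_nth ?sp //; last first.
  by apply: all_set_nth => //; rewrite sp.
  by apply/maxn_idPr; exact: ltn_ord.
congr (_ * _); rewrite row_basis /frame invmxK -/(frame (e x)) mulmxA mulmxKV //.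
by rewrite mulmxA row_frame -rowE mxE inord_val.
Qed.

Lemma parallel_formE : parallel_form Gam a x <->
  forall v i j l, (i < 6)%N -> (j < 6)%N -> (l < 6)%N ->
    su3_action (fun i j => Om v (inord i) (inord j)) t [:: i; j; l] = 0.
Proof.
have dt (f : {ffun 'I_3 -> 'I_6}) :
    \forall y \near x, t (codes f) = a y (rowsub f (frame (e y))).
  by apply: filterS at_ => y ty; rewrite -basis_codes ty ?size_codes ?codes_lt6.
have ddt (f : {ffun 'I_3 -> 'I_6}) : differentiable (fun y => a y (rowsub f (frame (e y))) : R) x.
  apply: (near_eq_differentiable (f := fun=> t (codes f))); last exact: differentiable_cst.
  exact: dt f.
have E1 v m : \sum_(i < 3) a x (set_row i (Gam x v (row i m)) m) =
    act v m + 'D_v (fun y => a y m : R) x.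
  have [_ ->] := is_derive_form (near_unit ad) de fa ddt v m.
  rewrite [X in _ = _ + (X + _)]big1 ?add0r => [|f _]; last first.
    by rewrite -(near_eq_derive _ (dt f)) derive_cst mulr0.
  rewrite -big_split /=; apply: eq_bigr => i _; rewrite GamE mulmxDr mulmxDl !mulmxA.
  have [ma _] := nbhs_singleton fa.
  by rewrite -[X in set_row i (X + _)]scale1r ma mul1r.
split=> [pa v i j l i6 j6 l6|H v m].
  rewrite -act_basis //= ?i6 ?j6 ?l6 //; apply: (addIr ('D_v (fun y =>
    a y (basis 3 (frame (e x)) [:: i; j; l])) x)).
  by rewrite -E1 add0r pa.
rewrite E1; suff -> : act v m = 0 by rewrite add0r.
move: m; apply: (multilinear_ext fU (act_multilinear v)).
  by move=> i m c u w; rewrite mulr0 addr0.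
move=> f; rewrite -basis_codes act_basis ?size_codes ?codes_lt6 // codes3.
by apply: H; exact: ltn_ord.
Qed.
End ParallelForm.

End Connection.

Section Linearity.
Context {R : realType}.
Implicit Types (b w t : nat -> nat -> nat -> R).

Lemma su3_sum (c : nat -> R) w i j : (i < 6)%N -> (j < 6)%N ->
  su3 (fun p q => sum6 (fun k => c k * w k p q)) i j = sum6 (fun k => c k * su3 (w k) i j).
Proof.
by do 6 (case: i => [_|i]; [by do 6 (case: j => [_|j]; [tab; ring|])|]).
Qed.

Lemma su3B (o o' : nat -> nat -> R) i j :
  su3 (fun p q => o p q - o' p q) i j = su3 o i j - su3 o' i j.
Proof.
rewrite /su3; do 6 (case: i => [|i]; [do 6 (case: j => [|j]; [ring|]); ring|]); ring.
Qed.

Lemma skew3B t t' i j k :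
  skew3 (fun i j k => t i j k - t' i j k) i j k = skew3 t i j k - skew3 t' i j k.
Proof. by rewrite /skew3; do !case: ifP => _; ring. Qed.

(** The difference of two solutions is at once su(3)-valued and totally skew, hence zero. *)
Lemma su3_relation_unique b w t w' t' : su3_relation b w t -> su3_relation b w' t' ->
  forall k i j, (k < 6)%N -> (i < 6)%N -> (j < 6)%N -> su3 (w k) i j = su3 (w' k) i j.
Proof.
move=> rel rel'.
have D k i j : (k < 6)%N -> (i < 6)%N -> (j < 6)%N ->
    su3 (fun p q => w k p q - w' k p q) i j = skew3 (fun i j k => t i j k - t' i j k) k i j.
  move=> k6 i6 j6; rewrite su3B skew3B.
  have := rel k i j k6 i6 j6; rewrite rel' //; clear; lra.
move=> k i j k6 i6 j6.
have E : su3 (fun p q => w k p q - w' k p q) i j = 0.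
  by rewrite D // (su3_skew3_eq0 (w := fun k p q => w k p q - w' k p q) D).
by apply/eqP; rewrite -subr_eq0 -su3B E.
Qed.

Lemma skew3_form (a : form R 3) (E : 'M[R]_6) i j k : is_form a ->
  skew3 (fun i j k => a (basis 3 E [:: i; j; k])) i j k = a (basis 3 E [:: i; j; k]).
Proof.
move=> fa; pose c i j k := a (basis 3 E [:: i; j; k]).
have s12 i' j' k' : c i' k' j' = - c i' j' k' by exact: form3_swap12.
have s01 i' j' k' : c j' i' k' = - c i' j' k' by exact: form3_swap01.
have ltE m n : Nat.ltb m n = (m < n)%N.
  by apply/idP/idP => [/Nat.ltb_lt/ssrnat.ltP|/ssrnat.ltP/Nat.ltb_lt].
have eqE m n : Nat.eqb m n = (m == n) by [].
rewrite -/(c i j k) /skew3 !ltE !eqE -/(c i j k) -!/(c _ _ _).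
have z01 i' k' : c i' i' k' = 0 by have := s01 i' i' k'; lra.
have z12 i' k' : c i' k' k' = 0 by have := s12 i' k' k'; lra.
have z02 i' k' : c i' k' i' = 0 by rewrite s12 z01 oppr0.
case: (ltngtP i j) => [ij|ji|<-]; last by rewrite z01.
  case: (ltngtP j k) => [//|kj|->]; last by rewrite z12.
  case: (ltngtP i k) => [ik|ki|->]; last by rewrite z02.
    by rewrite (s12 i k j).
  by rewrite (s12 i k j) -(s01 i k j) .
case: (ltngtP i k) => [ik|ki|->]; last by rewrite z02.
  by rewrite (s01 j i k).
case: (ltngtP j k) => [jk|kj|->]; last by rewrite z12.
  by rewrite (s12 j i k) (s01 i j k) opprK.
by rewrite (s01 j k i) opprK (s12 j i k) (s01 i j k) opprK.
Qed.

End Linearity.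

(** * Connections at a point: existence criterion and uniqueness *)

Section PointwiseConnection.
Context {R : realType}.
Variables (G J e : vec R -> 'M[R]_6) (P Q : vec R -> form R 3) (x : vec R).
Hypothesis de : differentiable e x.
Hypothesis dJ : differentiable J x.
Hypothesis ad : \forall y \near x, adapted_at (G y) (J y) (P y) (Q y) (e y).
Implicit Types (Gam : vec R -> vec R -> vec R -> vec R) (w t : nat -> nat -> nat -> R).

Let b := coframe_deriv e x.
Let adx := nbhs_singleton ad.
Let eU : e x \in unitmx := adapted_unit adx.
Let fU : frame (e x) \in unitmx.
Proof. by rewrite unitmx_inv. Qed.

(** These conditions involve only the value of [Gam] at x, so a connection can be found point by
    point before smoothness and gluing are considered. *)
Definition su3_at Gam : Prop :=
  [/\ (forall v, linear (Gam x v)), (forall u, linear (Gam x ^~ u)) &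
  [/\ parallel_metric Gam G x, parallel_endo Gam J x, parallel_form Gam P x,
      parallel_form Gam Q x & is_form (lower (G x) (torsion Gam x))]].

Definition su3_mx w (v : vec R) : 'M[R]_6 := \matrix_(i, j)
  su3 (fun p q => sum6 (fun k => (v *m e x) 0 (inord k) * w k p q)) i j.

(** Chart expression of the connection with matrices [su3 (w k)] along E_k: a constant field u has
    frame components u e, which are differentiated and then converted back by [frame]. *)
Definition christoffel w (v u : vec R) : vec R :=
  u *m (e x *m su3_mx w v + 'D_v e x) *m frame (e x).

Lemma su3_mxE w v i j : (i < 6)%N -> (j < 6)%N -> su3_mx w v (inord i) (inord j) =
  sum6 (fun k => (v *m e x) 0 (inord k) * su3 (w k) i j).
Proof. by move=> i6 j6; rewrite mxE !inordK // su3_sum. Qed.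

Lemma su3_mx_basis w k i j : (k < 6)%N -> (i < 6)%N -> (j < 6)%N ->
  su3_mx w (row (inord k) (frame (e x))) (inord i) (inord j) = su3 (w k) i j.
Proof.
move=> k6 i6 j6; rewrite su3_mxE // (row_frame ad) -sum6E (bigD1 (inord k)) //= big1 => [|l lk].
  by rewrite mxE inord_val !eqxx mul1r addr0 inordK.
by rewrite mxE inord_val (negPf lk) andbF mul0r.
Qed.

Lemma su3_mx_linear w : linear (su3_mx w).
Proof.
move=> c u v; apply/matrixP; apply: ord6P => i i6; apply: ord6P => j j6.
rewrite [RHS]mxE [X in _ = X + _]mxE !su3_mxE // -!sum6E mulr_sumr -big_split /=.
by apply: eq_bigr => k _; rewrite mulmxDl -scalemxAl [in LHS]mxE [in LHS]mxE; ring.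
Qed.

Lemma torsionE Gam u v : torsion Gam x u v = Gam x u v - Gam x v u.
Proof.
have Dc (w' u' : vec R) : 'D_u' (cst w' : vec R -> vec R) x = 0 by exact: derive_cst.
by rewrite /torsion /cov /lie_bracket !Dc !add0r !oppr0 addr0.
Qed.

Lemma torsion_basis Gam (Om : vec R -> 'M[R]_6) :
  (forall v u, Gam x v u = u *m (e x *m Om v + 'D_v e x) *m frame (e x)) ->
  let o k i j := Om (row (inord k) (frame (e x))) (inord i) (inord j) in
  forall k i j, (k < 6)%N -> (i < 6)%N -> (j < 6)%N ->
  lower (G x) (torsion Gam x) (basis 3 (frame (e x)) [:: k; i; j])
  = o k i j - o i k j + (b k i j - b i k j).
Proof.
move=> GamE o k i j k6 i6 j6; rewrite (lower_basis adx) torsionE mulmxBl mxE.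
rewrite (Gam_basis ad GamE) // mxE (Gam_basis ad GamE) // /o /b; ring.
Qed.

Let nfP : \forall y \near x, is_form (P y).
Proof. by apply: filterS ad => y /Psip_is_form. Qed.

Let nfQ : \forall y \near x, is_form (Q y).
Proof. by apply: filterS ad => y /Psim_is_form. Qed.

Let ntP : \forall y \near x, forall p, size p = 3 -> all (ltn^~ 6) p ->
  P y (basis 3 (frame (e y)) p) = tP R p.
Proof. by apply: filterS ad => y ady p; exact: (Psip_basis ady). Qed.

Let ntQ : \forall y \near x, forall p, size p = 3 -> all (ltn^~ 6) p ->
  Q y (basis 3 (frame (e y)) p) = tQ R p.
Proof. by apply: filterS ad => y ady p; exact: (Psim_basis ady). Qed.

Lemma linear_frame (V : lmodType R) (L : vec R -> V) v : linear L ->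
  L v = \sum_k (v *m e x) 0 k *: L (row k (frame (e x))).
Proof.
move=> linL.
pose l := GRing.isLinear.Build _ _ _ _ L linL.
pose L' : {linear vec R -> V} := HB.pack L l.
rewrite -[L]/(L' : _ -> _) {1}(row_sum_basis v fU) /frame invmxK linear_sum.
by apply: eq_bigr => k _; rewrite linearZ.
Qed.

Lemma multilinear_xrow k (a : form R k) i j : multilinear_form a ->
  multilinear_form (fun m => - a (xrow i j m)).
Proof.
move=> ma l m c u w.
have E u' : xrow i j (set_row l u' m) = set_row (tperm i j l) u' (xrow i j m).
  have rE (A : 'M[R]_(k, 6)) q : row q (xrow i j A) = row (tperm i j q) A.
    by apply/rowP => r; rewrite !mxE.
  apply/row_matrixP => q; rewrite rE !set_rowE rE.
  by rewrite -(inj_eq (@perm_inj _ (tperm i j))) tpermK.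
by rewrite !E ma opprD mulrN.
Qed.

(** Parallelism puts the connection matrices in su(3); being metric, the connection then has
    Levi-Civita part equal to itself minus half the torsion. *)
Lemma su3_at_relation Gam : su3_at Gam -> exists w t, [/\ su3_relation b w t,
  forall i j k, (i < 6)%N -> (j < 6)%N -> (k < 6)%N ->
    lower (G x) (torsion Gam x) (basis 3 (frame (e x)) [:: i; j; k]) = 2 * skew3 t i j k &
  Gam x = christoffel w].
Proof.
move=> [linr linl [pG pJ pP pQ fT]].
(* The connection matrix in the frame, obtained by solving Gam v u = u (e Om v + D_v e) e^-1. *)
pose Om v := frame (e x) *m (lin1_mx (Gam x v) *m e x - 'D_v e x).
have GamE v u : Gam x v u = u *m (e x *m Om v + 'D_v e x) *m frame (e x).
  rewrite /Om mulmxA mulmxV // mul1mx subrK mulmxA mulmxK //.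
  pose l := GRing.isLinear.Build _ _ _ _ (Gam x v) (linr v).
  pose L : {linear vec R -> vec R} := HB.pack (Gam x v) l.
  by rewrite -[Gam x v]/(L : _ -> _) mul_rV_lin1.
pose o k i j : R := Om (row (inord k) (frame (e x))) (inord i) (inord j).
have oE v i j : (i < 6)%N -> (j < 6)%N ->
    su3 (fun i j => Om v (inord i) (inord j)) i j = Om v (inord i) (inord j).
  have com p q : (p < 6)%N -> (q < 6)%N ->
      - sg q (Om v (inord p) (inord (cj q))) = sg p (Om v (inord (cj p)) (inord q)).
    move=> p6 q6; rewrite -mul_acs0 // -acs0_mul //.
    by rewrite ((parallel_endoE de dJ ad GamE).1 pJ v).
  move: i j; apply: su3_id => [i j i6 j6|p q|].
  - have /matrixP/(_ (inord j) (inord i)) := (parallel_metricE de ad GamE).1 pG v.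
    by rewrite [X in X = _ -> _]mxE [X in _ + X]mxE [X in _ = X -> _]mxE => /eqP;
      rewrite addr_eq0 => /eqP.
  - rewrite !inE => /or3P[] /eqP[-> ->].
    + by have := com 0%N 2%N isT isT; have := com 0%N 3%N isT isT; rewrite /sg /= => <- <-; rewrite !opprK.
    + by have := com 0%N 4%N isT isT; have := com 0%N 5%N isT isT; rewrite /sg /= => <- <-; rewrite !opprK.
    + by have := com 2%N 4%N isT isT; have := com 2%N 5%N isT isT; rewrite /sg /= => <- <-; rewrite !opprK.
  (* At (E_0, E_2, E_4) the derivation action on Psi- is, up to sign, the complex trace Om_01 +
     Om_23 + Om_45. *)
  - have := (parallel_formE de ad GamE nfQ ntQ).1 pQ v 0%N 2%N 4%N isT isT isT.
    move: (Om v) => W; pose f (i j : nat) : R := W (inord i) (inord j).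
    rewrite -[W (inord 4) _]/(f 4%N 5%N) -[W (inord 0) _]/(f 0%N 1%N) -[W (inord 2) _]/(f 2%N 3%N).
    rewrite -[fun i j : nat => _]/f; move: f => f; rewrite /su3_action; tab; lra.
have linOm : linear Om.
  move=> c u v; rewrite /Om (derive_is_linear de) scalemxAr -mulmxDr; congr (_ *m _).
  have -> : lin1_mx (Gam x (c *: u + v)) = c *: lin1_mx (Gam x u) + lin1_mx (Gam x v).
    by apply/matrixP => i j; rewrite [LHS]mxE linl !mxE.
  by rewrite mulmxDl -scalemxAl opprD scalerBr addrACA.
have OmE v : Om v = su3_mx o v.
  apply/matrixP; apply: ord6P => i i6; apply: ord6P => j j6.
  rewrite -oE // [RHS]mxE !inordK //; congr su3; apply/funext => p; apply/funext => q.
  rewrite (linear_frame v linOm) summxE -sum6E; apply: eq_bigr => k _.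
  by rewrite mxE inord_val /o inord_val.
have oE' k i j : (i < 6)%N -> (j < 6)%N -> su3 (o k) i j = o k i j by exact: oE.
have torB k i j : (k < 6)%N -> (i < 6)%N -> (j < 6)%N ->
    lower (G x) (torsion Gam x) (basis 3 (frame (e x)) [:: k; i; j])
    = o k i j - o i k j + (b k i j - b i k j).
  exact: (torsion_basis GamE).
clearbody o.
pose t i j k : R := 2^-1 * lower (G x) (torsion Gam x) (basis 3 (frame (e x)) [:: i; j; k]).
have torE i j k : (i < 6)%N -> (j < 6)%N -> (k < 6)%N ->
    lower (G x) (torsion Gam x) (basis 3 (frame (e x)) [:: i; j; k]) = 2 * skew3 t i j k.
  move=> i6 j6 k6.
  rewrite (@skew3_form R (fun m => 2^-1 * lower (G x) (torsion Gam x) m)); last exact: is_formZ.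
  by rewrite mulVKf // pnatr_eq0.
exists o, t; split=> //.
  apply: (koszul_of_torsion (o := fun k => su3 (o k))) => k i j k6 i6 j6; first exact: su3_skew.
  by rewrite -torE // torB // !oE'.
by apply/funext => v; apply/funext => u; rewrite GamE OmE.
Qed.

(** Skewness in the first two arguments holds for every torsion, and skewness in the last two is
    checked on the frame; adjacent pairs suffice. *)
Lemma torsion_is_form Gam t :
  (forall v, linear (Gam x v)) -> (forall u, linear (Gam x ^~ u)) ->
  (forall i j k, (i < 6)%N -> (j < 6)%N -> (k < 6)%N ->
    lower (G x) (torsion Gam x) (basis 3 (frame (e x)) [:: i; j; k]) = 2 * skew3 t i j k) ->
  is_form (lower (G x) (torsion Gam x)).
Proof.
move=> linr linl torE.
have ma : multilinear_form (lower (G x) (torsion Gam x)).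
  apply: lower_multilinear => [v c u u'|u c v v']; rewrite !torsionE.
    by rewrite (linl v c u u') (linr v c u u') opprD scalerBr addrACA.
  by rewrite (linr u c v v') (linl u c v v') opprD scalerBr addrACA.
apply: alternating_adjacent => // m i j ij rij.
case: i j ij rij => [[|[|[|//]]] i3] [[|[|[|//]]] j3] //= _.
  have -> : Ordinal i3 = inord 0 by apply: val_inj; rewrite /= inordK.
  have -> : Ordinal j3 = inord 1 by apply: val_inj; rewrite /= inordK.
  move=> r01; rewrite /lower torsionE r01 subrr.
  by rewrite /bilin !mul0mx mxE.
have -> : Ordinal i3 = inord 1 by apply: val_inj; rewrite /= inordK.
have -> : Ordinal j3 = inord 2 by apply: val_inj; rewrite /= inordK.
move=> r12.
have : lower (G x) (torsion Gam x) m = - lower (G x) (torsion Gam x) (xrow (inord 1) (inord 2) m).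
  move: m {r12}; apply: (multilinear_ext fU ma (multilinear_xrow _ _ ma)) => f.
  rewrite -basis_codes codes3 xrow12_basis !torE ?ltn_ord //.
  by rewrite skew3_swap23 ?ltn_ord // mulrN.
have -> : xrow (inord 1) (inord 2) m = m.
  apply/row_matrixP => l; rewrite (_ : row l (xrow _ _ m) = row (tperm (inord 1) (inord 2) l) m).
    by case: tpermP => [->|->|].
  by apply/rowP => q; rewrite !mxE.
by lra.
Qed.

Lemma christoffel_su3 w t : su3_relation b w t -> su3_at (fun _ => christoffel w).
Proof.
move=> rel; set Gam := fun _ => christoffel w.
have GamE v u : Gam x v u = u *m (e x *m su3_mx w v + 'D_v e x) *m frame (e x) by [].
have mxE' v i j : (i < 6)%N -> (j < 6)%N -> su3_mx w v (inord i) (inord j) =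
  su3 (fun p q => sum6 (fun k => (v *m e x) 0 (inord k) * w k p q)) i j.
  by move=> i6 j6; rewrite mxE !inordK.
have torE : forall k i j, (k < 6)%N -> (i < 6)%N -> (j < 6)%N ->
    lower (G x) (torsion Gam x) (basis 3 (frame (e x)) [:: k; i; j]) = 2 * skew3 t k i j.
  move=> k i j k6 i6 j6; rewrite (torsion_basis GamE) // !su3_mx_basis //.
  exact: (torsion_of_koszul rel).
have linr v : linear (Gam x v) by move=> c u u'; rewrite /Gam /christoffel !mulmxDl -!scalemxAl.
have linl u : linear (Gam x ^~ u).
  have gen c (A B A' B' : 'M[R]_6) : u *m (e x *m (c *: A + B) + (c *: A' + B')) *m frame (e x)
      = c *: (u *m (e x *m A + A') *m frame (e x)) + u *m (e x *m B + B') *m frame (e x).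
    rewrite [e x *m (_ + _)]mulmxDr -scalemxAr addrACA -scalerDr.
    by rewrite [u *m (c *: _ + _)]mulmxDr -scalemxAr [LHS]mulmxDl -scalemxAl.
  move=> c v v'; rewrite /Gam /christoffel su3_mx_linear (derive_is_linear de).
  exact: gen.
split=> //; split.
- apply/(parallel_metricE de ad GamE) => v; apply/matrixP; apply: ord6P => i i6; apply: ord6P => j j6.
  by rewrite [LHS]mxE [X in _ + X]mxE [RHS]mxE !mxE' // su3_skew // addNr.
- apply/(parallel_endoE de dJ ad GamE) => v; apply/matrixP; apply: ord6P => i i6; apply: ord6P => j j6.
  by rewrite mul_acs0 // acs0_mul // !mxE' ?cj_lt6 // su3_acs.
- apply/(parallel_formE de ad GamE nfP ntP) => v i j l i6 j6 l6.
  by rewrite /su3_action /= /sum6 !mxE' //; exact: su3_tP.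
- apply/(parallel_formE de ad GamE nfQ ntQ) => v i j l i6 j6 l6.
  by rewrite /su3_action /= /sum6 !mxE' //; exact: su3_tQ.
exact: torsion_is_form linr linl torE.
Qed.

Lemma su3_at_unique Gam Gam' : su3_at Gam -> su3_at Gam' -> Gam x = Gam' x.
Proof.
move=> /su3_at_relation[w [t [rel _ ->]]] /su3_at_relation[w' [t' [rel' _ ->]]].
have E v : su3_mx w v = su3_mx w' v.
  apply/matrixP; apply: ord6P => i i6; apply: ord6P => j j6.
  have U := su3_relation_unique rel rel'.
  by rewrite !su3_mxE // -!sum6E; apply: eq_bigr => k _; rewrite (U k i j).
by apply/funext => v; apply/funext => u; rewrite /christoffel E.
Qed.

End PointwiseConnection.

(** * Smooth dependence of the tables on the point *)

Section Smoothness.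
Context {R : realType}.

Lemma derive_coord m n (f : vec R -> 'M[R]_(m, n)) x v : differentiable f x ->
  'D_v f x = \sum_(l < 6) v 0 l *: ('D_(delta_mx 0 l) f x : 'M[R]_(m, n)).
Proof.
move=> df; rewrite {1}(row_sum_delta v) deriveE // linear_sum.
by apply: eq_bigr => l _; rewrite linearZ /= deriveE.
Qed.

Variables (U : set (vec R)) (e : vec R -> 'M[R]_6).
Hypotheses (oU : open U) (se : smooth_on U e) (eU : forall x, U x -> e x \in unitmx).

Lemma smooth_frame : smooth_on U (fun x => frame (e x)).
Proof. exact: smooth_on_invmx. Qed.

Lemma smooth_coframe_deriv k i j : smooth_on U (fun x => coframe_deriv e x k i j : R).
Proof.
rewrite /coframe_deriv; case: [&& (k < 6)%N, (i < 6)%N & (j < 6)%N]; last exact: smooth_on_cst.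
(* The direction E_k moves with the point, so the derivative is expanded along the fixed coordinate
   directions. *)
apply: (smooth_on_ext (f := fun x => \sum_(l < 6) frame (e x) (inord k) l
   * (frame (e x) *m 'D_(delta_mx 0 l) e x) (inord i) (inord j))) => // [x Ux|].
  have gen (F : 'M[R]_6) (v : vec R) (D : 'I_6 -> 'M[R]_6) p q :
      (F *m \sum_(l < 6) v 0 l *: D l) p q = \sum_(l < 6) v 0 l * (F *m D l) p q.
    by rewrite mulmx_sumr summxE; apply: eq_bigr => l _; rewrite -scalemxAr mxE.
  rewrite (derive_coord _ (smooth_on_differentiable oU se Ux)) gen.
  by apply: eq_bigr => l _; congr (_ * _); rewrite mxE.
apply: smooth_on_sum => // l _; apply: smooth_onM => //.
  exact: ((smooth_on_mxP _ oU).1 smooth_frame).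
apply: ((smooth_on_mxP (fun x => frame (e x) *m 'D_(delta_mx 0 l) e x) oU).1 _ (inord i) (inord j)).
by apply: smooth_on_mulmx => //; [exact: smooth_frame | exact: smooth_on_derive].
Qed.

Definition smooth_table (l : vec R -> nat -> nat -> nat -> R) : Prop :=
  forall k i j, smooth_on U (fun x => l x k i j).

Lemma smooth_koszul b : smooth_table b -> smooth_table (fun x => koszul (b x)).
Proof.
move=> sb k i j; rewrite /koszul; apply: smooth_onM => //; first exact: smooth_on_cst.
apply: (smooth_onD (g := fun x => b x k j i - b x j k i)) => //; last exact: smooth_onB.
apply: (smooth_onD (g := fun x => b x i j k - b x j i k)) => //; last exact: smooth_onB.
exact: (smooth_onB (g := fun x => b x k i j)).
Qed.

Lemma smooth_skew3 t : smooth_table t -> smooth_table (fun x => skew3 (t x)).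
Proof.
move=> st i j k; rewrite /skew3.
have s0 : smooth_on U (fun=> 0 : R) by exact: smooth_on_cst.
have sN i' j' k' : smooth_on U (fun x => - t x i' j' k') by exact: smooth_onN (st _ _ _).
case: (Nat.ltb i j); [case: (Nat.ltb j k); [|case: (Nat.eqb k j); [|case: (Nat.ltb i k);
  [|case: (Nat.eqb i k)]]] | case: (Nat.eqb i j); [| case: (Nat.ltb i k);
  [|case:(Nat.eqb i k); [|case:(Nat.ltb j k); [|case:(Nat.eqb j k)]]]]].
all: first [exact: s0 | exact: st | exact: sN].
Qed.

Lemma smooth_skew2 t : smooth_table t -> smooth_table (fun x => skew2 (t x)).
Proof.
move=> st k i j; rewrite /skew2.
have s0 : smooth_on U (fun=> 0 : R) by exact: smooth_on_cst.
have sN : smooth_on U (fun x => - t x k j i) by exact: smooth_onN (st _ _ _).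
case: (Nat.ltb i j); first exact: st.
by case: (Nat.eqb i j).
Qed.

Lemma smooth_half_torsion l : smooth_table l -> smooth_table (fun x => half_torsion (l x)).
Proof.
move=> sl; have sre k i j : smooth_on U (fun x => skew2 (l x) k i j - skew2 (l x) k (cj i) (cj j)).
  by apply: (smooth_onB (g := fun x => skew2 (l x) k (cj i) (cj j))) => //; exact: (smooth_skew2 sl).
have sim k i j : smooth_on U (fun x => skew2 (l x) k i (cj j) + skew2 (l x) k (cj i) j).
  by apply: (smooth_onD (g := fun x => skew2 (l x) k (cj i) j)) => //; exact: (smooth_skew2 sl).
move=> i j k; rewrite /half_torsion.
have s0 : smooth_on U (fun=> 0 : R) by exact: smooth_on_cst.
have sx : smooth_on U (fun x => 2^-1 * (skew2 (l x) 2%N 0%N 4%N - skew2 (l x) 2%N (cj 0%N) (cj 4%N)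
   - (skew2 (l x) 0%N 2%N 4%N - skew2 (l x) 0%N (cj 2%N) (cj 4%N))
   - (skew2 (l x) 5%N 0%N (cj 2%N) + skew2 (l x) 5%N (cj 0%N) 2%N))).
  apply: smooth_onM => //; first exact: smooth_on_cst.
  by do 2!(apply: smooth_onB => //).
have sy : smooth_on U (fun x => 2^-1 * (skew2 (l x) 2%N 0%N (cj 4%N) + skew2 (l x) 2%N (cj 0%N) 4%N
   - (skew2 (l x) 0%N 2%N (cj 4%N) + skew2 (l x) 0%N (cj 2%N) 4%N)
   + (skew2 (l x) 4%N 0%N (cj 2%N) + skew2 (l x) 4%N (cj 0%N) 2%N))).
  apply: smooth_onM => //; first exact: smooth_on_cst.
  by apply: smooth_onD => //; apply: smooth_onB => //.
have sN f : smooth_on U f -> smooth_on U (fun x => - f x :> R) by exact: smooth_onN.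
have sD f g : smooth_on U f -> smooth_on U g -> smooth_on U (fun x => f x + g x :> R) by exact: smooth_onD.
have sB f g : smooth_on U f -> smooth_on U g -> smooth_on U (fun x => f x - g x :> R) by exact: smooth_onB.
case: i => [|[|[|[|i]]]]; case: j => [|[|[|[|[|j]]]]]; try exact: s0; case: k => [|[|[|[|[|[|k]]]]]]; try exact: s0.
all: first [exact: sre | exact: sx | exact: sN (sim _ _ _) | exact: sD sx (sre _ _ _) | exact: sB sx (sre _ _ _)
  | exact: sB (sN _ (sim _ _ _)) sy | exact: sy | exact: sB (sim _ _ _) sy | exact: sD (sB _ _ (sim _ _ _) sy) (sre _ _ _)].
Qed.

Lemma smooth_su3_part l : smooth_table l -> smooth_table (fun x => su3_part (l x)).
Proof.
move=> sl k i j; apply: smooth_onD => //; first exact: smooth_skew2.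
exact: smooth_skew3 (smooth_half_torsion sl) _ _ _.
Qed.

Lemma smooth_su3 (o : vec R -> nat -> nat -> R) : (forall p q, smooth_on U (fun x => o x p q)) ->
  forall i j, smooth_on U (fun x => su3 (o x) i j).
Proof.
move=> so i j; rewrite /su3.
have s0 : smooth_on U (fun=> 0 : R) by exact: smooth_on_cst.
have sN p q : smooth_on U (fun x => - o x p q) by exact: smooth_onN (so _ _).
have sNN p q p' q' : smooth_on U (fun x => - o x p q - o x p' q') by exact: smooth_onB (sN _ _) (so _ _).
have sD p q p' q' : smooth_on U (fun x => o x p q + o x p' q') by exact: smooth_onD (so _ _) (so _ _).
case: i => [|[|[|[|[|[|i]]]]]]; case: j => [|[|[|[|[|[|j]]]]]].
all: first [exact: s0 | exact: so | exact: sN | exact: sNN | exact: sD].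
Qed.

Lemma smooth_christoffel w v u : smooth_table w ->
  smooth_on U (fun x => christoffel e x (w x) v u).
Proof.
move=> sw; apply: smooth_on_mulmx => //; last exact: smooth_frame.
apply: smooth_on_mulmx => //; first exact: smooth_on_cst.
apply: smooth_onD => //; last exact: smooth_on_derive.
apply: smooth_on_mulmx => //; apply/(smooth_on_mxP _ oU) => i j.
apply: (smooth_on_ext (f := fun x =>
  su3 (fun p q => \sum_(k < 6) (v *m e x) 0 k * w x k p q) i j)) => // [x _|].
  rewrite mxE; congr su3; apply/funext => p; apply/funext => q.
  by rewrite -sum6E; apply: eq_bigr => k _; rewrite inord_val.
apply: smooth_su3 => p q; apply: smooth_on_sum => // k _; apply: smooth_onM => //.
apply: ((smooth_on_mxP (fun x => v *m e x) oU).1).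
by apply: smooth_on_mulmx => //; exact: smooth_on_cst.
Qed.

End Smoothness.

(** * Pulling an adapted coframe back along a change of chart *)

Section ChangeOfChart.
Context {R : realType}.

Definition jacobian (f : vec R -> vec R) (x : vec R) : 'M[R]_6 :=
  \matrix_(i < 6) 'D_(delta_mx 0 i) f x.

Lemma jacobianE f x v : differentiable f x -> 'D_v f x = v *m jacobian f x.
Proof.
move=> df; rewrite (derive_coord v df) mulmx_sum_row; apply: eq_bigr => l _.
by rewrite rowK.
Qed.

Variables (U : set (vec R)) (f : vec R -> vec R) (x : vec R).
Hypotheses (oU : open U) (sf : smooth_on U f) (Ux : U x).

Let df y (Uy : U y) : differentiable f y := smooth_on_differentiable oU sf Uy.

Lemma smooth_jacobian : smooth_on U (jacobian f).
Proof.
apply/(smooth_on_mxP _ oU) => i j.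
apply: (smooth_on_ext (f := fun x => 'D_(delta_mx 0 i) f x 0 j)) => // [y _|].
  by rewrite mxE.
exact: ((smooth_on_mxP _ oU).1 (smooth_on_derive (delta_mx 0 i) sf)).
Qed.

(** Both sides are a second derivative of f, in the two possible orders. *)
Lemma derive_jacobian_sym u v :
  u *m 'D_v (jacobian f) x = v *m 'D_u (jacobian f) x.
Proof.
have dJ := smooth_on_differentiable oU smooth_jacobian Ux.
have E u' v' : u' *m 'D_v' (jacobian f) x = 'D_v' ('D_u' f) x.
  have := is_derive_mulmxl u' (derivableP (diff_derivable (v := v') dJ)) => -[_ <-].
  by apply: near_eq_derive; apply: (near_open oU Ux) => y Uy; rewrite jacobianE //; exact: df.
by rewrite !E (deriveC_mx _ _ oU sf).
Qed.

Variable e : vec R -> 'M[R]_6.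
Hypotheses (de : differentiable e (f x)) (eU : e (f x) \in unitmx).
Hypothesis fU : jacobian f x \in unitmx.

Definition pullback_coframe (y : vec R) : 'M[R]_6 := jacobian f y *m e (f y).

Let e' := pullback_coframe.

Lemma differentiable_pullback : differentiable e' x.
Proof.
apply: differentiable_mulmx; first exact: smooth_on_differentiable oU smooth_jacobian Ux.
exact: differentiable_comp (df Ux) de.
Qed.

Lemma derive_pullback v : 'D_v e' x =
  'D_v (jacobian f) x *m e (f x) + jacobian f x *m 'D_(v *m jacobian f x) e (f x).
Proof.
have dJ := smooth_on_differentiable oU smooth_jacobian Ux.
have dfe : differentiable (e \o f) x := differentiable_comp (df Ux) de.
have := is_derive_mulmx (derivableP (diff_derivable (v := v) dJ))
  (derivableP (diff_derivable (v := v) dfe)) => -[_ ->].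
by rewrite (derive_comp _ (df Ux) de) (jacobianE _ (df Ux)).
Qed.

Lemma frame_pullback : frame (e' x) = frame (e (f x)) *m invmx (jacobian f x).
Proof.
have e'U : e' x \in unitmx by rewrite unitmx_mul fU.
apply: (can_inj (mulmxK e'U)); rewrite mulVmx //.
by rewrite /e' /pullback_coframe mulmxA mulmxKV // mulVmx.
Qed.

(** The coframe derivatives change by second derivatives of the transition map, which are symmetric
    in the first two indices and cancel in the Koszul formula. *)
Lemma koszul_pullback k i j : (k < 6)%N -> (i < 6)%N -> (j < 6)%N ->
  koszul (coframe_deriv e' x) k i j = koszul (coframe_deriv e (f x)) k i j.
Proof.
have [D1 DE] : exists D : vec R -> 'M[R]_6, forall v, 'D_v (jacobian f) x = D v by eexists.
have S u v : u *m D1 v = v *m D1 u by rewrite -!DE derive_jacobian_sym.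
pose h p q r := (row q (frame (e' x)) *m D1 (row p (frame (e' x))) *m e (f x)) 0 r.
have hC p q r : h p q r = h q p r by rewrite /h S.
have bE p q r : (p < 6)%N -> (q < 6)%N -> (r < 6)%N -> coframe_deriv e' x p q r =
    h (inord p) (inord q) (inord r) + coframe_deriv e (f x) p q r.
  move=> p6 q6 r6; rewrite /coframe_deriv p6 q6 r6 /= derive_pullback DE mulmxDr mxE; congr (_ + _).
    by rewrite /h -!row_mul [RHS]mxE mulmxA.
  have -> : row (inord p) (frame (e' x)) *m jacobian f x = row (inord p) (frame (e (f x))).
    by rewrite -row_mul frame_pullback mulmxKV.
  by rewrite frame_pullback mulmxA mulmxKV.
move=> k6 i6 j6; rewrite /koszul !bE // (hC (inord i)) (hC (inord j) (inord k)).
rewrite (hC (inord j) (inord i)); ring.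
Qed.

(** The inhomogeneous term arises from differentiating the Jacobian factor of the pulled-back
    coframe. *)
Lemma christoffel_pullback w v u :
  christoffel e' x w v u *m jacobian f x =
  christoffel e (f x) w (v *m jacobian f x) (u *m jacobian f x) + u *m 'D_v (jacobian f) x.
Proof.
rewrite /christoffel derive_pullback frame_pullback.
have -> : su3_mx e' x w v = su3_mx e (f x) w (v *m jacobian f x).
  apply/matrixP => i j; rewrite !mxE; congr su3.
  by apply/funext => p; apply/funext => q; rewrite /e' /pullback_coframe mulmxA.
move: ('D_v (jacobian f) x) ('D_(v *m jacobian f x) e (f x)) (su3_mx _ _ _ _) => D1 D2 W.
rewrite /e' /pullback_coframe /frame.
move: (jacobian f x) (e (f x)) fU eU => A B AU BU.
rewrite mulmxA mulmxKV // -(mulmxA A B W) addrCA -mulmxDr [D1 *m B + _]addrC.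
rewrite [u *m (_ + D1 *m B)]mulmxDr [LHS]mulmxDl [u *m (D1 *m B)]mulmxA mulmxK // [u *m (A *m _)]mulmxA.
by [].
Qed.

End ChangeOfChart.

(** * Gluing the pointwise connections on the manifold *)

Section Manifold.
Context {R : realType} {M : manifold6 R} (S : su3_structure M).
Implicit Types (a b c : index M) (x y v u : vec R) (e : vec R -> 'M[R]_6).

Let tr a b := transition (atlas a) (atlas b).
Let ov a b := overlap (atlas a) (atlas b).

Lemma overlap_open a b : open (ov a b).
Proof.
rewrite openE => x [cx dx]; rewrite /interior; apply: filterI.
  by apply: (@open_nbhs_nbhs _ x (cod (atlas a))); split; [exact: cod_open|].
apply: (param_cont (mem_set cx)).
by apply: (@open_nbhs_nbhs _ (param (atlas a) x) (dom (atlas b))); split; [exact: dom_open|].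
Qed.

Lemma transition_cod a b x : ov a b x -> cod (atlas b) (tr a b x).
Proof. by case=> _ /coord_cod. Qed.

Let smooth_tr a b : smooth_on (ov a b) (tr a b) := atlas_smooth (m := M) a b.

Lemma dtransE a b x v : ov a b x -> dtrans a b x v = v *m jacobian (tr a b) x.
Proof.
move=> ox; apply: jacobianE.
exact: smooth_on_differentiable (@overlap_open a b) (smooth_tr a b) ox.
Qed.

(** A vector killed by the Jacobian would have length zero, since the metric is the pull-back of the
    metric in the other chart. *)
Lemma jacobian_unit a b x : ov a b x -> jacobian (tr a b) x \in unitmx.
Proof.
move=> ox; rewrite -row_free_unit; apply/row_freeP.
have inj v : v *m jacobian (tr a b) x = 0 -> v = 0.
  move=> v0; apply/eqP/negPn/negP => vn.
  have := met_pos S ox.1 vn.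
  by rewrite (met_tensorial S ox) dtransE // v0 /bilin !mul0mx mxE ltxx.
apply/row_freeP; rewrite -kermx_eq0; apply/eqP/row_matrixP => i.
rewrite row0; apply: inj; apply/sub_kermxP; exact: row_sub.
Qed.

Let adp c x e := adapted_at (met S c x) (acs S c x) (Psip S c x) (Psim S c x) (e x).

Lemma adapted_pullback a b x e : ov a b x -> adp b (tr a b x) e ->
  adp a x (pullback_coframe (tr a b) e).
Proof.
move=> ox [eU Gb Fb Pb Qb].
have monE k (m : 'M[R]_(k, 6)) (s : k.-tuple nat) :
    monomial (pullback_coframe (tr a b) e x) s m = monomial (e (tr a b x)) s (m *m jacobian (tr a b) x).
  by rewrite /monomial /pullback_coframe mulmxA.
have mxE' k (m : 'M[R]_(k, 6)) : \matrix_(i < k) dtrans a b x (row i m) = m *m jacobian (tr a b) x.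
  by apply/row_matrixP => i; rewrite rowK dtransE // row_mul.
split=> [|v u|m|m|m].
- by rewrite unitmx_mul jacobian_unit.
- by rewrite (met_tensorial S ox) !dtransE // Gb /pullback_coframe !mulmxA.
- rewrite !monE -Fb /fundamental (met_tensorial S ox) (acs_tensorial S ox) !dtransE //.
  by rewrite !row_mul.
- by have [_ _ tP] := Psip_form S; rewrite (tP _ _ _ ox) mxE' Pb !monE.
- by have [_ _ tQ] := Psim_form S; rewrite (tQ _ _ _ ox) mxE' Qb !monE.
Qed.

Lemma acs_differentiable c x : cod (atlas c) x -> differentiable (acs S c) x.
Proof. by apply: smooth_on_differentiable; [exact: cod_open | exact: acs_smooth]. Qed.

Lemma adapted_near c U e x : adapted S c U e -> U x ->
  [/\ cod (atlas c) x, differentiable e x & \forall y \near x, adp c y e].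
Proof.
move=> [oU Uc se ad] Ux; split; [exact: Uc|exact: smooth_on_differentiable oU se Ux|].
exact: near_open oU Ux ad.
Qed.

Lemma exists_adapted c x : cod (atlas c) x -> exists U e, adapted S c U e /\ U x.
Proof. by move=> /(su3_coframe S)[U [e [oU Ux Uc se ad]]]; exists U, e; split. Qed.

Definition su3_point c x (Gam : vec R -> vec R -> vec R -> vec R) : Prop :=
  su3_at (met S c) (acs S c) (Psip S c) (Psim S c) x Gam.

Lemma su3_point_unique c x Gam Gam' : cod (atlas c) x ->
  su3_point c x Gam -> su3_point c x Gam' -> Gam x = Gam' x.
Proof.
move=> cx; have [U [e [aU Ux]]] := exists_adapted cx.
have [_ de ad] := adapted_near aU Ux.
exact: (su3_at_unique de (acs_differentiable cx) ad).
Qed.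

Lemma su3_point_cst c x Gam : su3_point c x (fun _ => Gam x) -> su3_point c x Gam.
Proof. by []. Qed.

Lemma connection_su3_point nabla : su3_connection_skew_torsion S nabla ->
  forall c x, cod (atlas c) x -> su3_point c x (nabla c).
Proof.
move=> [[linr linl _ _] H] c x cx; have [pG pJ pP pQ fT] := H c x cx.
by split; [exact: linr | exact: linl | split].
Qed.

Lemma su3_connection_unique nabla nabla' :
  su3_connection_skew_torsion S nabla -> su3_connection_skew_torsion S nabla' ->
  connection_eq nabla nabla'.
Proof.
move=> /connection_su3_point H /connection_su3_point H' c x cx v u.
by rewrite (su3_point_unique cx (H c x cx) (H' c x cx)).
Qed.

Lemma su3_point_conditions :
  (forall c x, cod (atlas c) x -> exists Gam, su3_point c x Gam) ->
  [/\ skew_nijenhuis S, structure_eq S (Psip S) & structure_eq S (Psim S)].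
Proof.
move=> ex.
have rel c U e x : adapted S c U e -> U x -> exists w t, su3_relation (coframe_deriv e x) w t.
  move=> aU Ux; have [cx de ad] := adapted_near aU Ux.
  have [Gam H] := ex c x cx.
  have [w [t [r _ _]]] := su3_at_relation de (acs_differentiable cx) ad H.
  by exists w, t.
split=> [c x cx|c U e aU x Ux|c U e aU x Ux].
- have [U [e [aU Ux]]] := exists_adapted cx; have [w [t r]] := rel _ _ _ _ aU Ux.
  have [_ de ad] := adapted_near aU Ux.
  exact: (nij_is_form_of_su3 de (acs_differentiable cx) ad r).
- have [w [t r]] := rel _ _ _ _ aU Ux; have [cx de ad] := adapted_near aU Ux.
  exact: (structure_of_su3 de (acs_differentiable cx) ad r).1.
- have [w [t r]] := rel _ _ _ _ aU Ux; have [cx de ad] := adapted_near aU Ux.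
  exact: (structure_of_su3 de (acs_differentiable cx) ad r).2.
Qed.

Section Existence.
Hypotheses (sN : skew_nijenhuis S) (sP : structure_eq S (Psip S)) (sQ : structure_eq S (Psim S)).

Let canw (b : nat -> nat -> nat -> R) := su3_part (koszul b).

Lemma canonical_relation c U e x : adapted S c U e -> U x ->
  su3_relation (coframe_deriv e x) (canw (coframe_deriv e x)) (half_torsion (koszul (coframe_deriv e x))).
Proof.
move=> aU Ux; have [cx de ad] := adapted_near aU Ux.
apply: (su3_of_structure_at de (acs_differentiable cx) ad); first exact: sN.
  exact: (sP aU Ux).
exact: (sQ aU Ux).
Qed.

Lemma canonical_su3_point c U e x : adapted S c U e -> U x ->
  su3_point c x (fun _ => christoffel e x (canw (coframe_deriv e x))).
Proof.
move=> aU Ux; have [cx de ad] := adapted_near aU Ux.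
exact: (christoffel_su3 de (acs_differentiable cx) ad (canonical_relation aU Ux)).
Qed.

(** A choice at each point. By uniqueness it coincides with [christoffel] for any adapted coframe
    around the point, whence its smoothness; the default zero is never met inside a chart. *)
Definition su3_nabla : connection_data M := fun c x =>
  xget (fun _ _ => 0) [set g | su3_point c x (fun _ => g)].

Lemma su3_nablaP c x : cod (atlas c) x -> su3_point c x (su3_nabla c).
Proof.
move=> cx; have [U [e [aU Ux]]] := exists_adapted cx.
have H : [set g | su3_point c x (fun _ => g)] (su3_nabla c x).
  by apply: xgetPex; eexists; exact: (canonical_su3_point aU Ux).
exact: su3_point_cst.
Qed.

Lemma su3_nablaE c U e x : adapted S c U e -> U x ->
  su3_nabla c x = christoffel e x (canw (coframe_deriv e x)).
Proof.
move=> aU Ux; have [cx _ _] := adapted_near aU Ux.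
exact: (su3_point_unique cx (su3_nablaP cx) (canonical_su3_point aU Ux)).
Qed.

(** An adapted coframe of the second chart pulls back to one of the first. The connections built
    from the two obey the transformation law, and by uniqueness they are the chosen ones. *)
Lemma su3_nabla_transform a b x v u : ov a b x ->
  dtrans a b x (su3_nabla a x v u) = 'D_v (fun y => dtrans a b y u) x
    + su3_nabla b (tr a b x) (dtrans a b x v) (dtrans a b x u).
Proof.
move=> ox; have bx := transition_cod ox.
have [U [e [aU Ux]]] := exists_adapted bx; have [_ de ad] := adapted_near aU Ux.
have oo := @overlap_open a b; have so := smooth_tr a b.
have eU : e (tr a b x) \in unitmx := adapted_unit (nbhs_singleton ad).
have fU := jacobian_unit ox.
pose e' := pullback_coframe (tr a b) e.
have de' : differentiable e' x := differentiable_pullback oo so ox de.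
have ctr : {for x, continuous (tr a b)} := smooth_on_continuous so ox.
have ad' : \forall y \near x, adp a y e'.
  have no : \forall y \near x, ov a b y := near_open oo ox (fun y oy => oy).
  have adf : \forall y \near x, adp b (tr a b y) e := ctr _ ad.
  by apply: filterS2 adf no => y ady oy; exact: adapted_pullback.
(* The same matrices w serve in both charts because the Levi-Civita coefficients in corresponding
   frames agree. *)
pose w := canw (coframe_deriv e (tr a b x)).
have rel : su3_relation (coframe_deriv e' x) w (half_torsion (koszul (coframe_deriv e (tr a b x)))).
  move=> k i j k6 i6 j6; rewrite (koszul_pullback oo so ox de eU fU k6 i6 j6).
  exact: (canonical_relation aU Ux).
have H' := christoffel_su3 de' (acs_differentiable ox.1) ad' rel.
have -> : su3_nabla a x = christoffel e' x w.
  exact: (su3_point_unique ox.1 (su3_nablaP ox.1) H').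
rewrite (su3_nablaE aU Ux) !dtransE // (christoffel_pullback oo so ox de eU fU) addrC.
congr (_ + _).
have dJ := smooth_on_differentiable oo (smooth_jacobian oo so) ox.
have [_ <-] := is_derive_mulmxl u (derivableP (diff_derivable (v := v) dJ)).
by apply: near_eq_derive; apply: (near_open oo ox) => y oy; rewrite dtransE.
Qed.

Lemma su3_nabla_connection : su3_connection_skew_torsion S su3_nabla.
Proof.
split=> [|c x cx]; last first.
  have [_ _ [pG pJ pP pQ fT]] := su3_nablaP cx; by split.
split=> [c x cx|c x cx|c v u|a b x ox v u].
- by have [] := su3_nablaP cx.
- by have [] := su3_nablaP cx.
- apply: smooth_on_local => x cx; have [U [e [aU Ux]]] := exists_adapted cx.
  have [oU Uc se ad] := aU.
  exists U, (fun y => christoffel e y (canw (coframe_deriv e y)) v u); split=> //.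
    have eU y : U y -> e y \in unitmx by move=> /ad/adapted_unit.
    apply: (smooth_christoffel (w := fun y => canw (coframe_deriv e y)) oU se eU).
    apply: (smooth_su3_part oU); apply: (smooth_koszul oU) => k i j.
    exact: smooth_coframe_deriv.
  by move=> y Uy; rewrite (su3_nablaE aU Uy).
- exact: su3_nabla_transform.
Qed.

End Existence.

End Manifold.

(** * The Levi-Civita connection in an adapted frame *)

Section LeviCivita.
Context {R : realType}.
Variables (G J e : vec R -> 'M[R]_6) (P Q : vec R -> form R 3) (x : vec R).
Hypothesis de : differentiable e x.
Hypothesis ad : \forall y \near x, adapted_at (G y) (J y) (P y) (Q y) (e y).

Let b := coframe_deriv e x.
Let adx := nbhs_singleton ad.
Let eU : e x \in unitmx := adapted_unit adx.

Definition table_mx (l : nat -> nat -> nat -> R) (v : vec R) : 'M[R]_6 :=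
  \matrix_(i, j) \sum_(k < 6) (v *m e x) 0 k * l k i j.

Definition frame_connection l (v u : vec R) : vec R :=
  u *m (e x *m table_mx l v + 'D_v e x) *m frame (e x).

Lemma mul_derive_coframe (v u : vec R) (j : 'I_6) : (u *m 'D_v e x) 0 j =
  \sum_(i < 6) \sum_(k < 6) (u *m e x) 0 i * (v *m e x) 0 k * b k i j.
Proof.
have linD := derive_is_linear de.
have [D DE] : exists D : vec R -> 'M[R]_6, forall v, 'D_v e x = D v by eexists.
have Ev : D v = \sum_(k < 6) (v *m e x) 0 k *: D (row k (frame (e x))).
  by apply: (linear_frame ad) => c w w'; rewrite -!DE linD.
have bE (i k : 'I_6) : b k i j = (row i (frame (e x)) *m D (row k (frame (e x)))) 0 j.
  by rewrite /b /coframe_deriv !ltn_ord /= !inord_val -row_mul DE [RHS]mxE.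
rewrite DE Ev {1}(row_sum_basis (E := frame (e x)) u) ?unitmx_inv // /frame invmxK.
rewrite mulmx_suml summxE; apply: eq_bigr => i _.
rewrite mulmx_sumr summxE; apply: eq_bigr => k _.
by rewrite bE -scalemxAl -scalemxAr scalerA mxE.
Qed.

Lemma mul_table l (v u : vec R) (j : 'I_6) : (u *m e x *m table_mx l v) 0 j =
  \sum_(i < 6) \sum_(k < 6) (u *m e x) 0 i * (v *m e x) 0 k * l k i j.
Proof.
rewrite mxE; apply: eq_bigr => i _; rewrite [table_mx _ _ _ _]mxE mulr_sumr.
by apply: eq_bigr => k _; rewrite mulrA.
Qed.

Variable nabla : vec R -> vec R -> vec R.
Hypothesis nablaE : forall v u,
  nabla v u = u *m (e x *m table_mx (koszul b) v + 'D_v e x) *m frame (e x).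

Lemma frame_connection_sym v u : nabla v u = nabla u v.
Proof.
have nE v' u' j : (nabla v' u' *m e x) 0 j =
    \sum_(i < 6) \sum_(k < 6) (u' *m e x) 0 i * (v' *m e x) 0 k * (koszul b k i j + b k i j).
  rewrite nablaE mulmxKV // mulmxDr mulmxA mxE mul_table mul_derive_coframe -big_split.
  apply: eq_bigr => i _; rewrite -big_split; apply: eq_bigr => k _.
  by rewrite /= mulrDr.
suff E : nabla v u *m e x = nabla u v *m e x by rewrite -[nabla v u](mulmxK eU) E mulmxK.
apply/rowP => j; rewrite (nE v u) (nE u v) [LHS]exchange_big.
apply: eq_bigr => i _; apply: eq_bigr => k _.
have -> : koszul b i k j + b i k j = koszul b k i j + b k i j by rewrite /koszul; lra.
by rewrite [_ 0 k * _]mulrC.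
Qed.

(** The connection with frame coefficients [koszul b] is metric and symmetric; inserting both facts
    in the coordinate Koszul formula leaves it unchanged. *)
Lemma levi_civita_frame v u : levi_civita G x v u = nabla v u.
Proof.
have pG : parallel_metric (fun=> nabla) G x.
  apply/(parallel_metricE de ad (Om := table_mx (koszul b)) (Gam := fun=> nabla)) => // v'.
  apply/matrixP => i j; rewrite [LHS]mxE [X in _ + X]mxE [RHS]mxE.
  have tE i' j' : table_mx (koszul b) v' i' j' = \sum_(k < 6) (v' *m e x) 0 k * koszul b k i' j' by rewrite mxE.
  rewrite !tE -big_split big1 //= => k _.
  by rewrite -mulrDr [koszul b k j i]koszul_skew addrN mulr0.
rewrite /levi_civita.
have GU : G x \in unitmx by rewrite (adapted_metric adx) unitmx_mul unitmx_tr eU.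
suff -> : (\row_(j < 6) (2^-1 *
     ('D_v (fun y => bilin (G y) u (delta_mx 0 j)) x
      + 'D_u (fun y => bilin (G y) v (delta_mx 0 j)) x
      - 'D_(delta_mx 0 j) (fun y => bilin (G y) v u) x))) = nabla v u *m G x by rewrite mulmxK.
apply/rowP => j.
rewrite mxE !pG (frame_connection_sym u v) (frame_connection_sym (delta_mx 0 j) v).
rewrite (frame_connection_sym (delta_mx 0 j) u) (bilinC adx u).
have -> : (nabla v u *m G x) 0 j = bilin (G x) (nabla v u) (delta_mx 0 j).
  by rewrite /bilin trmx_delta -colE [RHS]mxE.
set p := bilin (G x) (nabla v u) _; set q := bilin _ (nabla v _) _; set r := bilin _ v _.
by clearbody p q r; field.
Qed.

End LeviCivita.

(** * Curvature and scalar curvature from the connection matrix *)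

Section Curvature.
Context {R : realType}.
Variables (U : set (vec R)) (e : vec R -> 'M[R]_6) (x : vec R).
Hypotheses (oU : open U) (se : smooth_on U e) (eU : forall y, U y -> e y \in unitmx) (Ux : U x).
Variables (Gam : vec R -> vec R -> vec R -> vec R) (Lam : vec R -> vec R -> 'M[R]_6).
Hypothesis dLam : forall v, differentiable (Lam^~ v) x.
Hypothesis GamE : \forall y \near x, forall v u,
  Gam y v u = u *m (e y *m Lam y v + 'D_v e y) *m frame (e y).
Hypothesis Gam0 : forall u, Gam x 0 u = 0.

Let eUx := eU Ux.
Let de := smooth_on_differentiable oU se Ux.

Lemma cov_cov u v w :
  cov Gam (cst u) (cov Gam (cst v) (cst w)) x *m e x =
  w *m ('D_u e x *m Lam x v + e x *m 'D_u (Lam^~ v) x + 'D_u ('D_v e) x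
        + (e x *m Lam x v + 'D_v e x) *m Lam x u).
Proof.
have near_cov : \forall y \near x, cov Gam (cst v) (cst w) y =
    w *m (e y *m Lam y v + 'D_v e y) *m frame (e y).
  by apply: filterS GamE => y GE; rewrite -GE /cov /= (derive_cst w) add0r.
rewrite {1}/cov (near_eq_derive _ near_cov) (nbhs_singleton near_cov).
have De : is_derive x u e ('D_u e x) by exact/derivableP/diff_derivable.
have DL : is_derive x u (Lam^~ v) ('D_u (Lam^~ v) x) by exact/derivableP/diff_derivable.
have DD : is_derive x u ('D_v e) ('D_u ('D_v e) x).
  by apply/derivableP; exact: smooth_on_derivable (smooth_on_derive v se) Ux.
have Df : is_derive x u (fun y => frame (e y)) (- (invmx (e x) *m 'D_u e x *m invmx (e x))).
  apply: is_derive_invmx => //; first exact: near_open oU Ux eU.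
  exact: smooth_on_derivable (smooth_frame oU se eU) Ux.
have DA : is_derive x u (fun y => e y *m Lam y v + 'D_v e y)
    ('D_u e x *m Lam x v + e x *m 'D_u (Lam^~ v) x + 'D_u ('D_v e) x).
  exact: is_deriveD (is_derive_mulmx De DL) DD.
have [_ ->] := is_derive_mulmx (is_derive_mulmxl w DA) Df.
rewrite (nbhs_singleton GamE) /cst /frame.
have alg (A A' B L E : 'M[R]_6) : E \in unitmx ->
    (w *m A' *m invmx E + w *m A *m - (invmx E *m B *m invmx E)
      + w *m A *m invmx E *m (E *m L + B) *m invmx E) *m E = w *m (A' + A *m L).
  move=> EU; rewrite !mulmxDl mulmxKV // [in X in _ + X]mulmxKV // mulmxN !mulmxA mulNmx mulmxKV //.
  rewrite mulmxDr !mulmxA mulmxKV // mulmxDr -addrA; congr (_ + _).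
  by rewrite addrC addrK mulmxA.
exact: alg.
Qed.

(** The second structure equation; the products appear in reversed order because matrices act on row
    vectors from the right, and the second derivatives of e cancel by symmetry. *)
Lemma curvatureE u v w :
  curvature Gam x u v w *m e x = w *m e x *m ('D_u (Lam^~ v) x - 'D_v (Lam^~ u) x
    + Lam x v *m Lam x u - Lam x u *m Lam x v).
Proof.
have c0 : cov Gam (lie_bracket (cst u) (cst v)) (cst w) x = 0.
  have l0 : lie_bracket (cst u) (cst v) x = 0.
    by rewrite /lie_bracket (derive_cst u) (derive_cst v) subrr.
  by rewrite /cov l0 Gam0 addr0 (derive_cst w).
have alg (eu ev lu lv euv Lu Lv E : 'M[R]_6) :
    eu *m Lv + E *m lu + euv + (E *m Lv + ev) *m Lu - (ev *m Lu + E *m lv + euv + (E *m Lu + eu) *m Lv)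
    = E *m (lu - lv + Lv *m Lu - Lu *m Lv).
  rewrite !(mulmxDl, mulmxDr, mulmxN) !mulmxA.
  move: (E *m Lv *m Lu) (E *m Lu *m Lv) (eu *m Lv) (ev *m Lu) (E *m lu) (E *m lv) => a b c d p q.
  by apply/matrixP => i j; rewrite !mxE; ring.
rewrite /curvature c0 subr0 mulmxBl !cov_cov (deriveC_mx _ _ oU se Ux) -mulmxBr -mulmxA.
by congr (_ *m _); exact: alg.
Qed.

End Curvature.

Section ScalarCurvature.
Context {R : realType}.
Variables (U : set (vec R)) (e : vec R -> 'M[R]_6) (x : vec R).
Hypotheses (oU : open U) (se : smooth_on U e) (Ux : U x).
Variables (G J : vec R -> 'M[R]_6) (P Q : vec R -> form R 3).
Hypothesis ad : forall y, U y -> adapted_at (G y) (J y) (P y) (Q y) (e y).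

Let eU y (Uy : U y) : e y \in unitmx := adapted_unit (ad Uy).
Let nad y (Uy : U y) : \forall z \near y, adapted_at (G z) (J z) (P z) (Q z) (e z) :=
  near_open oU Uy ad.
Let dey y (Uy : U y) : differentiable e y := smooth_on_differentiable oU se Uy.
Let de : differentiable e x := dey Ux.
Let b := coframe_deriv e x.
Let E (k : 'I_6) := row k (frame (e x)).
Let l y := koszul (coframe_deriv e y).

Lemma smooth_lc k i j : smooth_on U (fun y => l y k i j).
Proof.
apply: (smooth_koszul oU (b := fun y => coframe_deriv e y)) => k' i' j'.
exact: (smooth_coframe_deriv oU se eU).
Qed.

Definition frame_derive (t : vec R -> nat -> nat -> nat -> R) (a k i j : nat) : R :=
  'D_(row (inord a) (frame (e x))) (fun y => t y k i j) x.

Lemma is_derive_table (u v : vec R) (i j : 'I_6) :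
  is_derive x u (fun y => table_mx e y (l y) v i j)
    (\sum_(k < 6) ((v *m 'D_u e x) 0 k * l x k i j + (v *m e x) 0 k * 'D_u (fun y => l y k i j) x)).
Proof.
have tE y : table_mx e y (l y) v i j = \sum_(k < 6) (v *m e y) 0 k * l y k i j by rewrite mxE.
under eq_fun do rewrite tE; apply: is_derive_bigsum => k.
have De : is_derive x u e ('D_u e x) by exact/derivableP/diff_derivable.
have D1 := is_derive_entry 0 k (is_derive_mulmxl v De).
have D2 : is_derive x u (fun y => l y k i j) ('D_u (fun y => l y k i j) x).
  by apply/derivableP; exact: smooth_on_derivable (@smooth_lc k i j) Ux.
apply: (is_derive_eq (is_deriveM D1 D2)).
by rewrite addrC [X in X + _ = _]mulrC.
Qed.

Lemma differentiable_table v : differentiable (fun y => table_mx e y (l y) v) x.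
Proof.
apply/differentiable_mxP => i j.
have tE y : table_mx e y (l y) v i j = \sum_(k < 6) (v *m e y) 0 k * l y k i j by rewrite mxE.
under eq_fun do rewrite tE.
apply: (smooth_on_differentiableR oU _ Ux); apply: smooth_on_sum => // k _.
apply: smooth_onM => //; last exact: smooth_lc.
apply: ((smooth_on_mxP (fun x => v *m e x) oU).1).
by apply: smooth_on_mulmx => //; exact: smooth_on_cst.
Qed.

(** The vector E_c(x) is kept fixed in the chart, so its components in the moving frame vary; this
    produces the term with b. *)
Lemma derive_table_frame (a c i j : 'I_6) :
  'D_(E a) (fun y => table_mx e y (l y) (E c)) x i j =
  frame_derive l a c i j + \sum_(k < 6) b a c k * l x k i j.
Proof.
have D := derivableP (diff_derivable (v := E a) (differentiable_table (E c))).
have [_ <-] := is_derive_entry i j D; have [_ ->] := is_derive_table (E a) (E c) i j.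
rewrite big_split /= addrC; congr (_ + _).
  rewrite (bigD1 c) //= big1 => [|k kc].
    by rewrite (row_frame (nad Ux)) mxE !eqxx mul1r addr0 /frame_derive inord_val.
  by rewrite (row_frame (nad Ux)) mxE (negPf kc) andbF mul0r.
apply: eq_bigr => k _; congr (_ * _).
by rewrite /b /coframe_deriv !ltn_ord /= !inord_val -row_mul mxE.
Qed.

Lemma table_frame (a i j : 'I_6) : table_mx e x (l x) (E a) i j = l x a i j.
Proof.
rewrite mxE (bigD1 a) //= big1 => [|k ka].
  by rewrite (row_frame (nad Ux)) mxE !eqxx mul1r addr0.
by rewrite (row_frame (nad Ux)) mxE (negPf ka) andbF mul0r.
Qed.

Lemma scalar_curvature_frame :
  scalar_curvature G (e x) x = scalc (l x) (frame_derive l).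
Proof.
have GamU y : U y -> forall v u, levi_civita G y v u =
    u *m (e y *m table_mx e y (l y) v + 'D_v e y) *m frame (e y).
  move=> Uy v u; apply: (levi_civita_frame (dey Uy) (nad Uy) (nabla := frame_connection e y (l y))).
  by [].
have GamE := near_open oU Ux GamU.
have Gam0 u : levi_civita G x 0 u = 0.
  rewrite (nbhs_singleton GamE) derive0 addr0.
  have -> : table_mx e x (l x) 0 = 0.
    by apply/matrixP => i j; rewrite !mxE big1 // => k _; rewrite mul0mx mxE mul0r.
  by rewrite mulmx0 mulmx0 mul0mx.
rewrite /scalar_curvature /scalc -sum6E; apply: eq_bigr => a _.
rewrite -sum6E; apply: eq_bigr => c _; rewrite (bilin_basis (ad Ux)).
have C := curvatureE oU se eU Ux differentiable_table GamE Gam0.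
rewrite {}C (row_frame (nad Ux)) -rowE -/(E a) -/(E c).
have ent (A B C D : 'M[R]_6) : row c (A - B + C - D) 0 a = A c a - B c a + C c a - D c a.
  by rewrite !mxE.
rewrite ent !derive_table_frame.
have mE (A B : 'M[R]_6) i j : (A *m B) i j = \sum_k A i k * B k j by rewrite mxE.
rewrite !mE.
have -> : \sum_(k < 6) table_mx e x (l x) (E c) c k * table_mx e x (l x) (E a) k a
    = \sum_(k < 6) l x c c k * l x a k a by apply: eq_bigr => k _; rewrite !table_frame.
have -> : \sum_(k < 6) table_mx e x (l x) (E a) c k * table_mx e x (l x) (E c) k a
    = \sum_(k < 6) l x a c k * l x c k a by apply: eq_bigr => k _; rewrite !table_frame.
(* The two sums with b, due to the moving frame components, make up the bracket term, as
   [acoef (koszul b)] equals b_ack - b_cak. *)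
have -> : sum6 (fun k => acoef (l x) a c k * l x k c a + l x c c k * l x a k a - l x a c k * l x c k a)
  = \sum_(k < 6) b a c k * l x k c a - \sum_(k < 6) b c a k * l x k c a
    + \sum_(k < 6) l x c c k * l x a k a - \sum_(k < 6) l x a c k * l x c k a.
  rewrite -sum6E -sumrB -big_split -sumrB /=; apply: eq_bigr => k _.
  congr (_ + _ - _); rewrite -mulrBl; congr (_ * _).
  by rewrite /acoef /l /koszul -/b; lra.
by rewrite opprD [_ + (- _ - _)]addrACA !addrA.
Qed.

End ScalarCurvature.

(** * The first Bianchi identity of the frame *)

Section FirstBianchi.
Variable R : realFieldType.

(** This is d(de_j) = 0: h stands for the second derivatives of the coframe, whose symmetry makes
    them cancel in the cyclic sum, as do the quadratic terms. *)
Lemma jacobi_koszul (b : nat -> nat -> nat -> R) (db h : nat -> nat -> nat -> nat -> R)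
    (dl : nat -> nat -> nat -> nat -> R) i j k m :
  (forall i j k m, (i < 6)%N -> (j < 6)%N -> (k < 6)%N -> (m < 6)%N ->
     acoef (dl i) j k m = db i j k m - db i k j m) ->
  (forall i j k m, (i < 6)%N -> (j < 6)%N -> (k < 6)%N -> (m < 6)%N ->
     db i j k m = h i j k m - sum6 (fun n => b i k n * b j n m) - sum6 (fun n => b i j n * b n k m)) ->
  (forall i j k m, h i j k m = h j i k m) ->
  (i < 6)%N -> (j < 6)%N -> (k < 6)%N -> (m < 6)%N ->
  jacobi (koszul b) dl i j k m = 0.
Proof.
move=> dlE dbE hC i6 j6 k6 m6; rewrite /jacobi !dlE // !dbE //.
have aE p q r : acoef (koszul b) p q r = b p q r - b q p r by rewrite /acoef /koszul; lra.
rewrite /sum6 !aE (hC j i) (hC k i) (hC k j).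
by clear; ring.
Qed.

End FirstBianchi.

Section SecondDerivative.
Context {R : realType}.
Variables (U : set (vec R)) (e : vec R -> 'M[R]_6) (x : vec R).
Hypotheses (oU : open U) (se : smooth_on U e) (eU : forall y, U y -> e y \in unitmx) (Ux : U x).

Let de := smooth_on_differentiable oU se Ux.
Let b := coframe_deriv e x.
Let E (k : 'I_6) := row k (frame (e x)).

Lemma linear_coord (D : vec R -> 'M[R]_6) (F : 'M[R]_6) (v : vec R) i j : linear D ->
  \sum_(l < 6) v 0 l * (F *m D (delta_mx 0 l)) i j = (F *m D v) i j.
Proof.
move=> linD; pose lD := GRing.isLinear.Build _ _ _ _ D linD.
pose D' : {linear vec R -> 'M[R]_6} := HB.pack D lD.
rewrite [in RHS](row_sum_delta v) -[D]/(D' : _ -> _) linear_sum mulmx_sumr summxE.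
by apply: eq_bigr => l _; rewrite linearZ /= -scalemxAr [RHS]mxE.
Qed.

Lemma product_rule_algebra (F : 'M[R]_6) (D1 D2 : vec R -> 'M[R]_6) (i j k m : 'I_6) :
  linear D1 -> linear D2 -> let A := - (F *m D1 (row i F) *m F) in
  \sum_(l < 6) (F j l * (A *m D1 (delta_mx 0 l) + F *m D2 (delta_mx 0 l)) k m
     + (F *m D1 (delta_mx 0 l)) k m * A j l) =
  (F *m D2 (row j F)) k m - \sum_(n < 6) (F *m D1 (row i F)) k n * (F *m D1 (row j F)) n m
  - \sum_(n < 6) (F *m D1 (row i F)) j n * (F *m D1 (row n F)) k m.
Proof.
move=> lin1 lin2 A; set B := F *m D1 (row i F).
have rE (C : 'M[R]_6) l : C j l = row j C 0 l by rewrite mxE.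
transitivity ((A *m D1 (row j F)) k m + (F *m D2 (row j F)) k m + (F *m D1 (row j A)) k m).
  rewrite -!linear_coord // -!big_split /=; apply: eq_bigr => l _.
  by rewrite -!rE [X in _ * X + _]mxE mulrDr [_ * A j l]mulrC.
have -> : (A *m D1 (row j F)) k m = - \sum_(n < 6) B k n * (F *m D1 (row j F)) n m.
  by rewrite /A mulNmx -/B -mulmxA mxE mxE.
have -> : (F *m D1 (row j A)) k m = - \sum_(n < 6) B j n * (F *m D1 (row n F)) k m.
  have -> : row j A = - \sum_(n < 6) B j n *: row n F.
    rewrite /A -/B linearN /= row_mul mulmx_sum_row; congr (- _); apply: eq_bigr => n _.
    by rewrite mxE.
  pose lD := GRing.isLinear.Build _ _ _ _ D1 lin1.
  pose D' : {linear vec R -> 'M[R]_6} := HB.pack D1 lD.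
  rewrite -[D1]/(D' : _ -> _) linearN linear_sum mulmxN mulmx_sumr [LHS]mxE summxE.
  by congr (- _); apply: eq_bigr => n _; rewrite linearZ /= -scalemxAr [LHS]mxE.
by rewrite [- _ + _]addrC.
Qed.

(** The frame e^-1 occurs twice in b, as the direction E_j and as the left factor; differentiating
    each occurrence gives one quadratic term. *)
Lemma derive_coframe_deriv (i j k m : 'I_6) :
  'D_(E i) (fun y => coframe_deriv e y j k m) x =
  (frame (e x) *m 'D_(E i) ('D_(E j) e) x) k m
  - \sum_(n < 6) b i k n * b j n m - \sum_(n < 6) b i j n * b n k m.
Proof.
have cE y : U y -> \sum_(l < 6) frame (e y) j l * (frame (e y) *m 'D_(delta_mx 0 l) e y) k m
    = coframe_deriv e y j k m.
  move=> Uy; rewrite /coframe_deriv !ltn_ord /= !inord_val.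
  have linD := derive_is_linear (smooth_on_differentiable oU se Uy).
  rewrite -(linear_coord _ _ _ _ linD); apply: eq_bigr => l _; congr (_ * _).
  by rewrite mxE.
rewrite -(near_eq_derive _ (near_open oU Ux cE)).
set u := E i.
have Df : is_derive x u (fun y => frame (e y)) (- (invmx (e x) *m 'D_u e x *m invmx (e x))).
  apply: is_derive_invmx; first exact: near_open oU Ux eU.
    exact: smooth_on_derivable (smooth_frame oU se eU) Ux.
  exact/derivableP/diff_derivable.
have DD l : is_derive x u ('D_(delta_mx 0 l) e) ('D_u ('D_(delta_mx 0 l) e) x).
  by apply/derivableP; exact: smooth_on_derivable (smooth_on_derive (delta_mx 0 l) se) Ux.
have [_ ->] := is_derive_bigsum (index_enum 'I_6) (fun l : 'I_6 =>
  is_deriveM (is_derive_entry j l Df) (is_derive_entry k m (is_derive_mulmx Df (DD l)))).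
have lin1 : linear (fun v => 'D_v e x) := derive_is_linear de.
have lin2 : linear (fun v => 'D_u ('D_v e) x).
  have -> : (fun v => 'D_u ('D_v e) x) = (fun v => 'D_v ('D_u e) x).
    by apply/funext => v; exact: deriveC_mx oU se Ux.
  apply: derive_is_linear; exact: smooth_on_differentiable oU (smooth_on_derive u se) Ux.
have bE (p q r : 'I_6) : b p q r = (frame (e x) *m 'D_(E p) e x) q r.
  by rewrite /b /coframe_deriv !ltn_ord /= !inord_val.
under [X in _ = _ - X - _]eq_bigr do rewrite !bE.
under [X in _ = _ - X]eq_bigr do rewrite !bE.
exact: (product_rule_algebra (frame (e x)) i j k m lin1 lin2).
Qed.

End SecondDerivative.

(** * The codifferential of a 1-form with varying components *)

Section CodifferentialOneForm.
Context {R : realType}.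
Variables (U : set (vec R)) (e : vec R -> 'M[R]_6) (x : vec R).
Hypotheses (oU : open U) (se : smooth_on U e) (eU : forall y, U y -> e y \in unitmx) (Ux : U x).
Variables (alpha : vec R -> form R 1) (th : vec R -> nat -> R).
Hypothesis fa : forall y, U y -> is_form (alpha y).
Hypothesis aE : forall y, U y -> forall i, (i < 6)%N -> alpha y (row (inord i) (frame (e y))) = th y i.
Hypothesis sth : forall i, smooth_on U (fun y => th y i).

Let de := smooth_on_differentiable oU se Ux.

Lemma hodge1_basis y q : U y -> size q = 5%N -> all (ltn^~ 6) q ->
  hodge (p := 1) (q := 5) erefl (e y) (alpha y) (basis 5 (frame (e y)) q)
  = hod (fun s => th y (nth 0%N s 0)) q.
Proof.
move=> Uy sq q6; rewrite (hodge_basis _ (eU Uy) (fa Uy) sq q6) /hod; congr (_ * _).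
have -> : basis 1 (frame (e y)) (compl six q) = row (inord (nth 0%N (compl six q) 0)) (frame (e y)).
  by apply/row_matrixP => l; rewrite row_basis !ord1 row_id.
apply: aE => //; have : all (ltn^~ 6) (compl six q).
  rewrite /six /=; do 6 (case: notin => /=; rewrite ?andbT //=).
by case: (compl six q) => //= a s /andP[].
Qed.

Lemma codiff_one_form :
  codiff (p := 0) (q := 5) erefl erefl e alpha x 0 =
  codiff1 (coframe_deriv e x) (th x)
    (fun a i => 'D_(row (inord a) (frame (e x))) (fun y => th y i) x).
Proof.
pose beta y : form R 5 := hodge (p := 1) (q := 5) erefl (e y) (alpha y).
have nU : \forall y \near x, U y := near_open oU Ux (fun y Uy => Uy).
have nE : \forall y \near x, e y \in unitmx by apply: filterS nU => y /eU.
have fb : \forall y \near x, is_form (beta y) by apply: filterS nU => y _; exact: hodge_is_form.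
have dt (f : {ffun 'I_5 -> 'I_6}) : differentiable (fun y => beta y (rowsub f (frame (e y))) : R) x.
  apply: (near_eq_differentiable (f := fun y => hod (fun s => th y (nth 0%N s 0)) (codes f))).
    apply: filterS nU => y Uy.
    by rewrite -basis_codes /beta hodge1_basis // ?size_codes ?codes_lt6.
  apply: (smooth_on_differentiableR oU _ Ux); apply: (smooth_onM oU (sth _)).
  exact: smooth_on_cst.
have fdb : is_form (ext_deriv beta x) := ext_deriv_is_form nE de fb dt.
rewrite /codiff -/beta (_ : 0 = basis 0 (frame (e x)) [::]); last by apply/matrixP => -[].
rewrite (hodge_basis _ (eU Ux) fdb) // /hod /= (_ : eps R _ _ = 1) ?mulr1 //.
rewrite (ext_deriv_basis nE de fb dt) // /codiff1; congr (- (_ + _)).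
  rewrite sumtoE; apply: eq_bigr => i _; congr (sg _ _).
  have s5 : size (without i six) = 5%N by rewrite (@size_without 5).
  have l6 : all (ltn^~ 6) (without i six) by apply: all_without.
  rewrite -(near_eq_derive (f := fun y => hod (fun s => th y (nth 0%N s 0)) (without i six))); last first.
    by apply: filterS nU => y Uy; apply/esym/hodge1_basis.
  rewrite /hod; set c := eps _ _ _; set n := nth _ _ _.
  have Dth v : is_derive x v (fun y => th y n) ('D_v (fun y => th y n) x).
    by apply/derivableP; exact: smooth_on_derivable (sth n) Ux.
  have [_ ->] := is_deriveM (Dth (row (inord (nth 0%N six i)) (frame (e x)))) (is_derive_cst c x _).
  rewrite (_ : nth 0%N six i = i); last exact: (nth_iota 0%N 0 (ltn_ord i)).
  by rewrite scaler0 add0r mulrC.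
by apply: eq_ext => // q sq q6; exact: hodge1_basis.
Qed.

End CodifferentialOneForm.

Section DeriveTables.
Context {R : realType}.
Variables (x v : vec R).

Let is_derive0 : is_derive x v (fun=> 0 : R) 0 := is_derive_cst 0 x v.

Lemma is_derive_su3 (o : vec R -> nat -> nat -> R) do_ i j :
  (forall p q, is_derive x v (fun y => o y p q) (do_ p q)) ->
  is_derive x v (fun y => su3 (o y) i j) (su3 do_ i j).
Proof.
move=> Do; rewrite /su3.
have sN p q : is_derive x v (fun y => - o y p q) (- do_ p q) by exact: is_deriveN.
have sNN p q p' q' : is_derive x v (fun y => - o y p q - o y p' q') (- do_ p q - do_ p' q').
  exact: is_deriveB (sN _ _) (Do _ _).
have sD p q p' q' : is_derive x v (fun y => o y p q + o y p' q') (do_ p q + do_ p' q').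
  exact: is_deriveD (Do _ _) (Do _ _).
case: i => [|[|[|[|[|[|i]]]]]]; case: j => [|[|[|[|[|[|j]]]]]].
all: first [exact: is_derive0 | exact: Do | exact: sN | exact: sNN | exact: sD].
Qed.

Lemma is_derive_skew3 (t : vec R -> nat -> nat -> nat -> R) dt i j k :
  (forall p q r, is_derive x v (fun y => t y p q r) (dt p q r)) ->
  is_derive x v (fun y => skew3 (t y) i j k) (skew3 dt i j k).
Proof.
move=> Dt; rewrite /skew3.
have sN p q r : is_derive x v (fun y => - t y p q r) (- dt p q r) by exact: is_deriveN.
case: (Nat.ltb i j); [case: (Nat.ltb j k); [|case: (Nat.eqb k j); [|case: (Nat.ltb i k);
  [|case: (Nat.eqb i k)]]] | case: (Nat.eqb i j); [| case: (Nat.ltb i k);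
  [|case:(Nat.eqb i k); [|case:(Nat.ltb j k); [|case:(Nat.eqb j k)]]]]].
all: first [exact: is_derive0 | exact: Dt | exact: sN].
Qed.

End DeriveTables.

(** * The scalar curvature formula on a coframe *)

Section ScalarFormula.
Context {R : realType}.
Variables (U : set (vec R)) (e : vec R -> 'M[R]_6) (x : vec R).
Hypotheses (oU : open U) (se : smooth_on U e) (Ux : U x).
Variables (G J : vec R -> 'M[R]_6) (P Q : vec R -> form R 3).
Hypothesis ad : forall y, U y -> adapted_at (G y) (J y) (P y) (Q y) (e y).
Hypothesis dJ : forall y, U y -> differentiable J y.
Variables (w t : vec R -> nat -> nat -> nat -> R).
Hypotheses (sw : smooth_table U w) (st : smooth_table U t).
Hypothesis rel : forall y, U y -> su3_relation (coframe_deriv e y) (w y) (t y).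

Let eU y (Uy : U y) : e y \in unitmx := adapted_unit (ad Uy).
Let nad y (Uy : U y) : \forall z \near y, adapted_at (G z) (J z) (P z) (Q z) (e z) :=
  near_open oU Uy ad.
Let dey y (Uy : U y) : differentiable e y := smooth_on_differentiable oU se Uy.
Let b y := coframe_deriv e y.
Let E (k : nat) := row (inord k) (frame (e x)).
Let F y := fundamental (G y) (J y).
Let nijf : form R 3 := lower (G x) (nijenhuis J x).
Let leef y : form R 1 := fun v => codiff (p := 1) (q := 4) erefl erefl e F y (v *m J y).

Let D (t : vec R -> nat -> nat -> nat -> R) := frame_derive e x t.

Lemma sb k i j : smooth_on U (fun y => b y k i j).
Proof. exact: (smooth_coframe_deriv oU se eU). Qed.

Lemma is_derive_frame s a k i j : smooth_table U s ->
  is_derive x (E a) (fun y => s y k i j) (D s a k i j).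
Proof. by move=> ss; apply/derivableP; exact: smooth_on_derivable (ss k i j) Ux. Qed.

Lemma sl : smooth_table U (fun y => koszul (b y)).
Proof. exact: (smooth_koszul oU (b := b) sb). Qed.

Lemma jacobi_frame i j k m : (i < 6)%N -> (j < 6)%N -> (k < 6)%N -> (m < 6)%N ->
  jacobi (koszul (b x)) (D (fun y => koszul (b y))) i j k m = 0.
Proof.
pose h i j k m := (frame (e x) *m 'D_(E i) ('D_(E j) e) x) (inord k) (inord m).
apply: (jacobi_koszul (db := D b) (h := h)) => {i j k m} [i j k m _ _ _ _|i j k m i6 j6 k6 m6|i j k m].
- have D1 := is_deriveB (is_derive_frame i k j m sl) (is_derive_frame i j k m sl).
  have D2 := is_deriveB (is_derive_frame i j k m sb) (is_derive_frame i k j m sb).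
  have aE y p q r : koszul (b y) q p r - koszul (b y) p q r = b y p q r - b y q p r.
    by rewrite /koszul; lra.
  have E2 : 'D_(E i) (fun y => b y j k m - b y k j m) x = D b i j k m - D b i k j m by case: D2.
  have E1 : 'D_(E i) (fun y => koszul (b y) k j m - koszul (b y) j k m) x =
      D (fun y => koszul (b y)) i k j m - D (fun y => koszul (b y)) i j k m by case: D1.
  apply: etrans (esym E1) (etrans _ E2); congr ('D_ _ _ _).
  by apply/funext => y; exact: aE.
- have := derive_coframe_deriv oU se eU Ux (inord i) (inord j) (inord k) (inord m).
  rewrite !inordK // => DE; apply: etrans DE _; rewrite -!sum6E /h.
  by congr (_ - _ - _); apply: eq_bigr => n _; rewrite inordK.
- by rewrite /h (deriveC_mx _ _ oU se Ux).
Qed.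

(** The truncation of [su3_normal_form] carried out at every point of U, so that the resulting
    tables can be differentiated. *)
Let w' y k := if (k < 6)%N then w y k else fun _ _ => 0.
Let t' y := trunc3 (t y).

Lemma sw' : smooth_table U w'.
Proof.
by move=> k i j; rewrite /w'; case: (k < 6)%N; [exact: sw | exact: smooth_on_cst].
Qed.

Lemma st' : smooth_table U t'.
Proof.
by move=> k i j; rewrite /t' /trunc3; case: [&& _, _ & _]; [exact: st | exact: smooth_on_cst].
Qed.

Lemma normal_form y : U y ->
  koszul (b y) = (fun k i j => su3 (w' y k) i j - skew3 (t' y) k i j) /\
  b y = (fun k i j => sym12 (fun k i j => b y k i j + koszul (b y) k i j) k i j
     - (su3 (w' y k) i j - skew3 (t' y) k i j)).
Proof. by move=> /rel/(@su3_normal_form _ (fun k i j =>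
   (frame (e y) *m 'D_(row (inord k) (frame (e y))) e y) (inord i) (inord j))). Qed.

Let theta y i : R := - sg i (2 * leet (skew3 (t' y)) (cj i)).

Lemma lee_theta y i : U y -> (i < 6)%N -> leef y (row (inord i) (frame (e y))) = theta y i.
Proof.
move=> Uy i6; rewrite /leef (lee_basis (dey Uy) (nad Uy)) // -/(b y) (normal_form Uy).2.
exact: leec_su3.
Qed.

(** The relation holds on the whole open set U, so its derivative again splits into an su(3) part
    and a skew part, as [scalc_su3] requires. *)
Lemma derive_koszul : D (fun y => koszul (b y)) =
  (fun a k i j => su3 (D w' a k) i j - skew3 (D t' a) k i j).
Proof.
apply/funext => a; apply/funext => k; apply/funext => i; apply/funext => j.
have D1 := is_derive_su3 i j (fun p q => is_derive_frame a k p q sw').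
have D2 := is_derive_skew3 k i j (fun p q r => is_derive_frame a p q r st').
have [_ <-] := is_deriveB D1 D2; apply: near_eq_derive; apply: (near_open oU Ux) => y Uy.
by rewrite (normal_form Uy).1.
Qed.

Lemma derive_theta a i :
  is_derive x (E a) (fun y => theta y i) (- sg i (2 * leet (skew3 (D t' a)) (cj i))).
Proof.
have D2 k i' j := is_derive_skew3 k i' j (fun p q r => is_derive_frame a p q r st').
have DL k := is_deriveD (is_deriveD (D2 k 0%N 1%N) (D2 k 2%N 3%N)) (D2 k 4%N 5%N).
have D2L k := is_deriveM (is_derive_cst (2 : R) x (E a)) (DL k).
have {D2L} DM k : is_derive x (E a) (fun y => 2 * leet (skew3 (t' y)) k)
    (2 * leet (skew3 (D t' a)) k).
  by apply: is_derive_eq (D2L k) _; rewrite scaler0 addr0.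
by rewrite /theta /sg; case: Nat.odd; do ?apply: is_deriveN.
Qed.

Lemma smooth_theta i : smooth_on U (fun y => theta y i).
Proof.
have sk := smooth_skew3 oU st'.
have sL k : smooth_on U (fun y => leet (skew3 (t' y)) k).
  apply: (smooth_onD oU _ (sk _ _ _)).
  exact: (smooth_onD oU (sk _ _ _) (sk _ _ _)).
have sM : smooth_on U (fun y => 2 * leet (skew3 (t' y)) (cj i)).
  by apply: (smooth_onM oU _ (sL _)); exact: smooth_on_cst.
by rewrite /theta /sg; case: Nat.odd; do ?apply: (smooth_onN oU).
Qed.

Lemma scalar_curvature_su3 (T : form R 3) :
  (forall i j k, (i < 6)%N -> (j < 6)%N -> (k < 6)%N ->
     T (basis 3 (frame (e x)) [:: i; j; k]) = 2 * skew3 (t x) i j k) ->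
  scalar_curvature G (e x) x =
    8^-1 * inner (e x) nijf (P x) ^+ 2 + 8^-1 * inner (e x) nijf (Q x) ^+ 2
    + 2 * inner (e x) (leef x) (leef x) - 12^-1 * sqnorm3 (e x) T
    + 3 * codiff (p := 0) (q := 5) erefl erefl e leef x 0.
Proof.
move=> TE; have [lE bE] := normal_form Ux.
have J0 : forall i j k m, (i < 6)%N -> (j < 6)%N -> (k < 6)%N -> (m < 6)%N ->
    jacobi (fun k i j => su3 (w' x k) i j - skew3 (t' x) k i j)
      (fun a k i j => su3 (D w' a k) i j - skew3 (D t' a) k i j) i j k m = 0.
  by rewrite -lE -derive_koszul; exact: jacobi_frame.
rewrite (scalar_curvature_frame oU se Ux ad).
have -> : scalc (koszul (b x)) (frame_derive e x (fun y => koszul (b y))) =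
    scalc (fun k i j => su3 (w' x k) i j - skew3 (t' x) k i j)
      (fun a k i j => su3 (D w' a k) i j - skew3 (D t' a) k i j).
  by rewrite -derive_koszul -lE.
rewrite (scalc_su3 (fun k i j => b x k i j + koszul (b x) k i j) J0) -bE.
have -> : inner (e x) nijf (P x) = 8 * dotP (t' x).
  by rewrite (dotP_nij (dey Ux) (dJ Ux) (nad Ux)) -/(b x) bE dotP_nijc_su3.
have -> : inner (e x) nijf (Q x) = 8 * dotQ (t' x).
  by rewrite (dotQ_nij (dey Ux) (dJ Ux) (nad Ux)) -/(b x) bE dotQ_nijc_su3.
have -> : inner (e x) (leef x) (leef x) = sum6 (fun i => theta x i ^+ 2).
  by rewrite inner1_codes /sum6 !lee_theta // !expr2.
(* T = 2t, so the square norm is four times that of t, which turns the 3^-1 of [scalc_su3] into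
   12^-1. *)
have -> : sqnorm3 (e x) T = 4 * sum6 (fun i => sum6 (fun j => sum6 (fun k => skew3 (t' x) i j k ^+ 2))).
  have TE' i j k : (i < 6)%N -> (j < 6)%N -> (k < 6)%N ->
     T (basis 3 (frame (e x)) [:: i; j; k]) ^+ 2 = 4 * skew3 (t' x) i j k ^+ 2.
    move=> i6 j6 k6; rewrite TE //.
    have -> : skew3 (t' x) i j k = skew3 (t x) i j k by rewrite skew3_trunc3 i6 j6 k6.
    by rewrite exprMn; congr (_ * _); rewrite expr2 -natrM.
  rewrite sqnorm3_codes -!sum6E mulr_sumr; apply: eq_bigr => i _.
  rewrite -!sum6E mulr_sumr; apply: eq_bigr => j _.
  by rewrite -!sum6E mulr_sumr; apply: eq_bigr => k _; rewrite TE'.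
rewrite (codiff_one_form oU se eU Ux (th := theta)); last first.
- exact: smooth_theta.
- by move=> y Uy i; exact: lee_theta.
- by move=> y Uy; exact: (lee_is_form G J e y).
have -> : codiff1 (coframe_deriv e x) (theta x)
      (fun a i => 'D_(row (inord a) (frame (e x))) (fun y => theta y i) x)
   = codiff1 (b x) (theta x) (fun a i => - sg i (2 * leet (skew3 (D t' a)) (cj i))).
  congr codiff1; apply/funext => a; apply/funext => i.
  by have [_ ->] := derive_theta a i.
move: (dotP _) (dotQ _) (sum6 _) (sum6 _) (codiff1 _ _ _) => p q r s c.
by field.
Qed.

End ScalarFormula.

Lemma codiff1_0 (R : realFieldType) (b : nat -> nat -> nat -> R) :
  codiff1 b (fun _ => 0) (fun _ _ => 0) = 0.
Proof. by tab; ring. Qed.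

(** * Torsion and scalar curvature on the manifold *)

Section Formulas.
Context {R : realType} {M : manifold6 R} (S : su3_structure M).
Hypotheses (sN : skew_nijenhuis S) (sP : structure_eq S (Psip S)) (sQ : structure_eq S (Psim S)).
Variables (nabla : connection_data M) (c : index M) (U : set (vec R)) (e : vec R -> 'M[R]_6).
Variable (x : vec R).
Hypotheses (cn : su3_connection_skew_torsion S nabla) (aU : adapted S c U e) (Ux : U x).

Let b y := coframe_deriv e y.

(** By uniqueness [nabla] is the connection built from [half_torsion], so its torsion can be read
    off from that table. *)
Lemma torsion_form_canonical i j k : (i < 6)%N -> (j < 6)%N -> (k < 6)%N ->
  torsion_form S nabla c x (basis 3 (frame (e x)) [:: i; j; k])
  = 2 * skew3 (half_torsion (koszul (b x))) i j k.
Proof.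
have [cx de ad] := adapted_near aU Ux.
have rel := canonical_relation sN sP sQ aU Ux.
have -> : torsion_form S nabla c x =
    lower (met S c x) (torsion (fun _ => christoffel e x (su3_part (koszul (b x)))) x).
  congr lower; apply/funext => v; apply/funext => u; rewrite !torsionE.
  have -> : nabla c x = christoffel e x (su3_part (koszul (b x))) => //.
  exact: (su3_point_unique cx (connection_su3_point cn cx) (canonical_su3_point sN sP sQ aU Ux)).
move=> i6 j6 k6; rewrite (torsion_basis ad (Om := su3_mx e x (su3_part (koszul (b x))))) //.
by rewrite !(su3_mx_basis ad) //; exact: (torsion_of_koszul rel).
Qed.

Lemma torsion_form_eq (m : 'M[R]_(3, 6)) :
  torsion_form S nabla c x m =
   - hodge (p := 3) (q := 3) erefl (e x) (ext_deriv (fund S c) x) m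
   + hodge (p := 3) (q := 3) erefl (e x) (wedge (lee S c e x) (fund S c x)) m
   + 4^-1 * inner (e x) (nij S c x) (Psip S c x) * Psip S c x m
   + 4^-1 * inner (e x) (nij S c x) (Psim S c x) * Psim S c x m.
Proof.
have [cx de ad] := adapted_near aU Ux.
have fT : is_form (torsion_form S nabla c x) by have [_ H] := cn; have [] := H c x cx.
exact: (torsion_formula de (acs_differentiable S cx) ad (canonical_relation sN sP sQ aU Ux) fT
  torsion_form_canonical).
Qed.

Lemma scal_eq : scal S c e x =
  8^-1 * inner (e x) (nij S c x) (Psip S c x) ^+ 2
  + 8^-1 * inner (e x) (nij S c x) (Psim S c x) ^+ 2
  + 2 * inner (e x) (lee S c e x) (lee S c e x)
  - 12^-1 * sqnorm3 (e x) (torsion_form S nabla c x)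
  + 3 * codiff_lee S c e x.
Proof.
have [oU Uc se ad] := aU.
have eU y : U y -> e y \in unitmx by move=> /ad/adapted_unit.
have sl : smooth_table U (fun y => koszul (b y)).
  by apply: (smooth_koszul oU (b := b)) => k i j; exact: smooth_coframe_deriv.
have dJ y : U y -> differentiable (acs S c) y by move=> /Uc; exact: acs_differentiable.
have rel y : U y -> su3_relation (b y) (su3_part (koszul (b y))) (half_torsion (koszul (b y))).
  by move=> Uy; exact: (canonical_relation sN sP sQ aU Uy).
exact: (scalar_curvature_su3 oU se Ux ad dJ (smooth_su3_part oU sl) (smooth_half_torsion oU sl) rel
  torsion_form_canonical).
Qed.

(** In the scalar curvature formula only the term -|T|^2 / 12 is left. *)
Lemma scal_le0 : (forall y, cod (atlas c) y -> forall u v, nijenhuis (acs S c) y u v = 0) ->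
  (forall y, U y -> forall v, lee S c e y v = 0) -> scal S c e x <= 0.
Proof.
move=> N0 th0; have [oU Uc se ad] := aU.
have n0 m : nij S c x m = 0 by rewrite /nij /lower N0 ?/bilin ?mul0mx ?mxE //; exact: Uc.
have inner0 k (a b' : form R k) : (forall m, a m = 0) -> inner (e x) a b' = 0.
  by move=> a0; rewrite /inner big1 // => f _; rewrite a0 mul0r.
(* The codifferential differentiates theta, so the vanishing of theta is used on all of U and not
   just at x. *)
have codiff0 : codiff_lee S c e x = 0.
  have eU y : U y -> e y \in unitmx by move=> /ad/adapted_unit.
  rewrite /codiff_lee (codiff_one_form oU se eU Ux (th := fun _ _ => 0)).
  - have -> : (fun a i : nat => 'D_(row (inord a) (frame (e x))) (fun _ : vec R => 0 : R) x) = (fun _ _ => 0).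
      by apply/funext => a; apply/funext => i; exact: derive_cst.
    by rewrite codiff1_0.
  - move=> y Uy; rewrite (_ : lee S c e y = fun _ => 0); last by apply/funext => v; exact: th0.
    by split=> [i v c' u w|//]; rewrite mulr0 addr0.
  - by move=> y Uy i i6; exact: th0.
  - by move=> i; exact: smooth_on_cst.
rewrite scal_eq codiff0 !inner0 //; last exact: th0.
rewrite expr0n /= !mulr0 !addr0 add0r oppr_le0 mulr_ge0 ?invr_ge0 ?ler0n //.
by apply: sumr_ge0 => f _; exact: sqr_ge0.
Qed.

End Formulas.

Theorem theorem4p1 (R : realType) (M : manifold6 R) (S : su3_structure M) :
  let existence_uniqueness :=
    exists nabla, su3_connection_skew_torsion S nabla /\
      forall nabla', su3_connection_skew_torsion S nabla' ->
        connection_eq nabla nabla' in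
  let conditions :=
    [/\ skew_nijenhuis S, structure_eq S (Psip S) & structure_eq S (Psim S)] in
  [/\ existence_uniqueness <-> conditions,
      conditions -> forall nabla, su3_connection_skew_torsion S nabla ->
        forall c U e, adapted S c U e -> forall x, U x ->
          (forall m : 'M[R]_(3, 6),
             torsion_form S nabla c x m =
             - hodge (p := 3) (q := 3) erefl (e x) (ext_deriv (fund S c) x) m
             + hodge (p := 3) (q := 3) erefl (e x)
                 (wedge (lee S c e x) (fund S c x)) m
             + 4^-1 * inner (e x) (nij S c x) (Psip S c x) * Psip S c x m
             + 4^-1 * inner (e x) (nij S c x) (Psim S c x) * Psim S c x m) /\
          scal S c e x =
            8^-1 * inner (e x) (nij S c x) (Psip S c x) ^+ 2
            + 8^-1 * inner (e x) (nij S c x) (Psim S c x) ^+ 2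
            + 2 * inner (e x) (lee S c e x) (lee S c e x)
            - 12^-1 * sqnorm3 (e x) (torsion_form S nabla c x)
            + 3 * codiff_lee S c e x
    & conditions ->
        (forall c x, cod (atlas c) x -> forall u v, nijenhuis (acs S c) x u v = 0) ->
        (forall c U e, adapted S c U e -> forall x, U x -> forall v, lee S c e x v = 0) ->
        forall c U e, adapted S c U e -> forall x, U x -> scal S c e x <= 0].
Proof.
move=> existence_uniqueness conditions.
split=> [|[sN sP sQ] nabla cn c U e aU x Ux|[sN sP sQ] N0 th0 c U e aU x Ux].
- split=> [[nabla [cn _]]|[sN sP sQ]].
    apply: su3_point_conditions => c x cx; exists (nabla c).
    exact: connection_su3_point cn c x cx.
  exists (su3_nabla S); split; first exact: su3_nabla_connection.
  move=> nabla'; apply: su3_connection_unique; exact: su3_nabla_connection.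
- by split=> [m|]; [exact: (torsion_form_eq sN sP sQ cn aU Ux) | exact: (scal_eq sN sP sQ cn aU Ux)].
(* The inequality mentions no connection; the formula is applied to the one constructed from the
   conditions. *)
- apply: (scal_le0 sN sP sQ (su3_nabla_connection sN sP sQ) aU Ux (N0 c)).
  by move=> y Uy; exact: th0 aU y Uy.
Qed.
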